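(* Let $F\colon S(n)\to\mathbb{R}$ be sublinear and uniformly elliptic with associated convex body $\mathcal{K}\subseteq S(n)$, let $\Omega\subseteq\mathbb{R}^n$ be nonempty and open, and let $u\colon\Omega\to(-\infty,\infty]$. Then $u$ is a viscosity supersolution of $F(\mathcal{H}w)=0$ in $\Omega$ if and only if $u\not\equiv\infty$ is lower semicontinuous and for each $y_0\in\Omega$ and every $\epsilon>0$ such that $\bigcup_{Z\in\mathcal{K}}\mathcal{E}_Z(y_0,\epsilon)\subseteq\Omega$, we have \[\sup_{Z\in\mathcal{K}}\frac{1}{|\mathcal{E}_Z(y_0,\epsilon)|}\int_{\mathcal{E}_Z(y_0,\epsilon)}u(y)\,dy\leq u(y_0).\]
   Context: Here $n\geq 2$ and $S(n)$ is the space of symmetric real $n\times n$ matrices with inner product $\langle X,Y\rangle=\operatorname{tr}(XY)$, partially ordered by $X\leq Y$ iff $\xi^TX\xi\leq\xi^TY\xi$ for all $\xi\in\mathbb{R}^n$; $\mathcal{H}w$ is the Hessian matrix of $w$. $F$ is sublinear if $F(X+Y)\leq F(X)+F(Y)$ and $F(tX)=tF(X)$ for all $X,Y\in S(n)$, $t\geq 0$. $F$ is uniformly elliptic if there are constants $0<\lambda\leq\Lambda$ such that $\lambda\operatorname{tr}A\leq F(X+A)-F(X)\leq\Lambda\operatorname{tr}A$ for all $X,A\in S(n)$ with $A\geq 0$. The associated convex body of a sublinear $F$ is the unique nonempty compact convex set $\mathcal{K}\subseteq S(n)$ with $F(X)=\max_{Y\in\mathcal{K}}\langle Y,X\rangle$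 for all $X$; when $F$ is uniformly elliptic, every $Z\in\mathcal{K}$ is positive definite. For positive definite $Z$, $y_0\in\mathbb{R}^n$ and $\epsilon>0$, $\mathcal{E}_Z(y_0,\epsilon):=\{y\in\mathbb{R}^n\;|\;(y-y_0)^TZ^{-1}(y-y_0)<\epsilon^2\}$ is a solid ellipsoid. Integrals are Lebesgue integrals and $|D|$ is the Lebesgue measure of $D$. A viscosity supersolution of $F(\mathcal{H}w)=0$ in $\Omega$ is a function $u\colon\Omega\to(-\infty,\infty]$ that is lower semicontinuous, finite on a dense subset of $\Omega$, and such that whenever $x_0\in\Omega$ and a $C^2$ function $\phi$ satisfies $\phi(x_0)=u(x_0)$ and $\phi\leq u$ near $x_0$, then $F(\mathcal{H}\phi(x_0))\leq 0$.
   Formalization: ''u ≢ ∞'' is required on each connected component of Ω (u = 0 on one component and ∞ on another refutes the literal claim); a mean whose integral is undefined (positive and negative parts both infinite) counts as −∞. *)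

(* Defs.v *)
(* Stated over MathComp and MathComp-Analysis. *)
From HB Require Import structures.
From mathcomp Require Import all_boot all_order all_algebra.
From mathcomp Require Import all_classical all_reals all_analysis.

Set Implicit Arguments.
Unset Strict Implicit.
Unset Printing Implicit Defensive.

Import Order.TTheory GRing.Theory Num.Theory.
Import numFieldNormedType.Exports.

Local Open Scope classical_set_scope.
Local Open Scope ring_scope.

Section cV_measurable.
Context {d : measure_display} {T : measurableType d} (n : nat).

Let coor (i : 'I_n) (v : 'cV[T]_n) : T := v i ord0.

Let cV_set0 : g_sigma_preimage coor set0.
Proof. exact: sigma_algebra0. Qed.

Let cV_setC A : g_sigma_preimage coor A -> g_sigma_preimage coor (~` A).
Proof. exact: sigma_algebraC. Qed.

Let cV_bigcup (F : _^nat) : (forall i, g_sigma_preimage coor (F i)) ->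
  g_sigma_preimage coor (\bigcup_i (F i)).
Proof. exact: sigma_algebra_bigcup. Qed.

(* The product sigma-algebra on column vectors, as the library does for
   n.-tuple T; for T the real line these are the Borel sets of R^n. *)
HB.instance Definition _ := @isMeasurable.Build (measure_tuple_display d)
  'M[T]_(n, 1) (g_sigma_preimage coor) cV_set0 cV_setC cV_bigcup.

Lemma measurable_coor (i : 'I_n) :
  measurable_fun [set: 'cV[T]_n] (fun v => v i ord0).
Proof.
move=> _ Y mY; rewrite setTI; apply: sub_sigma_algebra => /=.
rewrite -bigcup_seq/=; exists i => /=; first by rewrite mem_index_enum.
by exists Y => //; rewrite setTI.
Qed.

Lemma measurable_fun_cV d1 (T1 : measurableType d1) (f : T1 -> 'cV[T]_n) :
  (forall i, measurable_fun [set: T1] (fun x => f x i ord0)) ->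
  measurable_fun [set: T1] f.
Proof.
move=> mf _ A mA; rewrite setTI; move: A mA.
pose G := [set A : set 'cV[T]_n | measurable (f @^-1` A)].
have GP : sigma_algebra setT G.
  split.
  - by rewrite /G/= preimage_set0.
  - by move=> A GA; rewrite /G/= setTD preimage_setC; exact: measurableC.
  - by move=> F GF; rewrite /G/= preimage_bigcup; apply: bigcupT_measurable.
apply: smallest_sub; first exact: GP.
rewrite -bigcup_seq => A [i _ [B mB <-]].
by rewrite /G/= setTI -[X in measurable X]setTI; exact: mf.
Qed.

End cV_measurable.

Section lebesgue_cV.
Context {R : realType}.

Definition cV_cons n (x : measurableTypeR R * 'cV[R]_n) : 'cV[R]_n.+1 :=
  \col_i oapp (fun j => x.2 j ord0) x.1 (unlift ord0 i).

Definition cV_uncons n (v : 'cV[R]_n.+1) : measurableTypeR R * 'cV[R]_n :=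
  (v ord0 ord0, \col_j v (lift ord0 j) ord0).

Lemma cV_consK n : cancel (@cV_cons n) (@cV_uncons n).
Proof.
move=> [x v]; rewrite /cV_uncons mxE unlift_none/=; congr pair.
by apply/colP => i; rewrite !mxE liftK.
Qed.

Lemma cV_unconsK n : cancel (@cV_uncons n) (@cV_cons n).
Proof.
by move=> v; apply/colP => i; rewrite mxE; case: unliftP => [j|] ->//=; rewrite mxE.
Qed.

Lemma measurable_cV_cons n :
  measurable_fun [set: measurableTypeR R * 'cV[R]_n] (@cV_cons n).
Proof.
apply: measurable_fun_cV => i.
under eq_fun do rewrite mxE.
case: unliftP => [j _|_] /=; last exact: measurable_fst.
exact: (measurableT_comp (measurable_coor j) measurable_snd).
Qed.

Lemma measurable_cV_uncons n :
  measurable_fun [set: 'cV[R]_n.+1] (@cV_uncons n).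
Proof.
apply/measurable_fun_pairP; split; first exact: measurable_coor.
apply: measurable_fun_cV => i.
under eq_fun do rewrite mxE.
exact: measurable_coor.
Qed.

Section step.
Variables (n : nat) (mu : {sigma_finite_measure set 'cV[R]_n -> \bar R}).

Let nu := [the {measure set _ -> \bar R} of (@lebesgue_measure R \x mu)%E].

Definition lebesgue_cV_step : set 'cV[R]_n.+1 -> \bar R :=
  pushforward (@lebesgue_measure R \x mu)%E (@cV_cons n).

HB.instance Definition _ := Measure.copy lebesgue_cV_step
  (measure_function_pushforward__canonical__measure_function_Measure
    nu (@measurable_cV_cons n)).

Let lebesgue_cV_step_sigma_finite : sigma_finite setT lebesgue_cV_step.
Proof.
have /sigma_finiteP[F [TF ndF Foo]] := sigma_finiteT (@lebesgue_measure R).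
have /sigma_finiteP[G [TG ndG Goo]] := sigma_finiteT mu.
exists (fun k => @cV_uncons n @^-1` (F k `*` G k)).
  rewrite -preimage_bigcup -[LHS](preimage_setT (@cV_uncons n)); congr (_ @^-1` _).
  rewrite -setXTT TF TG predeqE => -[x y]; split.
    move=> [/= [i _ Fx] [j _ Gy]]; exists (maxn i j) => //; split.
    - by move: x Fx; exact/subsetPset/ndF/leq_maxl.
    - by move: y Gy; exact/subsetPset/ndG/leq_maxr.
  by move=> [i _ []/= ? ?]; split; exists i.
move=> k; have [? ?] := Foo k; have [? ?] := Goo k.
have FG : measurable (F k `*` G k) by exact: measurableX.
split; first by rewrite -[X in measurable X]setTI; exact: measurable_cV_uncons.
rewrite /lebesgue_cV_step /pushforward -comp_preimage.
rewrite (_ : _ \o _ = id); last by apply/funext => x; exact: cV_consK.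
by rewrite preimage_id product_measure1E// lte_mul_pinfty// ge0_fin_numE.
Qed.

HB.instance Definition _ := Measure_isSigmaFinite.Build _ _ _
  lebesgue_cV_step lebesgue_cV_step_sigma_finite.

End step.

(* Lebesgue measure on R^n, on the Borel sets: the n-fold product of the
   one-dimensional Lebesgue measure. *)
Fixpoint lebesgue_cV n : {sigma_finite_measure set 'cV[R]_n -> \bar R} :=
  if n is n'.+1 then lebesgue_cV_step (lebesgue_cV n')
  else \d_(0 : 'cV[R]_0).

Lemma lebesgue_cV_box n (A : 'I_n -> set R) :
  (forall i, measurable (A i)) ->
  lebesgue_cV n [set v | forall i, A i (v i ord0)] =
  (\prod_(i < n) lebesgue_measure (A i))%E.
Proof.
elim: n A => [|n IHn] A mA.
  by rewrite big_ord0 /= diracE mem_set// => -[].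
pose B := [set v : 'cV[R]_n | forall i, A (lift ord0 i) (v i ord0)].
have mB : measurable B.
  rewrite (_ : B = \bigcap_(i in [set: 'I_n])
      ((fun v : 'cV[R]_n => v i ord0) @^-1` A (lift ord0 i))).
    apply: fin_bigcap_measurable => // i _.
    by rewrite -[X in measurable X]setTI; exact: measurable_coor.
  by apply/seteqP; split => v /= + i => /(_ i) //; exact.
rewrite big_ord_recl -(IHn (fun i => A (lift ord0 i)))//.
rewrite -(product_measure1E _ _ _ mB)//; last exact: mA.
rewrite /= /lebesgue_cV_step /pushforward; congr (_ _).
apply/seteqP; split => [[x v] /= Av|[x v] /= [Ax Av] i].
  split=> [|i]; first by have := Av ord0; rewrite mxE unlift_none.
  by have := Av (lift ord0 i); rewrite mxE liftK.
by rewrite mxE; case: unliftP => [j|] ->.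
Qed.

End lebesgue_cV.
Arguments lebesgue_cV {R} n.

Section sublinear_elliptic.
Context {R : realType} {n : nat}.
Implicit Types (X Y A Z : 'M[R]_n) (K : set 'M[R]_n) (F : 'M[R]_n -> R).
Implicit Types (x y : 'cV[R]_n) (U Omega : set 'cV[R]_n).
Implicit Types (phi : 'cV[R]_n -> R) (u : 'cV[R]_n -> \bar R).

Definition Sym : set 'M[R]_n := [set X | X^T = X].

Definition mx_inner X Y : R := \tr (X *m Y).

Definition quad_form X (xi : 'cV[R]_n) : R := (xi^T *m X *m xi) ord0 ord0.

Definition mx_le X Y := forall xi : 'cV[R]_n, quad_form X xi <= quad_form Y xi.

(* An operator on symmetric matrices is represented by a function on all square
   matrices; its values outside Sym are never used. *)
Definition sublinear F :=
  (forall X Y, Sym X -> Sym Y -> F (X + Y) <= F X + F Y) /\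
  (forall (t : R) X, 0 <= t -> Sym X -> F (t *: X) = t * F X).

Definition uniformly_elliptic F :=
  exists lambda Lambda : R, 0 < lambda <= Lambda /\
    forall X A, Sym X -> Sym A -> mx_le 0 A ->
      lambda * \tr A <= F (X + A) - F X <= Lambda * \tr A.

(* F is the support function of K, with the maximum attained; at most one such
   K exists. *)
Definition associated_convex_body F K :=
  [/\ K !=set0, compact K, convex_set K, K `<=` Sym &
    forall X, Sym X ->
      (exists2 Y, K Y & F X = mx_inner Y X) /\
      (forall Y, K Y -> mx_inner Y X <= F X)].

Definition ellipsoid Z (y0 : 'cV[R]_n) (eps : R) : set 'cV[R]_n :=
  [set y | quad_form (invmx Z) (y - y0) < eps ^+ 2].

Definition partial (i : 'I_n) phi : 'cV[R]_n -> R :=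
  fun x => 'D_(delta_mx i ord0) phi x.

Definition C1_on U phi := forall (i : 'I_n) x, U x ->
  derivable phi x (delta_mx i ord0) /\ {for x, continuous (partial i phi)}.

Definition C2_on U phi :=
  C1_on U phi /\ forall i : 'I_n, C1_on U (partial i phi).

Definition hessian phi x : 'M[R]_n :=
  \matrix_(i, j) partial i (partial j phi) x.

(* A function on Omega is represented by a function on R^n; its values outside
   the open set Omega are never used. *)
Definition lsc_on Omega u :=
  lower_semicontinuous (u : subspace Omega -> \bar R).

Definition finite_on_dense_subset Omega u :=
  Omega `<=` closure (Omega `&` [set x | u x \is a fin_num]).

Definition viscosity_supersolution F Omega u :=
  [/\ lsc_on Omega u,
      finite_on_dense_subset Omega u &
      forall (x0 : 'cV[R]_n) (U : set 'cV[R]_n) (phi : 'cV[R]_n -> R),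
        Omega x0 -> open U -> U x0 -> C2_on U phi ->
        (phi x0)%:E = u x0 -> (\forall x \near x0, ((phi x)%:E <= u x)%E) ->
        F (hessian phi x0) <= 0].

(* The condition "u is not identically +oo". It is required on each connected
   component of Omega, since the components do not interact: a function equal
   to 0 on one component and to +oo on another one has the sub-mean value
   property without being finite on a dense subset. *)
Definition not_identically_pinfty Omega u :=
  forall x, Omega x ->
    exists2 y, connected_component Omega x y & u y != +oo%E.

(* An integral whose positive and negative parts are both infinite is -oo in the
   library, so for such an ellipsoid a bound from above imposes nothing. *)
Definition mean_value (E : set 'cV[R]_n) u : \bar R :=
  ((lebesgue_cV n E)^-1 * \int[lebesgue_cV n]_(y in E) u y)%E.

End sublinear_elliptic.

(* Main.v *)
(** Write [q] for the quadratic form of the inverse of a matrix [Z] of [K], and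
    [L] for the operator [tr (Z D^2 .)], which [F] dominates.

    A polynomial [p] is a sum of terms [q ^ j * h] with [h] homogeneous and
    [L h = 0] (Fischer).  Replacing [q ^ j] by [s ^ j] gives the [L]-harmonic
    polynomial [H s] that agrees with [p] on [q = s].  The divergence theorem
    kills the integrals over [q < s] of the terms with [h] of positive degree,
    so that the integral of [p] over an ellipsoid equals that of
    [y |-> H (q y) 0], without any surface measure.  If [p < u] on the closed
    ellipsoid and [u] is a viscosity supersolution, then comparison with
    [H s + delta (q - s)] yields [H s 0 <= u 0], hence the mean value inequality
    for [p].  A lower semicontinuous [u] is an increasing limit of maxima of
    paraboloids, which are uniform limits of polynomials.

    Conversely, if [phi] of class C2 touches [u] from below at [x0] and
    [F (D^2 phi x0) = tr (Z D^2 phi x0) > 0] for some [Z] in [K], then a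
    second-order Taylor minorant of [phi] has mean larger than [u x0] over small
    ellipsoids.  The interior of the set where [u] is infinite is relatively
    closed, because an ellipsoid that meets it has infinite mean; this gives
    finiteness on a dense set. *)
Require Import Defs.
From mathcomp Require Import all_boot all_order all_algebra.
From mathcomp Require Import all_classical all_reals all_analysis.
From mathcomp Require Import measurable_realfun ring lra.
Import Order.TTheory GRing.Theory Num.Theory numFieldNormedType.Exports.
Set Implicit Arguments.
Unset Strict Implicit.
Unset Printing Implicit Defensive.
Local Open Scope classical_set_scope.
Local Open Scope ring_scope.

(** * Lebesgue measure *)

Section translation.
Context {R : realType}.

(** For a fixed [Z] in [K] the forward direction is linear: [F >= L] passes the viscosity inequality
    on to [L], and the supremum over [K] comes last. The converse takes the [Z] that attains [F] at
    the Hessian. Ellipticity bounds the eigenvalues on [K]: the lower bound makes [Z] invertible,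
    the upper one makes the ellipsoids shrink uniformly in [Z]. With integrals over solid ellipsoids
    only, the divergence theorem is applied to fields with the weight [(s - q)^2] cut off at 0,
    where it reduces to translation invariance. The weight is then removed in two stages:
    differentiation lowers it to [s - q], and comparing two levels [s] lowers it to 1. The closed
    ellipsoid may leave [Omega], and on the open one the negative part of [u] may have infinite
    integral. The estimates therefore run on [q < s] with [s < eps^2] and compare the positive and
    negative parts of [u - c], a form that survives exhaustion. The term [delta (q - s)] makes the
    comparison function strictly [L]-subharmonic, so that contact contradicts the viscosity
    inequality. *)

Lemma lebesgue_measure_shift (a : R) (A : set R) : measurable A ->
  lebesgue_measure ((fun x => x + a) @^-1` A) = lebesgue_measure A.
Proof.
move=> mA.
have mf : measurable_fun [set: measurableTypeR R]
    (fun x : measurableTypeR R => x + a : measurableTypeR R).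
  by apply: measurable_funD.
have := @lebesgue_measure_unique R
  (measure_function_pushforward__canonical__measure_function_Measure
     (@lebesgue_measure R) mf) _ A mA.
move=> /= -> // _ [[b c] _ <-] /=.
rewrite /pushforward.
have -> : (fun x : measurableTypeR R => x + a : measurableTypeR R) @^-1`
    `]b, c]%classic = `](b - a), (c - a)]%classic.
  by apply/seteqP; split=> x /=; rewrite !in_itv/= ltrBlDr lerBrDr.
rewrite !lebesgue_measure_itv/= !lte_fin ltrD2r.
by case: ifP => // _; rewrite -!EFinB; congr EFin; ring.
Qed.

Lemma measurable_shift n (v : 'cV[R]_n) :
  measurable_fun [set: 'cV[R]_n] (fun x => x + v).
Proof.
apply: measurable_fun_cV => i.
under eq_fun do rewrite mxE.
by apply: measurable_funD => //; exact: measurable_coor.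
Qed.

(** Induction on the dimension: a shift acts separately on the first coordinate and on the others,
    and a measure with the right values on rectangles is the product measure. *)
Lemma lebesgue_cV_shift n (v : 'cV[R]_n) (A : set 'cV[R]_n) : measurable A ->
  lebesgue_cV n ((fun x => x + v) @^-1` A) = lebesgue_cV n A.
Proof.
elim: n v A => [|n IHn] v A mA.
  congr (_ _); apply/seteqP; split => x /=;
    by rewrite (_ : x + v = x)//; apply/colP => -[].
pose w : 'cV[R]_n := \col_j v (lift ord0 j) ord0.
have mS : measurable_fun [set: measurableTypeR R * 'cV[R]_n]
   (fun p => (p.1 + v ord0 ord0 : measurableTypeR R, p.2 + w)).
  apply/measurable_fun_pairP; split.
    by apply: measurable_funD => //; exact: measurable_fst.
  exact: (measurableT_comp (measurable_shift w) measurable_snd).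
have mB : measurable (@cV_cons R n @^-1` A).
  by rewrite -[X in measurable X]setTI; exact: measurable_cV_cons.
rewrite /= /lebesgue_cV_step /pushforward.
rewrite [RHS](@product_measure_unique _ _ _ _ _ lebesgue_measure (lebesgue_cV n)
  (measure_function_pushforward__canonical__measure_function_Measure
     (@lebesgue_measure R \x lebesgue_cV n)%E mS))//=.
- rewrite /pushforward; congr (_ _); apply/seteqP; split => -[x y] /=;
  rewrite (_ : cV_cons _ + v = cV_cons (x + v ord0 ord0, y + w))//;
  apply/colP => i; rewrite !mxE; case: unliftP => [j|] -> /=; by rewrite ?mxE.
- move=> B C mB' mC; rewrite /pushforward.
  rewrite (_ : _ @^-1` _ = ((fun x => x + v ord0 ord0) @^-1` B) `*`
      ((fun y => y + w) @^-1` C)); last by apply/seteqP; split.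
  have mB1 : measurable ((fun x => x + v ord0 ord0) @^-1` B).
    rewrite -[X in measurable X]setTI.
    by apply: (measurable_funD (f := @id (measurableTypeR R))).
  have mC1 : measurable ((fun y => y + w) @^-1` C).
    by rewrite -[X in measurable X]setTI; exact: measurable_shift.
  rewrite product_measure1E// IHn//; congr (_ * _)%E.
  exact: lebesgue_measure_shift.
Qed.

(** Positive and negative parts are transported separately, so the identity also covers functions
    whose integral is infinite. *)
Lemma integral_shift n (v : 'cV[R]_n) (D : set 'cV[R]_n)
    (f : 'cV[R]_n -> \bar R) : measurable D -> measurable_fun D f ->
  (\int[lebesgue_cV n]_(x in (fun x => x + v)%R @^-1` D) f (x + v)%R =
   \int[lebesgue_cV n]_(x in D) f x)%E.
Proof.
move=> mD mf.
have ge0 (g : 'cV[R]_n -> \bar R) : measurable_fun D g ->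
    (forall x, 0 <= g x)%E ->
  (\int[lebesgue_cV n]_(x in (fun x => x + v)%R @^-1` D) g (x + v)%R =
   \int[lebesgue_cV n]_(x in D) g x)%E.
  move=> mg g0.
  have g0D : {in D, forall y, 0 <= g y}%E by move=> y _; exact: g0.
  rewrite -(@ge0_integral_pushforward _ _ _ _ _ _ (measurable_shift v)
    (lebesgue_cV n) D g)//.
  apply: (eq_measure_integral (lebesgue_cV n)
    (m1 := measure_function_pushforward__canonical__measure_function_Measure
      (lebesgue_cV n) (measurable_shift v))) => A mA _ /=.
  exact: lebesgue_cV_shift.
rewrite integralE [RHS]integralE; congr (_ - _)%E.
  rewrite -(ge0 _ (measurable_funepos mf) (funepos_ge0 f)).
  by apply: eq_integral => x _; rewrite !funeposE.
rewrite -(ge0 _ (measurable_funeneg mf) (funeneg_ge0 f)).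
by apply: eq_integral => x _; rewrite !funenegE.
Qed.

End translation.

(** * Topology and bounds *)

Section cV_topology.
Context {R : realType}.

Lemma cV_ballP n (x y : 'cV[R]_n) (e : R) :
  ball x e y <-> 0 < e /\ forall i, `|x i ord0 - y i ord0| < e.
Proof.
split=> [[e0 xy]|[e0 xy]]; first by split => // i; exact: xy.
by split => // i j; rewrite (ord1 j); exact: xy.
Qed.

Lemma cV_coor_continuous n (i : 'I_n) :
  continuous (fun v : 'cV[R]_n => v i ord0).
Proof. exact: coord_continuous. Qed.

Lemma trmx_continuous m n : continuous (@trmx R m n).
Proof.
move=> x B /nbhs_ballP[e e0 eB]; apply/nbhs_ballP; exists e => //= y [_ xy].
by apply: eB; split => // i j; rewrite !mxE; exact: xy.
Qed.

(** Heine-Borel for row vectors, carried over by transposition. *)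
Lemma cV_compact n (A : set 'cV[R]_n) (M : R) :
  (forall x, A x -> forall i, `|x i ord0| <= M) -> closed A -> compact A.
Proof.
move=> AM Acl.
have -> : A = (@trmx R 1 n) @` ((@trmx R 1 n) @^-1` A).
  apply/seteqP; split=> [x Ax|_ [x /= Ax <-]//].
  by exists x^T; rewrite /= trmxK.
apply: continuous_compact; first exact/continuous_subspaceT/trmx_continuous.
have B : closed ((@trmx R 1 n) @^-1` A).
  by apply: closed_comp => // x _; exact: trmx_continuous.
have [->|[x0 Ax0]] := eqVneq ((@trmx R 1 n) @^-1` A) set0.
  exact: compact0.
apply: bounded_closed_compact => //.
exists `|M|; split; first exact: num_real.
move=> r Mr x Ax; rewrite /= [leLHS]/Num.norm /= mx_normrE.
apply/bigmax_leP; split; first by rewrite (le_trans _ (ltW Mr)).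
move=> -[i j] _ /=; rewrite (ord1 i).
have := AM _ Ax j; rewrite mxE => /le_trans; apply.
by rewrite (le_trans (ler_norm _) (ltW Mr)).
Qed.

(** Balls of the sup norm are cubes, hence in the product sigma-algebra, and an open set is the
    union of the countably many cubes with rational centre and radius [1 / (k + 1)] that it
    contains. *)
Lemma open_measurable_cV n (A : set 'cV[R]_n) : open A -> measurable A.
Proof.
move=> oA.
pose I := ('cV[rat]_n * nat)%type.
pose ctr (i : I) : 'cV[R]_n := map_mx (@ratr R) i.1.
pose B (i : I) := [set y : 'cV[R]_n | ball (ctr i) (i.2.+1%:R^-1) y].
have mB i : measurable (B i).
  have -> : B i = \bigcap_(j in [set: 'I_n])
     ((fun v : 'cV[R]_n => v j ord0) @^-1` ball (ctr i j ord0) (i.2.+1%:R^-1)).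
    apply/seteqP; split=> [y /cV_ballP[_ h] j _|y h]; first exact: h.
    by apply/cV_ballP; split => // j; exact: h.
  apply: fin_bigcap_measurable => // j _.
  rewrite -[X in measurable X]setTI; apply: measurable_coor => //.
  by apply: (open_measurable (R := R)); exact: ball_open.
have -> : A = \bigcup_(i in [set i | B i `<=` A]) B i.
  apply/seteqP; split=> [x Ax|x [i Bi]]; last exact: Bi.
  have := oA; rewrite openE => /(_ _ Ax) /nbhs_ballP[e /= e0 eA].
  have [k ke] : exists k : nat, k.+1%:R^-1 < e / 2.
    have e20 : 0 < e / 2 by rewrite divr_gt0.
    have [k _ kP] := near_infty_natSinv_lt (PosNum e20).
    by exists k; exact: (kP k (leqnn k)).
  have c j : {q : rat | `|ratr q - x j ord0| < k.+1%:R^-1}.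
    apply: cid.
    have [q] : exists q, ratr q \in `](x j ord0 - k.+1%:R^-1),
        (x j ord0 + k.+1%:R^-1)[.
      by apply: rat_in_itvoo; rewrite ltrBlDr -addrA ltrDl addr_gt0.
    by rewrite in_itv /= -ltr_distl; exists q.
  exists (\col_j sval (c j), k) => /=.
    move=> y /cV_ballP[_ /= h]; apply: eA; apply/cV_ballP; split => // j.
    have := h j; rewrite !mxE; case: (c j) => q /= h1 h2.
    have -> : x j ord0 - y j ord0 =
       (ratr q - y j ord0) - (ratr q - x j ord0) by ring.
    rewrite (le_lt_trans (ler_normB _ _))// [ltRHS](splitr e) ltrD//;
      exact: lt_trans ke.
  apply/cV_ballP; split => //= j; rewrite !mxE; exact: (svalP (c j)).
rewrite bigcup_mkcond; apply: countable_bigcupT_measurable => [|i].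
  exact: countableP.
by case: ifP.
Qed.

Lemma continuous_measurable_cV n (f : 'cV[R]_n -> R) :
  continuous f -> measurable_fun [set: 'cV[R]_n] f.
Proof.
move=> cf; apply: (measurability _ (RGenOInfty.measurableE R)).
move=> /= _ [_ [a ->]] <-; rewrite setTI; apply: open_measurable_cV.
apply: open_comp; first by move=> x _; exact: cf.
by apply: interval_open.
Qed.

End cV_topology.

(** * Lower semicontinuous functions *)

Section lsc.
Context {R : realType} {n : nat}.
Implicit Types (u : 'cV[R]_n -> \bar R) (Omega D C : set 'cV[R]_n).

Lemma lsc_on_open Omega u : open Omega ->
  lsc_on Omega u <-> forall a, open (Omega `&` [set x | a%:E < u x]%E).
Proof.
move=> oO; rewrite /lsc_on; split.
  move=> /lower_semicontinuousP h a; have := h a.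
  by rewrite -open_setIS// setIC.
move=> h; apply/lower_semicontinuousP => a.
by have := h a; rewrite setIC -(open_setIS (A := Omega)).
Qed.

Lemma lsc_on_near Omega u : open Omega -> lsc_on Omega u ->
  forall x a, Omega x -> (a%:E < u x)%E -> \forall y \near x, (a%:E < u y)%E.
Proof.
move=> oO /(lsc_on_open _ oO) h x a Ox axu.
have := h a; rewrite openE => /(_ x (conj Ox axu)).
by apply: filterS => y [].
Qed.

Lemma lsc_on_measurable Omega u D : open Omega -> lsc_on Omega u ->
  D `<=` Omega -> measurable D -> measurable_fun D u.
Proof.
move=> oO /(lsc_on_open _ oO) h DO mD.
apply: (measurability _ (ErealGenOInfty.measurableE R)).
move=> /= _ [_ [a ->]] <-; rewrite preimage_itvoy.
rewrite -(setIidl DO) -setIA; apply: measurableI => //.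
by apply: open_measurable_cV; exact: (h a).
Qed.

Lemma ereal_between (x y : \bar R) : (x < y)%E -> exists a : R,
  (x < a%:E < y)%E.
Proof.
case: x y => [r| |] [s| |] //= h.
- by exists ((r + s) / 2); rewrite !lte_fin !midf_lt.
- by exists (r + 1); rewrite lte_fin ltrDl ltr01 ltry.
- by exists (s - 1); rewrite lte_fin ltrBlDr ltrDl ltr01 ltNyr.
- by exists 0; rewrite ltNyr ltry.
Qed.

(** If the infimum [m] were not attained, the sets [u < a] with [m < a] would generate a proper
    filter on [C]. At a cluster point [x], a level strictly between [m] and [u x] contradicts lower
    semicontinuity. *)
Lemma compact_lsc_min (C : set 'cV[R]_n) u : C !=set0 -> compact C ->
  (forall x a, C x -> (a%:E < u x)%E -> \forall y \near x, C y -> (a%:E < u y)%E) ->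
  exists2 x, C x & forall y, C y -> (u x <= u y)%E.
Proof.
move=> [c Cc] cC lscu; set m := ereal_inf (u @` C).
have mle y : C y -> (m <= u y)%E by move=> Cy; apply: ereal_inf_lbound; exists y.
apply: contrapT => nmin.
have mlt x : C x -> (m < u x)%E.
  move=> Cx; rewrite lt_neqAle mle// andbT; apply/eqP => mE; apply: nmin.
  by exists x => // y Cy; rewrite -mE mle.
pose F := filter_from [set a | (m < a)%E] (fun a => C `&` [set x | (u x < a)%E]).
have PF : ProperFilter F.
  apply: filter_from_proper.
    apply: filter_from_filter; first by exists (u c); exact: mlt.
    move=> a b /= ma mb; exists (Order.min a b); first by rewrite /= lt_min ma.
    by move=> x [Cx]; rewrite /= lt_min => /andP[? ?].
  by move=> a /= /ereal_inf_lt[_ [x Cx <-] xa]; exists x.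
have FC : F C by exists (u c); [exact: mlt|move=> x []].
have [x [Cx clx]] := cC F PF FC.
have [a /andP[ma ax]] := ereal_between (mlt _ Cx).
have Fa : F (C `&` [set x | (u x < a%:E)%E]) by exists a%:E.
have [y [[Cy ya] /(_ Cy) ay]] := clx _ _ Fa (lscu x a Cx ax).
by have := lt_trans ya ay; rewrite ltxx.
Qed.

End lsc.

Section lebesgue_cV_bounds.
Context {R : realType}.

Lemma lebesgue_cV_lty n (A : set 'cV[R]_n) (M : R) : measurable A ->
  (forall x, A x -> forall i, `|x i ord0| <= M) -> (lebesgue_cV n A < +oo)%E.
Proof.
move=> mA AM.
pose J : set R := `[- M, M]%classic.
pose B := [set v : 'cV[R]_n | forall i, J (v i ord0)].
have BE : lebesgue_cV n B = (\prod_(i < n) lebesgue_measure J)%E.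
  by apply: (lebesgue_cV_box (A := fun=> J)) => i; exact: measurable_itv.
have mB : measurable B.
  have -> : B = \bigcap_(j in [set: 'I_n])
     ((fun v : 'cV[R]_n => v j ord0) @^-1` J).
    by apply/seteqP; split=> [y h j _|y h j]; exact: h.
  apply: fin_bigcap_measurable => // j _.
  rewrite -[X in measurable X]setTI; apply: measurable_coor => //.
  exact: measurable_itv.
apply: (@le_lt_trans _ _ (lebesgue_cV n B)).
  apply: le_measure; rewrite ?inE// => x Ax i.
  by rewrite /J /= in_itv/= -ler_norml AM.
rewrite BE; suff : (\prod_(i < n) lebesgue_measure J)%E \is a fin_num.
  by rewrite fin_numElt => /andP[].
apply: (big_ind (fun x : \bar R => x \is a fin_num)) => // [x y|i _].
  exact: fin_numM.
rewrite /J lebesgue_measure_itv/=; case: ifP => _ //.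
Qed.

Lemma open_lebesgue_cV_gt0 n (A : set 'cV[R]_n) : open A -> A !=set0 ->
  (0 < lebesgue_cV n A)%E.
Proof.
move=> oA [x Ax].
have := oA; rewrite openE => /(_ _ Ax) /nbhs_ballP[e /= e0 eA].
pose J i : set R := ball (x i ord0) e.
pose B := [set v : 'cV[R]_n | forall i, J i (v i ord0)].
have BE : lebesgue_cV n B = (\prod_(i < n) lebesgue_measure (J i))%E.
  rewrite lebesgue_cV_box// => i.
  by apply: (open_measurable (R := R)); exact: ball_open.
have mA := open_measurable_cV oA.
have BS : B = ball x e.
  apply/seteqP; split => y; last by move=> /cV_ballP[].
  by move=> h; apply/cV_ballP.
have mB : measurable B by rewrite BS; apply: open_measurable_cV; exact: ball_open.
apply: (@lt_le_trans _ _ (lebesgue_cV n B)); last first.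
  by apply: le_measure; rewrite ?inE// BS.
rewrite BE; apply: (big_ind (fun x => 0 < x)%E) => // [y z|i _]; first exact: mule_gt0.
by rewrite /J lebesgue_measure_ball ?ltW// lte_fin mulrn_wgt0.
Qed.

End lebesgue_cV_bounds.

(** * Polynomial functions *)

Section polynomial_functions.
Context {R : realType} {n : nat}.
Implicit Types (f g : 'cV[R]_n -> R) (x : 'cV[R]_n) (i j k : 'I_n).

(** An inductive predicate on functions: closure under derivatives, continuity, bounds on boxes and
    the Fischer decomposition are all proved by induction on it. *)
Inductive polyf : ('cV[R]_n -> R) -> Prop :=
| polyf_cst c : polyf (fun=> c)
| polyf_coor i : polyf (fun x => x i ord0)
| polyfD f g : polyf f -> polyf g -> polyf (fun x => f x + g x)
| polyfM f g : polyf f -> polyf g -> polyf (fun x => f x * g x).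

Lemma polyf_ext f g : f =1 g -> polyf f -> polyf g.
Proof. by move=> /funext ->. Qed.

Lemma polyfZ c f : polyf f -> polyf (fun x => c * f x).
Proof. by move=> pf; exact: polyfM (polyf_cst c) pf. Qed.

Lemma polyfB f g : polyf f -> polyf g -> polyf (fun x => f x - g x).
Proof.
move=> pf pg; apply: (polyf_ext _ (polyfD pf (polyfZ (-1) pg))) => x.
by rewrite mulN1r.
Qed.

Lemma polyf_exp f m : polyf f -> polyf (fun x => f x ^+ m).
Proof.
move=> pf; elim: m => [|m IHm]; first exact: polyf_cst.
by apply: (polyf_ext _ (polyfM pf IHm)) => x; rewrite exprS.
Qed.

Lemma polyf_sum (I : finType) (F : I -> 'cV[R]_n -> R) :
  (forall a, polyf (F a)) -> polyf (fun x => \sum_a F a x).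
Proof.
move=> pF; rewrite /index_enum; elim: (Finite.enum _) => [|a s IHs].
  by apply: (polyf_ext _ (polyf_cst 0)) => x; rewrite big_nil.
by apply: (polyf_ext _ (polyfD (pF a) IHs)) => x; rewrite big_cons.
Qed.

Lemma polyf_quad_form (X : 'M[R]_n) : polyf (quad_form X).
Proof.
have pX i j : polyf (fun x => x i ord0 * X i j * x j ord0).
  apply: polyfM; last exact: polyf_coor.
  by apply: polyfM; [exact: polyf_coor|exact: polyf_cst].
have := polyf_sum (fun j => polyf_sum (fun i => pX i j)).
apply: polyf_ext => x; rewrite /quad_form mxE; apply: eq_bigr => j _.
rewrite mxE mulr_suml; apply: eq_bigr => i _; by rewrite mxE.
Qed.

Lemma is_derive_coor i x v : is_derive x v (fun y => y i ord0) (v i ord0).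
Proof.
have h : (fun t : R => t^-1 *: (((fun y : 'cV[R]_n => y i ord0) \o shift x) (t *: v) -
    x i ord0)) @ 0^' --> v i ord0.
  apply: (@cvg_trans _ ((fun=> v i ord0) @ 0^')); last exact: cvg_cst.
  apply: near_eq_cvg; near=> t.
  have t0 : t != 0 by near: t; exact: nbhs_dnbhs_neq.
  by rewrite /= /shift !mxE addrK /GRing.scale /= mulKf.
split; first by apply/cvg_ex; exists (v i ord0).
exact: cvg_lim h.
Unshelve. all: by end_near. Qed.

Lemma polyf_derivable f x v : polyf f -> derivable f x v.
Proof.
elim=> [c|i|{}f g _ df _ dg|{}f g _ df _ dg].
- exact: derivable_cst.
- by have [] := is_derive_coor i x v.
- exact: derivableD.
- exact: derivableM.
Qed.

Lemma partial_cst c i x : partial i (fun=> c) x = 0.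
Proof. by rewrite /partial derive_cst. Qed.

Lemma partial_coor j i x : partial i (fun y => y j ord0) x = (j == i)%:R.
Proof.
rewrite /partial; have [_ ->] := is_derive_coor j x (delta_mx i ord0).
by rewrite mxE eqxx andbT.
Qed.

Lemma partialD f g i x : polyf f -> polyf g ->
  partial i (fun y => f y + g y) x = partial i f x + partial i g x.
Proof. by move=> pf pg; apply: deriveD; exact: polyf_derivable. Qed.

Lemma partialM f g i x : polyf f -> polyf g ->
  partial i (fun y => f y * g y) x = f x * partial i g x + partial i f x * g x.
Proof.
move=> pf pg; rewrite /partial (deriveM (polyf_derivable pf) (polyf_derivable pg)).
by rewrite /GRing.scale /= [g x * _]mulrC.
Qed.

Lemma partialZ c f i x : polyf f ->
  partial i (fun y => c * f y) x = c * partial i f x.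
Proof.
move=> pf; rewrite (partialM _ _ (polyf_cst c) pf) partial_cst mul0r addr0 //.
Qed.

Lemma partial_sum (I : finType) (F : I -> 'cV[R]_n -> R) i x :
  (forall a, polyf (F a)) ->
  partial i (fun y => \sum_a F a y) x = \sum_a partial i (F a) x.
Proof.
move=> pF; have : polyf (fun y => \sum_a F a y) /\
    partial i (fun y => \sum_a F a y) x = \sum_a partial i (F a) x; last by case.
rewrite /index_enum; elim: (Finite.enum _) => [|a s [ps IHs]].
  under eq_fun do rewrite big_nil.
  by rewrite big_nil partial_cst; split => //; exact: polyf_cst.
under eq_fun do rewrite big_cons.
by rewrite big_cons partialD// IHs; split => //; exact: polyfD.
Qed.

Lemma polyf_partial f i : polyf f -> polyf (partial i f).
Proof.
elim=> [c|j|{}f g pf pdf pg pdg|{}f g pf pdf pg pdg].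
- by apply: (polyf_ext _ (polyf_cst 0)) => x; rewrite partial_cst.
- by apply: (polyf_ext _ (polyf_cst (j == i)%:R)) => x; rewrite partial_coor.
- by apply: (polyf_ext _ (polyfD pdf pdg)) => x; rewrite partialD.
- apply: (polyf_ext _ (polyfD (polyfM pf pdg) (polyfM pdf pg))) => x.
  by rewrite partialM.
Qed.

Lemma partialDf f g i : polyf f -> polyf g ->
  partial i (fun y => f y + g y) = (fun x => partial i f x + partial i g x).
Proof. by move=> pf pg; apply/funext => x; exact: partialD. Qed.

Lemma partialMf f g i : polyf f -> polyf g ->
  partial i (fun y => f y * g y) =
  (fun x => f x * partial i g x + partial i f x * g x).
Proof. by move=> pf pg; apply/funext => x; exact: partialM. Qed.

(** For polynomials the symmetry is algebraic, since it passes through sums and products; functions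
    of class C2 are treated in [schwarz]. *)
Lemma partial_comm f i j x : polyf f ->
  partial i (partial j f) x = partial j (partial i f) x.
Proof.
move=> pf; elim: pf x => [c|k|{}f g pf pdf pg pdg|{}f g pf pdf pg pdg] x.
- have z (l : 'I_n) : partial l (fun=> c) = (fun=> 0).
    by apply/funext => y; rewrite partial_cst.
  by rewrite !z !partial_cst.
- have z (l : 'I_n) : partial l (fun y : 'cV[R]_n => y k ord0) = (fun=> (k == l)%:R).
    by apply/funext => y; rewrite partial_coor.
  by rewrite !z !partial_cst.
- rewrite (partialDf i pf pg) (partialDf j pf pg).
  rewrite (partialD j x (polyf_partial i pf) (polyf_partial i pg)).
  by rewrite (partialD i x (polyf_partial j pf) (polyf_partial j pg)) pdf pdg.
- rewrite (partialMf i pf pg) (partialMf j pf pg).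
  have pfi := polyf_partial i pf; have pfj := polyf_partial j pf.
  have pgi := polyf_partial i pg; have pgj := polyf_partial j pg.
  rewrite (partialD j x (polyfM pf pgi) (polyfM pfi pg)).
  rewrite (partialD i x (polyfM pf pgj) (polyfM pfj pg)).
  rewrite (partialM j x pf pgi) (partialM j x pfi pg).
  rewrite (partialM i x pf pgj) (partialM i x pfj pg) pdf pdg.
  ring.
Qed.

Lemma polyf_continuous f : polyf f -> continuous f.
Proof.
elim=> [c|j|{}f g pf pdf pg pdg|{}f g pf pdf pg pdg] x.
- exact: cst_continuous.
- exact: cV_coor_continuous.
- apply: (@continuousD _ _ _ f g); [exact: pdf|exact: pdg].
- apply: (@continuousM _ _ f g); [exact: pdf|exact: pdg].
Qed.

Lemma polyf_measurable f : polyf f -> measurable_fun [set: 'cV[R]_n] f.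
Proof. move=> pf; apply: continuous_measurable_cV; exact: polyf_continuous. Qed.

Lemma polyf_C2 f U : polyf f -> C2_on U f.
Proof.
have C1 g : polyf g -> C1_on U g.
  move=> pg i x _; split; first exact: polyf_derivable.
  exact/polyf_continuous/polyf_partial.
by move=> pf; split => [|i]; apply: C1 => //; exact: polyf_partial.
Qed.

Lemma polyf_bounded f (M : R) : polyf f -> exists C, forall x,
  (forall i, `|x i ord0| <= M) -> `|f x| <= C.
Proof.
elim=> [c|j|{}f g pf [C Cf] pg [D Dg]|{}f g pf [C Cf] pg [D Dg]].
- by exists `|c|.
- by exists M.
- exists (C + D) => x xM; rewrite (le_trans (ler_normD _ _))// lerD//; auto.
- by exists (C * D) => x xM; rewrite normrM ler_pM//; auto.
Qed.

End polynomial_functions.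

Lemma partialE (R : realType) (n : nat) (f : 'cV[R]_n -> R) x i :
  partial i f x = 'D_(delta_mx i ord0) f x.
Proof. by []. Qed.

(* Otherwise unification unfolds partial derivatives into limits of filters and
   rewriting does not terminate in practice. *)

Opaque partial.

(** * Homogeneous polynomials and Euler's identity *)

Section homogeneous_polynomials.
Context {R : realType} {n : nat}.
Implicit Types (f g h : 'cV[R]_n -> R) (x : 'cV[R]_n) (i j k : 'I_n) (d : nat).

(** The zero function belongs to every degree. Degrees grow by one coordinate factor at a time,
    which makes Euler's identity a direct induction. *)
Inductive hpoly : nat -> ('cV[R]_n -> R) -> Prop :=
| hpoly0 d : hpoly d (fun=> 0)
| hpoly_cst c : hpoly 0 (fun=> c)
| hpolyX i d f : hpoly d f -> hpoly d.+1 (fun x => x i ord0 * f x)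
| hpolyD d f g : hpoly d f -> hpoly d g -> hpoly d (fun x => f x + g x).

Lemma hpoly_ext d f g : f =1 g -> hpoly d f -> hpoly d g.
Proof. by move=> /funext ->. Qed.

Lemma hpoly_polyf d f : hpoly d f -> polyf f.
Proof.
elim=> [{}d|c|i {}d {}f _ pf|{}d {}f g _ pf _ pg]; try exact: polyf_cst.
- by apply: polyfM => //; exact: polyf_coor.
- exact: polyfD.
Qed.

Lemma hpolyZ d c f : hpoly d f -> hpoly d (fun x => c * f x).
Proof.
elim=> [{}d|e|i {}d {}f _ pf|{}d {}f g _ pf _ pg].
- by apply: (hpoly_ext _ (hpoly0 _)) => x; rewrite mulr0.
- exact: hpoly_cst.
- by apply: (hpoly_ext _ (hpolyX i pf)) => x; rewrite mulrCA.
- by apply: (hpoly_ext _ (hpolyD pf pg)) => x; rewrite mulrDr.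
Qed.

Lemma hpoly_sum d (I : finType) (F : I -> 'cV[R]_n -> R) :
  (forall a, hpoly d (F a)) -> hpoly d (fun x => \sum_a F a x).
Proof.
move=> pF; rewrite /index_enum; elim: (Finite.enum _) => [|a s IHs].
  by apply: (hpoly_ext _ (hpoly0 _)) => x; rewrite big_nil.
by apply: (hpoly_ext _ (hpolyD (pF a) IHs)) => x; rewrite big_cons.
Qed.

Lemma hpoly_quad_formM d f (X : 'M[R]_n) : hpoly d f ->
  hpoly d.+2 (fun x => quad_form X x * f x).
Proof.
move=> pf; have := hpoly_sum (fun j => hpoly_sum
   (fun i => hpolyZ (X i j) (hpolyX i (hpolyX j pf)))).
apply: hpoly_ext => x; rewrite /quad_form mxE mulr_suml; apply: eq_bigr => j _.
rewrite mxE !mulr_suml; apply: eq_bigr => i _; rewrite mxE; ring.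
Qed.

Lemma hpoly_partial d f i : hpoly d f ->
  if d is d'.+1 then hpoly d' (partial i f) else partial i f = (fun=> 0).
Proof.
have p0 : partial i (fun=> 0 : R) = (fun=> 0).
  by apply/funext => x; rewrite partial_cst.
elim=> [{}d|c|j {}d {}f pf pdf|{}d {}f g pf pdf pg pdg].
- by case: d => [|d]; rewrite p0//; exact: hpoly0.
- by apply/funext => x; rewrite partial_cst.
- rewrite (partialMf i (polyf_coor j) (hpoly_polyf pf)).
  have p1 : hpoly d (fun x => (j == i)%:R * f x) by exact: hpolyZ.
  have e x : partial i (fun y : 'cV[R]_n => y j ord0) x * f x =
    (j == i)%:R * f x by rewrite partial_coor.
  case: d pf pdf p1 => [|d] pf pdf p1.
    by apply: (hpoly_ext _ p1) => x; rewrite e pdf mulr0 add0r.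
  by apply: (hpoly_ext _ (hpolyD (hpolyX j pdf) p1)) => x; rewrite e.
- rewrite (partialDf i (hpoly_polyf pf) (hpoly_polyf pg)).
  case: d pf pdf pg pdg => [|d] pf pdf pg pdg; last exact: hpolyD.
  by apply/funext => x; rewrite pdf pdg addr0.
Qed.

Lemma euler_hpoly d f x : hpoly d f ->
  \sum_i x i ord0 * partial i f x = d%:R * f x.
Proof.
elim=> [{}d|c|j {}d {}f pf pdf|{}d {}f g pf pdf pg pdg].
- by rewrite big1 ?mulr0// => i _; rewrite partial_cst mulr0.
- by rewrite big1 ?mul0r// => i _; rewrite partial_cst mulr0.
- under eq_bigr do rewrite (partialM _ _ (polyf_coor j) (hpoly_polyf pf))
    partial_coor mulrDr mulrCA.
  rewrite big_split /= -mulr_sumr pdf (bigD1 j)//= eqxx big1 => [|i ij].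
    by rewrite addr0 mul1r -natr1; ring.
  by rewrite eq_sym (negbTE ij) mul0r mulr0.
- under eq_bigr do rewrite (partialD _ _ (hpoly_polyf pf) (hpoly_polyf pg)) mulrDr.
  by rewrite big_split /= pdf pdg mulrDr.
Qed.

Lemma hpoly0_const f x : hpoly 0 f -> f x = f 0.
Proof.
have gen e g : hpoly e g -> e = 0%N -> g x = g 0.
  by elim=> // {}e g1 g2 _ pg1 _ pg2 e0; rewrite pg1// pg2.
by move=> pf; exact: gen pf _.
Qed.

Lemma hpoly_at0 d f : hpoly d.+1 f -> f 0 = 0.
Proof.
have gen e g : hpoly e g -> (0 < e)%N -> g 0 = 0.
  elim=> [//|//|i {}e {}g _ _ _|{}e g1 g2 _ pg1 _ pg2 e0].
    by rewrite mxE mul0r.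
  by rewrite pg1// pg2// addr0.
by move=> pf; exact: gen pf _.
Qed.

End homogeneous_polynomials.

Lemma hessianE (R : realType) (n : nat) (f : 'cV[R]_n -> R) x i j :
  hessian f x i j = partial i (partial j f) x.
Proof. by rewrite mxE. Qed.

Opaque hessian.

(** * The operator [L] and the Fischer decomposition *)

Section fischer.
Context {R : realType} {n : nat}.
Variables Z Y : 'M[R]_n.
Hypotheses (symZ : Z^T = Z) (symY : Y^T = Y) (ZY : Z *m Y = 1%:M).
Implicit Types (f g h : 'cV[R]_n -> R) (x : 'cV[R]_n) (i j k : 'I_n) (d : nat).

Let q := quad_form Y.
Definition Lop f x := mx_inner Z (hessian f x).

Lemma LopE f x : Lop f x = \sum_i \sum_j Z i j * partial i (partial j f) x.
Proof.
rewrite /Lop /mx_inner /mxtrace exchange_big /=; apply: eq_bigr => i _.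
rewrite mxE; apply: eq_bigr => j _; rewrite hessianE.
by rewrite -[in LHS]symZ mxE.
Qed.

Lemma hessianD f g x : polyf f -> polyf g ->
  hessian (fun y => f y + g y) x = hessian f x + hessian g x.
Proof.
move=> pf pg; apply/matrixP => i j.
have addE (A B : 'M[R]_n) : (A + B) i j = A i j + B i j by rewrite mxE.
transitivity (partial i (partial j (fun y => f y + g y)) x).
  exact: hessianE.
transitivity (hessian f x i j + hessian g x i j); last by rewrite addE.
rewrite (partialDf j pf pg).
rewrite (partialD i x (polyf_partial j pf) (polyf_partial j pg)).
by congr (_ + _); exact/esym/hessianE.
Qed.

Lemma LopD f g x : polyf f -> polyf g ->
  Lop (fun y => f y + g y) x = Lop f x + Lop g x.
Proof.
by move=> pf pg; rewrite /Lop hessianD// /mx_inner mulmxDr mxtraceD.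
Qed.

Lemma LopM f g x : polyf f -> polyf g ->
  Lop (fun y => f y * g y) x = Lop f x * g x + f x * Lop g x +
  2 * \sum_i \sum_j Z i j * partial i f x * partial j g x.
Proof.
move=> pf pg; rewrite !LopE.
have -> : 2 * (\sum_i \sum_j Z i j * partial i f x * partial j g x) =
   (\sum_i \sum_j Z i j * partial i f x * partial j g x) +
   (\sum_i \sum_j Z i j * partial j f x * partial i g x).
  have two (a : R) : 2 * a = a + a by rewrite mulr_natl mulr2n.
  rewrite [LHS]two; apply: congr1; rewrite exchange_big /=.
  apply: eq_bigr => i _; apply: eq_bigr => j _.
  by rewrite -[in LHS]symZ mxE.
rewrite mulr_suml mulr_sumr -!big_split /=; apply: eq_bigr => i _.
rewrite mulr_suml mulr_sumr -!big_split /=; apply: eq_bigr => j _.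
rewrite (partialMf j pf pg).
have pfj := polyf_partial j pf; have pgj := polyf_partial j pg.
rewrite (partialD i x (polyfM pf pgj) (polyfM pfj pg)).
rewrite (partialM i x pf pgj) (partialM i x pfj pg).
move: (partial i (partial j f) x) (partial i (partial j g) x) => a b.
move: (partial i f x) (partial j f x) (partial i g x) (partial j g x) => u v w z.
move: (f x) (g x) (Z i j) => *; ring.
Qed.

Lemma Lop_cst c x : Lop (fun=> c) x = 0.
Proof.
rewrite LopE big1// => i _; rewrite big1// => j _.
rewrite (_ : partial j _ = fun=> 0) ?partial_cst ?mulr0//.
by apply/funext => y; rewrite partial_cst.
Qed.

Lemma LopZ c f x : polyf f -> Lop (fun y => c * f y) x = c * Lop f x.
Proof.
move=> pf; rewrite (LopM _ (polyf_cst c) pf) Lop_cst mul0r add0r.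
rewrite [X in _ + 2 * X]big1 ?mulr0 ?addr0// => i _; rewrite big1// => j _.
by rewrite partial_cst mulr0 mul0r.
Qed.

(** Component [k] of the field [Z grad h], whose divergence is [Lop h]. Twice this component is the
    commutator of [Lop] with multiplication by the coordinate [k]. *)
Definition Zgrad h k x := \sum_j Z k j * partial j h x.

Lemma polyf_Zgrad h k : polyf h -> polyf (Zgrad h k).
Proof.
by move=> ph; apply: polyf_sum => j; apply: polyfZ; exact: polyf_partial.
Qed.

Lemma Lop_coorM h k x : polyf h ->
  Lop (fun y => y k ord0 * h y) x = x k ord0 * Lop h x + 2 * Zgrad h k x.
Proof.
move=> ph; rewrite (LopM _ (polyf_coor k) ph).
have -> : Lop (fun y : 'cV[R]_n => y k ord0) x = 0.
  rewrite LopE big1// => i _; rewrite big1// => j _.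
  rewrite (_ : partial j _ = fun=> (k == j)%:R) ?partial_cst ?mulr0//.
  by apply/funext => y; rewrite partial_coor.
rewrite mul0r add0r; congr (_ + 2 * _).
rewrite (bigD1 k)//= [X in _ + X]big1 => [|i ik].
  by rewrite addr0; apply: eq_bigr => j _; rewrite partial_coor eqxx mulr1.
by rewrite big1// => j _; rewrite partial_coor eq_sym (negbTE ik) mulr0 mul0r.
Qed.

Lemma partial_quad_form (X : 'M[R]_n) i x : X^T = X ->
  partial i (quad_form X) x = 2 * \sum_k X i k * x k ord0.
Proof.
move=> symX.
have pT k l : polyf (fun x : 'cV[R]_n => X l k * (x l ord0 * x k ord0)).
  apply: polyfZ; apply: polyfM; exact: polyf_coor.
have -> : quad_form X = (fun x => \sum_k \sum_l X l k * (x l ord0 * x k ord0)).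
  apply/funext => y; rewrite /quad_form mxE; apply: eq_bigr => k _.
  rewrite mxE mulr_suml; apply: eq_bigr => l _; rewrite mxE; ring.
rewrite partial_sum; last by move=> k; exact: polyf_sum.
transitivity (\sum_k (\sum_l X l k * (x l ord0 * (k == i)%:R) +
   \sum_l X l k * ((l == i)%:R * x k ord0))).
  apply: eq_bigr => k _; rewrite partial_sum// -big_split /=.
  apply: eq_bigr => l _.
  rewrite (partialZ _ _ _ (polyfM (polyf_coor l) (polyf_coor k))).
  rewrite (partialM _ _ (polyf_coor l) (polyf_coor k)) !partial_coor.
  by rewrite mulrDr.
have two (a : R) : 2 * a = a + a by rewrite mulr_natl mulr2n.
rewrite big_split /= {}two; congr (_ + _).
  rewrite exchange_big /=; apply: eq_bigr => k _.
  rewrite (bigD1 i)//= eqxx big1 => [|l li].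
    by rewrite addr0 mulr1 -[in LHS]symX mxE.
  by rewrite (negbTE li) !mulr0.
apply: eq_bigr => k _; rewrite (bigD1 i)//= eqxx big1 => [|l li].
  by rewrite addr0 mul1r.
by rewrite (negbTE li) mul0r mulr0.
Qed.

Lemma Lop_quad_form_tr (X : 'M[R]_n) x : X^T = X ->
  Lop (quad_form X) x = 2 * \tr (Z *m X).
Proof.
move=> symX; rewrite LopE.
have e i j : partial i (partial j (quad_form X)) x = 2 * X j i.
  rewrite (_ : partial j (quad_form X) = fun y => 2 * \sum_k X j k * y k ord0); last first.
    by apply/funext => y; exact: partial_quad_form.
  have pc k : polyf (fun y : 'cV[R]_n => X j k * y k ord0).
    exact/polyfZ/polyf_coor.
  rewrite (partialZ 2 i x (polyf_sum pc)) partial_sum// (bigD1 i)//= big1 => [|k ki].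
    by rewrite addr0 (partialZ _ _ _ (polyf_coor i)) partial_coor eqxx mulr1.
  by rewrite (partialZ _ _ _ (polyf_coor k)) partial_coor (negbTE ki) mulr0.
under eq_bigr => i _ do under eq_bigr => j _ do rewrite e mulrCA.
rewrite /mxtrace mulr_sumr; apply: eq_bigr => i _.
by rewrite mxE mulr_sumr.
Qed.

Lemma Lop_quad_form x : Lop q x = 2 * n%:R.
Proof. by rewrite Lop_quad_form_tr// ZY mxtrace1. Qed.

Lemma Zgrad_quad_form k x : Zgrad q k x = 2 * x k ord0.
Proof.
rewrite /Zgrad; under eq_bigr do rewrite (partial_quad_form _ _ symY).
transitivity (2 * (Z *m (Y *m x)) k ord0); last by rewrite mulmxA ZY mul1mx.
rewrite mxE mulr_sumr; apply: eq_bigr => j _.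
by rewrite mxE mulrCA.
Qed.

(** As [Z Y = 1], the field [Z grad q] is twice the position vector, and the sum is Euler's identity
    for [h]. *)
Lemma euler_quad_form d h x : hpoly d h ->
  \sum_i partial i q x * Zgrad h i x = 2 * (d%:R * h x).
Proof.
move=> hh; under eq_bigr do rewrite mulr_sumr.
rewrite -(euler_hpoly x hh) mulr_sumr exchange_big /=; apply: eq_bigr => j _.
under eq_bigr do rewrite mulrA.
rewrite -mulr_suml mulrA; congr (_ * _).
rewrite -Zgrad_quad_form; apply: eq_bigr => i _.
by rewrite mulrC -[in LHS]symZ mxE.
Qed.

Lemma sum_partial_Zgrad h x : polyf h ->
  \sum_i partial i (Zgrad h i) x = Lop h x.
Proof.
move=> ph; rewrite LopE; apply: eq_bigr => i _.
have pT j : polyf (fun y => Z i j * partial j h y).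
  by apply: polyfZ; exact: polyf_partial.
rewrite [LHS](partial_sum i x pT); apply: eq_bigr => j _.
exact: (partialZ (Z i j) i x (polyf_partial j ph)).
Qed.

(** The coefficient [2 n] is [L q]; [4 d] is the cross term of the product rule, evaluated by
    Euler's identity. *)
Lemma Lop_quad_formM d h x : hpoly d h ->
  Lop (fun y => q y * h y) x = q x * Lop h x + (2 * n%:R + 4 * d%:R) * h x.
Proof.
move=> hh; have ph := hpoly_polyf hh.
have pq : polyf q by exact: polyf_quad_form.
rewrite (LopM x pq ph) Lop_quad_form.
have -> : \sum_i \sum_j Z i j * partial i q x * partial j h x = 2 * (d%:R * h x).
  rewrite -(euler_quad_form x hh); apply: eq_bigr => i _.
  by rewrite mulr_sumr; apply: eq_bigr => j _; rewrite mulrAC mulrC.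
by move: (q x) (Lop h x) (h x) => a b c; ring.
Qed.

Definition Lharmonic d h := hpoly d h /\ forall x, Lop h x = 0.

(** [L] has constant coefficients, so it commutes with partial derivatives. *)
Lemma Lharmonic_Zgrad d h k : Lharmonic d.+1 h -> Lharmonic d (Zgrad h k).
Proof.
move=> [hh h0]; split.
  by apply: hpoly_sum => j; apply: hpolyZ; exact: hpoly_partial hh.
move=> x; have ph := hpoly_polyf hh.
have pp i : polyf (partial i h) by exact: polyf_partial.
have pL : polyf (Lop h).
  have : polyf (fun x => \sum_i \sum_j Z i j * partial i (partial j h) x).
    apply: polyf_sum => i; apply: polyf_sum => j; apply: polyfZ; exact: polyf_partial.
  by apply: polyf_ext => y; rewrite LopE.
have Lp i : Lop (partial i h) x = 0.
  transitivity (partial i (Lop h) x).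
    rewrite LopE (_ : Lop h = fun x => \sum_i \sum_j Z i j * partial i (partial j h) x);
      last by apply/funext => y; rewrite LopE.
    have pT a b : polyf (fun x => Z a b * partial a (partial b h) x).
      by apply: polyfZ; exact: polyf_partial.
    rewrite [RHS]partial_sum; last by move=> a; exact: polyf_sum.
    apply: eq_bigr => a _; rewrite [RHS]partial_sum//; apply: eq_bigr => b _.
    rewrite [RHS](partialZ (Z a b) i x (polyf_partial a (pp b))).
    rewrite -[RHS](congr1 (fun t => Z a b * t) (partial_comm a i x (pp b))).
    apply: (congr1 (fun g => Z a b * partial a g x)).
    by apply/funext => y; exact: (partial_comm b i y ph).
  rewrite (_ : Lop h = fun=> 0) ?partial_cst//; exact/funext.
rewrite LopE /Zgrad.
transitivity (\sum_j Z k j * Lop (partial j h) x); last first.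
  by rewrite big1// => j _; rewrite Lp mulr0.
transitivity (\sum_a \sum_b \sum_j Z a b * (Z k j * partial a (partial b (partial j h)) x)).
  apply: eq_bigr => a _; apply: eq_bigr => b _; rewrite -mulr_sumr; congr (_ * _).
  have e : partial b (fun x0 => \sum_j Z k j * partial j h x0) =
     (fun x0 => \sum_j Z k j * partial b (partial j h) x0).
    apply/funext => y; rewrite partial_sum; last by move=> j; exact: polyfZ.
    by apply: eq_bigr => j _; rewrite partialZ.
  rewrite e partial_sum; last by move=> j; apply: polyfZ; exact: polyf_partial.
  by apply: eq_bigr => j _; rewrite (partialZ _ _ _ (polyf_partial b (pp j))).
under eq_bigr do rewrite exchange_big /=.
rewrite exchange_big /=; apply: eq_bigr => j _; rewrite LopE mulr_sumr.
apply: eq_bigr => a _; rewrite mulr_sumr; apply: eq_bigr => b _.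
by rewrite mulrCA.
Qed.

Inductive fischer : ('cV[R]_n -> R) -> Prop :=
| fischer_gen m d h : Lharmonic d h -> fischer (fun x => q x ^+ m * h x)
| fischerD f g : fischer f -> fischer g -> fischer (fun x => f x + g x).

Lemma fischer_ext f g : f =1 g -> fischer f -> fischer g.
Proof. by move=> /funext ->. Qed.

Hypothesis n_gt0 : (0 < n)%N.

(** For harmonic [h] of degree [d + 1], write [g] for component [k] of [Z grad h], harmonic of
    degree [d]. Then [L (x_k h) = 2 g] and [L (q g) = (2 n + 4 d) g], so [x_k h - c q g] is harmonic
    for [c = 2 / (2 n + 4 d)]. The correction [c q g] is a term with one more factor [q]. *)
Lemma fischer_coorM k f : fischer f -> fischer (fun x => x k ord0 * f x).
Proof.
elim=> [m d h hh|{}f g _ ff _ fg]; last first.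
  by apply: (fischer_ext _ (fischerD ff fg)) => x; rewrite mulrDr.
have [hd h0] := hh; have ph := hpoly_polyf hd.
(* In degree 0, [h] is constant and [x_k h] is already harmonic. *)
case: d => [|d] in hh hd *.
  have pd i : partial i h = fun=> 0 by exact: (hpoly_partial i hd).
  have xh : Lharmonic 1 (fun x => x k ord0 * h x).
    split; first exact: hpolyX.
    move=> x; rewrite Lop_coorM// h0 mulr0 add0r /Zgrad big1 ?mulr0// => j _.
    by rewrite pd mulr0.
  by apply: (fischer_ext _ (fischer_gen m xh)) => x; rewrite mulrCA.
have hg := Lharmonic_Zgrad k hh; have [hgd g0] := hg.
pose a : R := 2 * n%:R + 4 * d%:R.
have a0 : a != 0.
  by rewrite gt_eqF// ltr_wpDr ?mulr_gt0 ?mulr_ge0 ?ltr0n ?ler0n.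
pose c := 2 / a.
have hcg : Lharmonic d (fun x => c * Zgrad h k x).
  split; first exact: hpolyZ.
  by move=> x; rewrite (LopZ _ _ (hpoly_polyf hgd)) g0 mulr0.
have hx : Lharmonic d.+2 (fun x => x k ord0 * h x + - c * (q x * Zgrad h k x)).
  split.
    by apply: hpolyD; [exact: hpolyX|apply: hpolyZ; exact: hpoly_quad_formM].
  move=> x; have hq := hpoly_quad_formM Y hgd.
  rewrite LopD; [|exact: polyfM (polyf_coor k) ph|exact/polyfZ/(hpoly_polyf hq)].
  rewrite (LopZ _ _ (hpoly_polyf hq)) Lop_coorM// h0 (Lop_quad_formM _ hgd) g0.
  by rewrite /c -/a; move: (Zgrad h k x) (h x) (q x) (x k ord0) => *; field.
apply: (fischer_ext _ (fischerD (fischer_gen m hx) (fischer_gen m.+1 hcg))) => x.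
by rewrite exprS; move: (Zgrad h k x) (h x) (q x) => *; ring.
Qed.

(** The induction is on the stronger claim that multiplication by [f] preserves decomposable
    functions, because a product of two decompositions is not visibly a decomposition. It is then
    applied to the constant 1. *)
Lemma polyf_fischer f : polyf f -> fischer f.
Proof.
move=> pf; have : forall g, fischer g -> fischer (fun x => f x * g x).
  elim: pf => [c|i|{}f g _ IHf _ IHg|{}f g _ IHf _ IHg] h hh.
  - elim: hh => [m d {}h [hd h0]|{}f g _ ff _ fg]; last first.
      by apply: (fischer_ext _ (fischerD ff fg)) => x; rewrite mulrDr.
    have hc : Lharmonic d (fun x => c * h x).
      split; first exact: hpolyZ.
      by move=> x; rewrite (LopZ _ _ (hpoly_polyf hd)) h0 mulr0.
    by apply: (fischer_ext _ (fischer_gen m hc)) => x; rewrite mulrCA.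
  - exact: fischer_coorM.
  - by apply: (fischer_ext _ (fischerD (IHf _ hh) (IHg _ hh))) => x; rewrite mulrDl.
  - by apply: (fischer_ext _ (IHf _ (IHg _ hh))) => x; rewrite mulrA.
have h1 : Lharmonic 0 (fun=> 1).
  by split; [exact: hpoly_cst|exact: Lop_cst].
move/(_ _ (fischer_gen 0 h1)); apply: fischer_ext => x.
by rewrite expr0 !mulr1.
Qed.

End fischer.

(** * Moments of harmonic polynomials on ellipsoids *)

Section bounded_integrals.
Context {R : realType} {n : nat}.
Implicit Types (f g : 'cV[R]_n -> R) (D : set 'cV[R]_n).
Local Notation mu := (@lebesgue_cV R n).

Definition bounded_by (M : R) D := forall x, D x -> forall k, `|x k ord0| <= M.

Lemma cV_integrable D M f C : measurable D -> bounded_by M D ->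
  measurable_fun D f -> (forall x, D x -> `|f x| <= C) ->
  mu.-integrable D (EFin \o f).
Proof.
move=> mD bD mf fC; apply: measurable_bounded_integrable => //.
  exact: lebesgue_cV_lty bD.
exists `|C|; split; first exact: num_real.
move=> r Cr x Dx /=; rewrite (le_trans (fC _ Dx))// (le_trans (ler_norm C))//.
exact: ltW.
Qed.

Lemma polyf_integrable D M f : measurable D -> bounded_by M D -> polyf f ->
  mu.-integrable D (EFin \o f).
Proof.
move=> mD bD pf; have [C Cf] := polyf_bounded M pf.
apply: (cV_integrable (C := C) mD bD).
  by apply: measurable_funTS; exact: polyf_measurable.
by move=> x Dx; apply: Cf; exact: bD.
Qed.

Lemma normr_Rintegral_le D f C : measurable D -> (mu D < +oo)%E ->
  mu.-integrable D (EFin \o f) -> (forall x, D x -> `|f x| <= C) ->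
  `|\int[mu]_(x in D) f x| <= C * fine (mu D).
Proof.
move=> mD Doo intf fC; rewrite (le_trans (le_normr_Rintegral mD intf))//.
rewrite -Rintegral_cst//; apply: le_Rintegral => //.
  exact: integrable_norm.
apply: measurable_bounded_integrable => //.
by exists `|C|; split; [exact: num_real|move=> r Cr x Dx /=; exact: ltW].
Qed.

Definition box (M : R) : set 'cV[R]_n := [set x | forall k, `|x k ord0| <= M].

Lemma measurable_box M : measurable (box M).
Proof.
have -> : box M = \bigcap_(j in [set: 'I_n])
     ((fun v : 'cV[R]_n => v j ord0) @^-1` `[- M, M]%classic).
  apply/seteqP; split=> y h j; [move=> _|]; have := h j;
    rewrite /= in_itv/= ler_norml//; exact.
apply: fin_bigcap_measurable => // j _.
by rewrite -[X in measurable X]setTI; apply: measurable_coor.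
Qed.

Lemma Rintegral_support D f : (forall x, ~ D x -> f x = 0) ->
  \int[mu]_(x in D) f x = \int[mu]_x f x.
Proof.
move=> f0; rewrite Rintegral_mkcond; congr (Rintegral mu setT _).
apply/funext => x; rewrite patchE; case: ifPn => // /negP xD.
by rewrite f0// => Dx; apply: xD; rewrite inE.
Qed.

End bounded_integrals.
Arguments box {R n} M.

(** * Integrals of derivatives of compactly supported functions *)

Section divergence.
Context {R : realType} {n : nat}.
Implicit Types (f g : 'cV[R]_n -> R) (x : 'cV[R]_n) (i : 'I_n) (M : R).
Local Notation mu := (@lebesgue_cV R n).
Let e i : 'cV[R]_n := delta_mx i ord0.

(* A quantitative form of "f' is the i-th partial derivative of f", stable under
   squares of positive parts. *)
Definition taylor1 M i f f' := exists C : R, forall x t, box M x -> `|t| <= 1 ->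
  [/\ `|f x| <= C, `|f' x| <= C &
      `|f (x + t *: e i) - f x - t * f' x| <= C * t ^+ 2].

Lemma taylor1_ext M i f f' f1 f1' : f =1 f1 -> f' =1 f1' ->
  taylor1 M i f f' -> taylor1 M i f1 f1'.
Proof. by move=> /funext -> /funext ->. Qed.

Lemma taylor1D M i f f' g g' : taylor1 M i f f' -> taylor1 M i g g' ->
  taylor1 M i (fun x => f x + g x) (fun x => f' x + g' x).
Proof.
move=> [C Cf] [D Dg]; exists (C + D) => x t xM t1.
have [f1 f2 f3] := Cf x t xM t1; have [g1 g2 g3] := Dg x t xM t1.
split; [exact: (le_trans (ler_normD _ _) (lerD f1 g1))|
        exact: (le_trans (ler_normD _ _) (lerD f2 g2))|].
rewrite mulrDl; apply: le_trans (lerD f3 g3); rewrite (le_trans _ (ler_normD _ _))//.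
by rewrite le_eqVlt; apply/orP; left; apply/eqP; congr `|_|; ring.
Qed.

(** The constant is [6 = 1 + 3 + 2], one summand for each term of the expansion: [t^2 u v], then [r]
    times a factor of size [3 D], then [s] times a factor of size [2 C]. *)
Let mul_remainder (t a b u v r s C D : R) : `|t| <= 1 ->
  `|a| <= C -> `|u| <= C -> `|r| <= C * t ^+ 2 ->
  `|b| <= D -> `|v| <= D -> `|s| <= D * t ^+ 2 ->
  `|(a + t * u + r) * (b + t * v + s) - a * b - t * (a * v + u * b)|
     <= 6 * (C * D) * t ^+ 2.
Proof.
move=> t1 aC uC rC bD vD sD.
have C0 : 0 <= C by rewrite (le_trans _ aC).
have D0 : 0 <= D by rewrite (le_trans _ bD).
have t2 : 0 <= t ^+ 2 by rewrite sqr_ge0.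
have t21 : t ^+ 2 <= 1 by rewrite -real_normK ?num_real// expr_le1.
have -> : (a + t * u + r) * (b + t * v + s) - a * b - t * (a * v + u * b) =
  t ^+ 2 * (u * v) + r * (b + t * v + s) + (a + t * u) * s by ring.
have e1 : `|t ^+ 2 * (u * v)| <= C * D * t ^+ 2.
  by rewrite normrM ger0_norm// normrM mulrC ler_wpM2r// ler_pM.
have e2 : `|b + t * v + s| <= 3 * D.
  have -> : 3 * D = D + D + D by ring.
  rewrite (le_trans (ler_normD _ _))// lerD//; last first.
    by rewrite (le_trans sD)// ler_piMr.
  rewrite (le_trans (ler_normD _ _))// lerD// normrM.
  by rewrite (le_trans _ vD)// ler_piMl.
have e3 : `|a + t * u| <= 2 * C.
  have -> : 2 * C = C + C by ring.
  rewrite (le_trans (ler_normD _ _))// lerD// normrM.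
  by rewrite (le_trans _ uC)// ler_piMl.
have e4 : `|r * (b + t * v + s)| <= 3 * (C * D) * t ^+ 2.
  rewrite normrM (_ : 3 * _ * _ = (C * t ^+ 2) * (3 * D)); last by ring.
  exact: ler_pM.
have e5 : `|(a + t * u) * s| <= 2 * (C * D) * t ^+ 2.
  rewrite normrM (_ : 2 * _ * _ = (2 * C) * (D * t ^+ 2)); last by ring.
  exact: ler_pM.
rewrite (le_trans (ler_normD _ _))//.
have := ler_normD (t ^+ 2 * (u * v)) (r * (b + t * v + s)).
move: e1 e4 e5; lra.
Qed.

Lemma taylor1M M i f f' g g' : taylor1 M i f f' -> taylor1 M i g g' ->
  taylor1 M i (fun x => f x * g x) (fun x => f x * g' x + f' x * g x).
Proof.
move=> [C Cf] [D Dg]; exists (6 * (C * D)) => x t xM t1.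
have [f1 f2 f3] := Cf x t xM t1; have [g1 g2 g3] := Dg x t xM t1.
have C0 : 0 <= C by rewrite (le_trans _ f1).
have D0 : 0 <= D by rewrite (le_trans _ g1).
have CD0 : 0 <= C * D by rewrite mulr_ge0.
have fg a b : `|a| <= C -> `|b| <= D -> `|a * b| <= C * D.
  by move=> *; rewrite normrM ler_pM.
split.
- by rewrite (le_trans (fg _ _ f1 g1))//; lra.
- rewrite (le_trans (ler_normD _ _))//.
  have := fg _ _ f1 g2; have := fg _ _ f2 g1; lra.
- have := mul_remainder t1 f1 f2 f3 g1 g2 g3.
  have E (a b c : R) : a + b + (c - a - b) = c by ring.
  by rewrite !E.
Qed.

Local Notation posr a := (Num.max a 0).

(** The squared positive part is convex with derivative [2 posr a], and this derivative is Lipschitz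
    with constant 2; hence the two bounds on the remainder. *)
Let posr_sqr (a b : R) :
  0 <= posr b ^+ 2 - posr a ^+ 2 - 2 * posr a * (b - a) <= (b - a) ^+ 2.
Proof.
case: (leP a 0) => a0; case: (leP b 0) => b0.
- by rewrite expr0n /= !mulr0 mul0r !subr0 lexx sqr_ge0.
- have := mulr_ge0 (ltW b0) (_ : 0 <= - a); rewrite oppr_ge0 => /(_ a0).
  have := sqr_ge0 a; have := sqr_ge0 b; rewrite !expr2 => *; apply/andP; split; lra.
- have := mulr_ge0 (ltW a0) (_ : 0 <= - b); rewrite oppr_ge0 => /(_ b0).
  have := sqr_ge0 a; have := sqr_ge0 b; rewrite !expr2 => *; apply/andP; split; lra.
- have := sqr_ge0 (b - a); rewrite !expr2 => *; apply/andP; split; lra.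
Qed.

(** In [6 C^2], the part [4 C^2] comes from the squared increment of [f], which is at most
    [2 C |t|], and [2 C^2] comes from the remainder of [f] itself. *)
Lemma taylor1_posr_sqr M i f f' : taylor1 M i f f' ->
  taylor1 M i (fun x => posr (f x) ^+ 2) (fun x => 2 * posr (f x) * f' x).
Proof.
move=> [C Cf]; exists (6 * C ^+ 2) => x t xM t1.
have [f1 f2 f3] := Cf x t xM t1.
have C0 : 0 <= C by rewrite (le_trans _ f1).
set a := f x in f1 f3 *; set b := f (_ + _) in f3 *; set u := f' x in f2 f3 *.
have pa0 : 0 <= posr a by rewrite le_max lexx orbT.
have paC : posr a <= C.
  by rewrite ge_max C0 andbT (le_trans (ler_norm _)).
have t2 : 0 <= t ^+ 2 by rewrite sqr_ge0.
have C2 : 0 <= C ^+ 2 by rewrite sqr_ge0.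
split.
- rewrite ger0_norm ?sqr_ge0//; nra.
- rewrite normrM (ger0_norm (mulr_ge0 _ pa0))//.
  have : posr a * `|u| <= C * C by exact: ler_pM.
  rewrite -mulrA -expr2; move: (posr a * `|u|) => w; lra.
have /andP[h1 h2] := posr_sqr a b.
set r := b - a - t * u in f3.
have bar : `|b - a| <= 2 * C * `|t|.
  have -> : b - a = t * u + r by rewrite /r; ring.
  rewrite (le_trans (ler_normD _ _))// normrM.
  have : `|t| * `|u| <= `|t| * C by rewrite ler_wpM2l.
  have : C * t ^+ 2 <= C * `|t|.
    rewrite ler_wpM2l// -real_normK ?num_real// expr2 ler_piMr//.
  move: f3; move: (`|r|) (C * t ^+ 2) => *; lra.
have bar2 : (b - a) ^+ 2 <= 4 * C ^+ 2 * t ^+ 2.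
  rewrite -[(b - a) ^+ 2]real_normK ?num_real// -[t ^+ 2]real_normK ?num_real//.
  rewrite (_ : 4 * _ * _ = (2 * C * `|t|) ^+ 2); last by ring.
  by rewrite lerXn2r// ?nnegrE ?mulr_ge0.
have -> : posr b ^+ 2 - posr a ^+ 2 - t * (2 * posr a * u) =
  (posr b ^+ 2 - posr a ^+ 2 - 2 * posr a * (b - a)) + 2 * posr a * r.
  by rewrite /r; ring.
have par : `|2 * posr a * r| <= 2 * C ^+ 2 * t ^+ 2.
  rewrite normrM ger0_norm ?mulr_ge0//.
  rewrite (_ : 2 * C ^+ 2 * t ^+ 2 = (2 * C) * (C * t ^+ 2)); last by ring.
  by apply: ler_pM => //; [exact: mulr_ge0|exact: ler_wpM2l].
rewrite (le_trans (ler_normD _ _))// (ger0_norm h1).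
move: h2 bar2 par; lra.
Qed.

Lemma taylor1_polyf M i f : polyf f -> taylor1 M i f (partial i f).
Proof.
elim=> [c|j|{}f g pf tf pg tg|{}f g pf tf pg tg].
- exists `|c| => x t _ _; rewrite partial_cst subrr sub0r mulr0 normrN normr0.
  by split => //; rewrite mulr_ge0// sqr_ge0.
- exists (`|M| + 1) => x t xM _; rewrite partial_coor !mxE eqxx andbT.
  split; first by rewrite (le_trans (xM j))// ler_wpDr// ler_norm.
    by case: (j == i); rewrite ?normr1 ?normr0 ?addr_ge0// lerDr.
  have -> : x j ord0 + t * (j == i)%:R - x j ord0 - t * (j == i)%:R = 0 by ring.
  by rewrite normr0 mulr_ge0 ?sqr_ge0// addr_ge0.
- apply: taylor1_ext (taylor1D tf tg) => // x; by rewrite partialD.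
- apply: taylor1_ext (taylor1M tf tg) => // x; by rewrite partialM.
Qed.

(** Translation along the axis preserves the integral of [f], so integrating the remainder bounds
    [t] times the integral of [f'] by a multiple of [t^2]. The box is enlarged by 1 to contain the
    support of every translate with [|t| <= 1]. *)
Lemma Rintegral_taylor1 M0 i f f' : 0 <= M0 ->
  taylor1 (M0 + 1) i f f' ->
  measurable_fun setT f -> measurable_fun setT f' ->
  (forall x, ~ box M0 x -> f x = 0) -> (forall x, ~ box M0 x -> f' x = 0) ->
  \int[mu]_x f' x = 0.
Proof.
move=> M00 [C Cf] mf mf' f0 f'0.
set B : set 'cV[R]_n := box (M0 + 1).
have mB : measurable B by exact: measurable_box.
have bB : bounded_by (M0 + 1) B by [].
have Boo := lebesgue_cV_lty mB bB.
have C0 : 0 <= C.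
  have h0 : box (M0 + 1) (0 : 'cV[R]_n).
    by move=> k; rewrite mxE normr0 addr_ge0.
  have n01 : `|0 : R| <= 1 by rewrite normr0.
  by have [/(le_trans (normr_ge0 _))] := Cf 0 0 h0 n01.
have n01 : `|0 : R| <= 1 by rewrite normr0.
have intf : mu.-integrable B (EFin \o f).
  apply: (cV_integrable (C := C) mB bB); first exact: measurable_funTS.
  by move=> x xB; have [] := Cf x 0 xB n01.
have intf' : mu.-integrable B (EFin \o f').
  apply: (cV_integrable (C := C) mB bB); first exact: measurable_funTS.
  by move=> x xB; have [] := Cf x 0 xB n01.
have box_sub (x : 'cV[R]_n) : box M0 x -> B x.
  by move=> xM k; rewrite (le_trans (xM k))// lerDl.
have supp x : ~ B x -> f x = 0 by move=> xB; apply: f0 => /box_sub.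
have supp' x : ~ B x -> f' x = 0 by move=> xB; apply: f'0 => /box_sub.
rewrite -(Rintegral_support supp'); set I := Rintegral _ _ _.
have key t : 0 < t -> t <= 1 -> `|I| <= (C * fine (mu B)) * t.
  move=> t0 t1; have nt1 : `|t| <= 1 by rewrite gtr0_norm.
  pose ft x := f (x + t *: e i).
  have intft : mu.-integrable B (EFin \o ft).
    apply: (cV_integrable (C := 3 * C) mB bB).
      apply: measurable_funTS; exact: (measurableT_comp mf (measurable_shift _)).
    move=> x xB; have [f1 f2 f3] := Cf x t xB nt1.
    have -> : ft x = f x + t * f' x + (f (x + t *: e i) - f x - t * f' x).
      by rewrite /ft; ring.
    have h1 : `|t * f' x| <= C.
      by rewrite normrM (le_trans _ f2)// ler_piMl.
    have h2 : C * t ^+ 2 <= C.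
      by rewrite ler_piMr// -real_normK ?num_real// expr_le1.
    rewrite (le_trans (ler_normD _ _))//.
    have := ler_normD (f x) (t * f' x); lra.
  have ftE : \int[mu]_(x in B) ft x = \int[mu]_(x in B) f x.
    rewrite (Rintegral_support supp) Rintegral_support.
      rewrite /Rintegral; congr fine.
      have := @integral_shift R n (t *: e i) setT (EFin \o f) measurableT.
      rewrite preimage_setT; apply.
      exact/measurable_EFinP.
    move=> x xB; apply: f0 => xt; apply: xB => k.
    have -> : x k ord0 = (x + t *: e i) k ord0 - t * e i k ord0.
      by rewrite !mxE; ring.
    rewrite (le_trans (ler_normB _ _))// lerD ?(xt k)// normrM.
    rewrite mulr_ile1// mxE eqxx andbT.
    by case: (_ == _); rewrite ?normr1 ?normr0.
  have inttf' : mu.-integrable B (EFin \o (fun x => t * f' x)).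
    exact: (integrableZl mB t intf').
  have hE : \int[mu]_(x in B) (ft x - f x - t * f' x) = - (t * I).
    rewrite (RintegralB mB (integrableB mB intft intf) inttf').
    by rewrite (RintegralB mB intft intf) ftE RintegralZl// subrr sub0r.
  have hle : `|\int[mu]_(x in B) (ft x - f x - t * f' x)| <= (C * t ^+ 2) * fine (mu B).
    apply: normr_Rintegral_le => //.
      exact: (integrableB mB (integrableB mB intft intf) inttf').
    by move=> x xB; have [] := Cf x t xB nt1.
  move: hle; rewrite hE normrN normrM (gtr0_norm t0).
  rewrite (_ : C * t ^+ 2 * _ = t * (C * fine (mu B) * t)); last by ring.
  by rewrite ler_pM2l.
have K0 : 0 <= C * fine (mu B) by rewrite mulr_ge0 ?fine_ge0.
apply/eqP/negPn/negP => I0.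
have nI : 0 < `|I| by rewrite normr_gt0.
set K := C * fine (mu B) in key K0.
have den : 0 < `|I| + K + 1 by rewrite ltr_wpDl ?addr_ge0.
(* A value of [t] in []0, 1]] with [K t < |I|], against [key]. *)
have t0 : 0 < `|I| / (`|I| + K + 1) by rewrite divr_gt0.
have t1 : `|I| / (`|I| + K + 1) <= 1.
  by rewrite ler_pdivrMr// mul1r -addrA lerDl addr_ge0.
have := key _ t0 t1; rewrite mulrA ler_pdivlMr// [leRHS]mulrC ler_pM2l//.
by move: nI; lra.
Qed.

End divergence.

Lemma partial_exp (R : realType) (n : nat) (f : 'cV[R]_n -> R) i x m : polyf f ->
  partial i (fun y => f y ^+ m) x = m%:R * f x ^+ m.-1 * partial i f x.
Proof.
move=> pf; elim: m => [|m IHm].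
  have -> : (fun y => f y ^+ 0) = (fun=> 1) by apply/funext => y; rewrite expr0.
  by rewrite partial_cst !mul0r.
have -> : (fun y => f y ^+ m.+1) = (fun y => f y * f y ^+ m).
  by apply/funext => y; rewrite exprS.
rewrite (partialM i x pf (polyf_exp m pf)) IHm.
case: m {IHm} => [|m] /=; first by rewrite !mul0r mulr0 expr0 add0r mulr1 !mul1r.
rewrite exprS -[in RHS]natr1.
by move: (f x ^+ m) (partial i f x) (f x) (m.+1%:R : R) => *; ring.
Qed.

(** * Vanishing moments of harmonic polynomials *)

Section ellipsoid_moments.
Context {R : realType} {n : nat}.
Variables Z Y : 'M[R]_n.
Hypotheses (symZ : Z^T = Z) (symY : Y^T = Y) (ZY : Z *m Y = 1%:M).
Variable Lam : R.
Local Notation q := (quad_form Y).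
Hypothesis coercive : forall (x : 'cV[R]_n) i, (x i ord0) ^+ 2 <= Lam * q x.
Hypothesis Lam_gt0 : 0 < Lam.
Implicit Types (f g h : 'cV[R]_n -> R) (x : 'cV[R]_n) (i j k : 'I_n) (d m : nat).
Local Notation mu := (@lebesgue_cV R n).

(** The level [s] is a squared radius. It ranges over all reals, so that levels [s - del] need no
    sign condition. *)
Definition qball (s : R) : set 'cV[R]_n := [set x | q x < s].

Lemma quad_form_continuous (X : 'M[R]_n) : continuous (quad_form X).
Proof. by apply: polyf_continuous; exact: polyf_quad_form. Qed.

Lemma qball_open s : open (qball s).
Proof.
apply: (open_comp (f := q) (D := [set y | y < s])); last exact: open_lt.
by move=> x _; exact: quad_form_continuous.
Qed.

Lemma qball_measurable s : measurable (qball s).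
Proof.
by apply: open_measurable_cV; exact: qball_open.
Qed.

(** The bound [a <= (a + 1)^2] for [a >= 0] replaces the square root of [Lam * s]. *)
Lemma le_quad_form_bound s x : q x <= s -> forall i, `|x i ord0| <= Lam * s + 1.
Proof.
move=> xs i; have h := coercive x i.
have h1 : (x i ord0) ^+ 2 <= Lam * s by rewrite (le_trans h)// ler_wpM2l// ltW.
have h2 : 0 <= Lam * s by rewrite (le_trans _ h1)// sqr_ge0.
rewrite -(@ler_pXn2r _ 2)// ?nnegrE ?addr_ge0//.
rewrite real_normK ?num_real// (le_trans h1)//.
rewrite sqrrD expr1n mulr1 -addrA; have := sqr_ge0 (Lam * s); lra.
Qed.

Lemma qball_bounded s : bounded_by (Lam * s + 1) (qball s).
Proof. by move=> x /ltW /le_quad_form_bound. Qed.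

Lemma qball_lty s : (mu (qball s) < +oo)%E.
Proof. exact: lebesgue_cV_lty (qball_measurable s) (@qball_bounded s). Qed.

Lemma qball_integrable s f : polyf f -> mu.-integrable (qball s) (EFin \o f).
Proof. exact: (polyf_integrable (qball_measurable s) (@qball_bounded s)). Qed.

(** The integrand is the [i]-th derivative of [(s - q)^2 g]. Extended by 0 outside the ellipsoid,
    this function keeps a first-order expansion with quadratic remainder, because the positive part
    is squared; hence there is no boundary term. *)
Lemma divergence_qball i g s : polyf g ->
  \int[mu]_(x in qball s)
    (2 * (s - q x) * - partial i q x * g x + (s - q x) ^+ 2 * partial i g x) = 0.
Proof.
move=> pg.
have pq : polyf q by exact: polyf_quad_form.
have pw : polyf (fun x => s - q x) by exact: polyfB (polyf_cst s) pq.
pose w x := s - q x.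
pose W x := Num.max (w x) 0.
pose f x := W x ^+ 2 * g x.
pose f' x := W x ^+ 2 * partial i g x + (2 * W x * partial i w x) * g x.
have dw x : partial i w x = - partial i q x.
  have -> : w = (fun x => s + -1 * q x).
    by apply/funext => y; rewrite mulN1r.
  rewrite (partialD i x (polyf_cst s) (polyfZ (-1) pq)) partial_cst add0r.
  by rewrite (partialZ (-1) i x pq) mulN1r.
pose M0 := Num.max (Lam * s + 1) 0.
have M00 : 0 <= M0 by rewrite /M0 le_max lexx orbT.
have W0 x : ~ qball s x -> W x = 0.
  by move=> /negP; rewrite -leNgt => h; apply/max_r; rewrite subr_le0.
have WM x : ~ box M0 x -> W x = 0.
  move=> xM; apply: W0 => /qball_bounded h; apply: xM => k.
  by rewrite (le_trans (h k))// /M0 le_max lexx.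
have tf : taylor1 (M0 + 1) i f f'.
  exact: taylor1M (taylor1_posr_sqr (taylor1_polyf _ i pw)) (taylor1_polyf _ i pg).
have mw : measurable_fun setT w by exact: polyf_measurable.
have mW : measurable_fun setT W by apply: measurable_maxr.
have mg : measurable_fun setT g by exact: polyf_measurable.
have mdg : measurable_fun setT (partial i g).
  by apply: polyf_measurable; exact: polyf_partial.
have mdw : measurable_fun setT (partial i w).
  by apply: polyf_measurable; exact: polyf_partial.
have mW2 : measurable_fun setT (fun x => W x ^+ 2) by exact: measurable_funX.
have mf : measurable_fun setT f by exact: measurable_funM.
have mf' : measurable_fun setT f'.
  apply: measurable_funD; first exact: measurable_funM.
  apply: measurable_funM => //; apply: measurable_funM => //.
  by apply: measurable_funM.
have := Rintegral_taylor1 M00 tf mf mf' _ _.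
rewrite -(@Rintegral_support _ _ (qball s)); last first.
  by move=> x /W0 Wx; rewrite /f' Wx expr0n /= mulr0 !mul0r addr0.
move=> <-; last 2 first.
- by move=> x /WM Wx; rewrite /f Wx expr0n /= mul0r.
- by move=> x /WM Wx; rewrite /f' Wx expr0n /= mulr0 !mul0r addr0.
apply: eq_Rintegral => x; rewrite inE => xs.
have Wx : W x = s - q x by apply/max_l; rewrite subr_ge0 ltW.
by rewrite /f' Wx dw addrC.
Qed.

Lemma Rintegral_sum0 (D : set 'cV[R]_n) (I : finType) (F : I -> 'cV[R]_n -> R) :
  measurable D -> (forall a, mu.-integrable D (EFin \o F a)) ->
  (forall a, \int[mu]_(x in D) F a x = 0) ->
  \int[mu]_(x in D) (\sum_a F a x) = 0.
Proof.
move=> mD iF F0; rewrite /index_enum.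
have : mu.-integrable D (EFin \o (fun x => \sum_(a <- Finite.enum I) F a x)) /\
  \int[mu]_(x in D) (\sum_(a <- Finite.enum I) F a x) = 0; last by case.
elim: (Finite.enum I) => [|a s [is0 IHs]].
  under eq_fun do rewrite big_nil.
  split; first exact: integrable0.
  by rewrite Rintegral_cst// mul0r.
under eq_fun do rewrite big_cons.
split; first exact: (integrableD mD (iF a) is0).
by rewrite (RintegralD mD (iF a) is0) F0 IHs addr0.
Qed.

(** The divergence of [(s - q)^2 q^k Z grad h] combines [(s - q) q^k h] and [k (s - q)^2 q^(k-1) h].
    For [k = 0] only the first remains; for larger [k], one factor [s - q] of the second is expanded
    and induction applies. *)
Lemma harmonic_weighted_moment s d h m : Lharmonic Z d.+1 h ->
  \int[mu]_(x in qball s) ((s - q x) * (q x ^+ m * h x)) = 0.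
Proof.
move=> [hh h0]; have ph := hpoly_polyf hh.
have pq : polyf q by exact: polyf_quad_form.
have mD := qball_measurable s.
have pG (k : nat) i : polyf (fun x => q x ^+ k * Zgrad Z h i x).
  by apply: polyfM; [exact: polyf_exp|exact: polyf_Zgrad].
have pw : polyf (fun x => s - q x) by exact: polyfB (polyf_cst s) pq.
pose T (k : nat) i x := 2 * (s - q x) * - partial i q x * (q x ^+ k * Zgrad Z h i x) +
   (s - q x) ^+ 2 * partial i (fun x => q x ^+ k * Zgrad Z h i x) x.
have pT (k : nat) i : polyf (T k i).
  have pdq : polyf (partial i q) by exact: polyf_partial.
  apply: polyfD.
    apply: polyfM => //; apply: polyfM; first exact: polyfZ.
    by apply: (polyf_ext _ (polyfZ (-1) pdq)) => x; rewrite mulN1r.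
  by apply: polyfM; [exact: polyf_exp|exact: polyf_partial].
(* The degree of [h]; the argument divides by it, which is why constants are excluded. *)
pose l : R := d.+1%:R.
have TE (k : nat) x : \sum_i T k i x =
   - (4 * l) * ((s - q x) * (q x ^+ k * h x)) +
   2 * l * k%:R * ((s - q x) ^+ 2 * (q x ^+ k.-1 * h x)).
  transitivity ((- 2 * (s - q x) * q x ^+ k + (s - q x) ^+ 2 * (k%:R * q x ^+ k.-1)) *
      (\sum_i partial i q x * Zgrad Z h i x) +
     (s - q x) ^+ 2 * q x ^+ k * \sum_i partial i (Zgrad Z h i) x).
    rewrite !mulr_sumr -big_split /=; apply: eq_bigr => i _; rewrite /T.
    rewrite (partialM i x (polyf_exp k pq) (polyf_Zgrad Z i ph)).
    rewrite (partial_exp i x k pq).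
    move: (partial i (Zgrad Z h i) x) (partial i q x) (Zgrad Z h i x) => a b c.
    by move: (q x ^+ k) (q x ^+ k.-1) (q x) (k%:R : R) => *; ring.
  rewrite (euler_quad_form symZ symY ZY x hh) (sum_partial_Zgrad symZ x ph) h0 /l.
  by move: (q x ^+ k) (q x ^+ k.-1) (q x) (k%:R : R) (h x) (d.+1%:R : R) => *; ring.
have int0 (k : nat) : \int[mu]_(x in qball s)
   (- (4 * l) * ((s - q x) * (q x ^+ k * h x)) +
   2 * l * k%:R * ((s - q x) ^+ 2 * (q x ^+ k.-1 * h x))) = 0.
  under eq_Rintegral do rewrite -TE.
  apply: Rintegral_sum0 => // i; first exact: qball_integrable.
  exact: divergence_qball.
have l0 : 0 < l by rewrite ltr0n.
have pk (k : nat) : polyf (fun x => (s - q x) * (q x ^+ k * h x)).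
  by apply: polyfM => //; apply: polyfM => //; exact: polyf_exp.
elim: m => [|m IHm].
  have := int0 0%N; under eq_Rintegral do rewrite !mulr0 mul0r addr0.
  rewrite RintegralZl//; last exact: qball_integrable.
  by move=> /eqP; rewrite mulf_eq0 oppr_eq0 gt_eqF ?mulr_gt0//= => /eqP.
have := int0 m.+1.
(* Coefficients of the moments of order [m + 1] and [m] after [(s - q)^2 q^m = s (s - q) q^m - (s -
   q) q^(m+1)]. Both terms of [a] are negative, so it is nonzero. *)
pose a := - (4 * l) - 2 * l * m.+1%:R.
pose b := 2 * l * m.+1%:R * s.
have a0 : a != 0.
  have : 0 < 2 * l * m.+1%:R by rewrite !mulr_gt0.
  by rewrite /a => ?; rewrite lt_eqF//; lra.
under eq_Rintegral => x _.
  rewrite (_ : _ + _ = a * ((s - q x) * (q x ^+ m.+1 * h x)) +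
     b * ((s - q x) * (q x ^+ m * h x))); last first.
    rewrite /a /b /= exprS.
    by move: (q x ^+ m) (q x) (m.+1%:R : R) (h x) => *; ring.
  over.
rewrite RintegralD//; [|exact/qball_integrable/polyfZ|exact/qball_integrable/polyfZ].
rewrite RintegralZl ?RintegralZl//; [|exact: qball_integrable|exact: qball_integrable].
by rewrite IHm mulr0 addr0 => /eqP; rewrite mulf_eq0 (negbTE a0) => /eqP.
Qed.

(** Continuity of the measure from below: since [q < s] is strict, the smaller ellipsoids exhaust
    [qball s]. *)
Lemma qball_left_continuous s (e : R) : 0 < e ->
  exists2 del : R, 0 < del &
    fine (mu (qball s `\` qball (s - del))) < e.
Proof.
move=> e0.
pose F (m : nat) := qball (s - m.+1%:R^-1).
have FU : \bigcup_m F m = qball s.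
  apply/seteqP; split=> [x [m _]|x xs].
    by rewrite /F /qball /= => /lt_le_trans; apply; rewrite gerBl invr_ge0.
  have sx0 : 0 < s - q x by rewrite subr_gt0.
  have [m _ mP] := near_infty_natSinv_lt (PosNum sx0).
  have /= hm := mP m (leqnn m); exists m => //; rewrite /F /qball /=.
  by move: (_^-1) hm => r; lra.
have mF m : measurable (F m) by exact: qball_measurable.
have Fnd : nondecreasing_seq F.
  apply/nondecreasing_seqP => m; apply/subsetPset => x.
  rewrite /F /qball /= => /lt_le_trans; apply; rewrite lerD2l lerN2.
  by rewrite lef_pV2 ?posrE ?ltr0n// ler_nat.
have cF := @nondecreasing_cvg_mu _ _ _ mu F mF (bigcupT_measurable _ mF) Fnd.
rewrite FU in cF.
have fin t : mu (qball t) \is a fin_num by rewrite ge0_fin_numE// qball_lty.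
have cf : fine (mu (F m)) @[m --> \oo] --> fine (mu (qball s)).
  by apply: fine_cvg; rewrite fineK.
have /cvgrPdist_lt /(_ _ e0) [m _ mP] := cf.
exists m.+1%:R^-1; first by rewrite invr_gt0.
have FS : F m `<=` qball s by rewrite -FU; exact: bigcup_sup.
rewrite measureD//; [|exact: qball_measurable|exact: qball_measurable|exact: qball_lty].
rewrite setIidr// (fineB (fin s) (fin _)).
by rewrite (le_lt_trans (ler_norm _))// (mP m (leqnn m)).
Qed.

(* Obtained by differencing [harmonic_weighted_moment] in [s]: the weight [s - q]
   is at most [del] on the shell [s - del <= q < s]. *)
Lemma harmonic_moment s d h m : Lharmonic Z d.+1 h ->
  \int[mu]_(x in qball s) (q x ^+ m * h x) = 0.
Proof.
move=> hh; have ph := hpoly_polyf hh.1.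
have pq : polyf q by exact: polyf_quad_form.
have pf : polyf (fun x => q x ^+ m * h x) by apply: polyfM => //; exact: polyf_exp.
pose f x := q x ^+ m * h x.
set I := Rintegral _ _ _.
have [C Cf] := polyf_bounded (Lam * s + 1) pf.
have fC x : qball s x -> `|f x| <= C by move=> xs; apply: Cf; exact: qball_bounded.
have key (del : R) : 0 < del ->
    `|I| <= 2 * (C * fine (mu (qball s `\` qball (s - del)))).
  move=> del0; set A := qball (s - del); set B := qball s `\` A.
  have mA : measurable A by exact: qball_measurable.
  have mS := qball_measurable s.
  have mB : measurable B by exact: measurableD.
  have AS : A `<=` qball s.
    by move=> x /lt_le_trans; apply; rewrite gerBl ltW.
  have BS : B `<=` qball s by move=> x [].
  have Boo : (mu B < +oo)%E.
    by rewrite (le_lt_trans _ (qball_lty s))// le_measure ?inE.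
  have dAB : [disjoint A & B].
    by apply/disj_setPS => x [Ax [_ /(_ Ax)]].
  have AB : A `|` B = qball s by rewrite /B setDUK.
  have pwf : polyf (fun x => (s - q x) * f x).
    by apply: polyfM => //; exact: polyfB (polyf_cst s) pq.
  have intS g : polyf g -> mu.-integrable (qball s) (EFin \o g).
    exact: qball_integrable.
  have intA g : polyf g -> mu.-integrable A (EFin \o g).
    exact: qball_integrable.
  have intB g : polyf g -> mu.-integrable B (EFin \o g).
    by move=> pg; exact: (integrableS mS mB BS (intS _ pg)).
  have split g : polyf g -> \int[mu]_(x in qball s) g x =
      \int[mu]_(x in A) g x + \int[mu]_(x in B) g x.
    by move=> pg; rewrite -{1}AB Rintegral_setU// AB; exact: intS.
  have h1 := harmonic_weighted_moment s m hh.
  rewrite (split _ pwf) in h1.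
  (* On [A] the weight is [(s - del - q) + del], and the moment with weight [s - del - q] vanishes
     at the level [s - del]. *)
  have h2 : \int[mu]_(x in A) ((s - q x) * f x) = del * \int[mu]_(x in A) f x.
    have h3 := harmonic_weighted_moment (s - del) m hh.
    have pw' : polyf (fun x => (s - del - q x) * f x).
      by apply: polyfM => //; exact: polyfB (polyf_cst _) pq.
    transitivity (\int[mu]_(x in A) ((s - del - q x) * f x + del * f x)).
      by apply: eq_Rintegral => x _; ring.
    rewrite RintegralD//; [|exact: intA|by apply: intA; exact: polyfZ].
    by rewrite h3 add0r RintegralZl//; exact: intA.
  have IB : `|\int[mu]_(x in B) f x| <= C * fine (mu B).
    by apply: normr_Rintegral_le => //; [exact: intB|move=> x /BS /fC].
  have IwB : `|\int[mu]_(x in B) ((s - q x) * f x)| <= del * C * fine (mu B).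
    apply: normr_Rintegral_le => //; first exact: intB.
    move=> x [xs /negP]; rewrite -leNgt => xA; rewrite normrM.
    apply: ler_pM => //; last exact: fC.
    have xs' : q x < s by exact: xs.
    by rewrite ger0_norm; lra.
  (* The weighted moment at level [s] vanishes, so [del] times the integral over [A] is minus the
     weighted integral over the shell [B], where the weight is at most [del]. *)
  have IA : `|\int[mu]_(x in A) f x| <= C * fine (mu B).
    have -> : \int[mu]_(x in A) f x = - del^-1 * \int[mu]_(x in B) ((s - q x) * f x).
      move: h1; rewrite h2; move: (Rintegral _ A _) (Rintegral _ B _) => a b ab.
      have -> : b = - (del * a) by lra.
      by field; rewrite gt_eqF.
    have dn : `|- del^-1| = del^-1 by rewrite normrN gtr0_norm ?invr_gt0.
    by rewrite normrM dn mulrC ler_pdivrMr// mulrC mulrA.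
  rewrite /I (split _ pf) (le_trans (ler_normD _ _))//; move: IA IB.
  by move: (Rintegral _ A _) (Rintegral _ B _) (C * _) => *; lra.
apply/eqP/negPn/negP => I0.
have nI : 0 < `|I| by rewrite normr_gt0.
(* The sign of [C] is unknown; the absolute value and the added 1 make the divisor positive. *)
have C0 : 0 < 2 * `|C| + 1 by rewrite ltr_wpDl// mulr_ge0.
have [del del0 hdel] := qball_left_continuous s (divr_gt0 nI C0).
have := key _ del0; apply/negP; rewrite -ltNge.
move: hdel; rewrite ltr_pdivlMr//; set t := fine _ => tI.
have t0 : 0 <= t by rewrite fine_ge0.
have tC : C * t <= `|C| * t by rewrite ler_wpM2r// ler_norm.
have : 0 <= `|C| * t by rewrite mulr_ge0.
move: tI; rewrite mulrDr mulr1 mulrCA; lra.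
Qed.

(* [H s] solves the Dirichlet problem on the ellipsoid [q < s] with boundary
   values [f]; the last clause replaces integration over ellipsoidal shells. *)
Lemma fischer_dirichlet f : fischer Z Y f -> exists H : R -> 'cV[R]_n -> R,
  [/\ forall s, polyf (H s), forall s x, Lop Z (H s) x = 0,
      forall x, H (q x) x = f x, polyf (fun x => H (q x) 0) &
      forall s, \int[mu]_(x in qball s) f x =
                \int[mu]_(x in qball s) H (q x) 0].
Proof.
have pq : polyf q by exact: polyf_quad_form.
have fp g : fischer Z Y g -> polyf g.
  elim=> [m d h [hh _]|{}g g' _ pg _ pg']; last exact: polyfD.
  by apply: polyfM; [exact: polyf_exp|exact: hpoly_polyf hh].
elim=> [m d h hh|{}f g ff [H [H1 H2 H3 H4 H5]] fg [G [G1 G2 G3 G4 G5]]]; last first.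
  exists (fun s x => H s x + G s x); split.
  - by move=> s; exact: polyfD.
  - by move=> s x; rewrite LopD// H2 G2 addr0.
  - by move=> x; rewrite H3 G3.
  - exact: polyfD.
  - move=> s; have mD := qball_measurable s.
    have iq (k : 'cV[R]_n -> R) : polyf k -> mu.-integrable (qball s) (EFin \o k).
      exact: qball_integrable.
    rewrite (RintegralD mD (iq _ (fp _ ff)) (iq _ (fp _ fg))) H5 G5.
    by rewrite (RintegralD mD (iq _ H4) (iq _ G4)).
have ph := hpoly_polyf hh.1; have pm : polyf (fun x => q x ^+ m) by exact: polyf_exp.
exists (fun s x => s ^+ m * h x); split.
- by move=> s; exact: polyfZ.
- by move=> s x; rewrite (LopZ symZ)// hh.2 mulr0.
- by [].
- exact: polyfM pm (polyf_cst _).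
(* A term of degree 0 equals its value at the centre; one of positive degree vanishes at the centre
   and has vanishing moment. *)
- move=> s; case: d => [|d] in hh *.
    by apply: eq_Rintegral => x _; rewrite (hpoly0_const x hh.1).
  rewrite (harmonic_moment s m hh) (hpoly_at0 hh.1).
  under eq_Rintegral do rewrite mulr0.
  by rewrite Rintegral_cst ?mul0r//; exact: qball_measurable.
Qed.

End ellipsoid_moments.

(** * Comparison with harmonic polynomials *)

Lemma partial_shift (R : realType) (n : nat) (f : 'cV[R]_n -> R) (a : 'cV[R]_n) i :
  partial i (fun x => f (x + a)) = (fun x => partial i f (x + a)).
Proof.
apply/funext => x; rewrite !partialE /derive /=; congr (lim _).
by under [in RHS]eq_fun do rewrite addrA.
Qed.

Lemma polyf_shift (R : realType) (n : nat) (f : 'cV[R]_n -> R) (a : 'cV[R]_n) :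
  polyf f -> polyf (fun x => f (x + a)).
Proof.
elim=> [c|i|{}f g _ pf _ pg|{}f g _ pf _ pg].
- exact: polyf_cst.
- apply: (polyf_ext _ (polyfD (polyf_coor i) (polyf_cst (a i ord0)))) => x.
  by rewrite mxE.
- exact: polyfD.
- exact: polyfM.
Qed.

Section comparison.
Context {R : realType} {n : nat}.
Variables Z Y : 'M[R]_n.
Hypotheses (symZ : Z^T = Z) (symY : Y^T = Y) (ZY : Z *m Y = 1%:M).
Variable Lam : R.
Local Notation q := (quad_form Y).
Hypothesis coercive : forall (x : 'cV[R]_n) i, (x i ord0) ^+ 2 <= Lam * q x.
Hypothesis Lam_gt0 : 0 < Lam.
Hypothesis n_gt0 : (0 < n)%N.
Local Notation mu := (@lebesgue_cV R n).
Variables (Omega : set 'cV[R]_n) (u : 'cV[R]_n -> \bar R) (y0 : 'cV[R]_n).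
Hypotheses (oO : open Omega) (lscu : lsc_on Omega u).
Hypothesis uNy : forall x, Omega x -> (-oo < u x)%E.

Lemma quad_form0 : q 0 = 0.
Proof. by rewrite /quad_form mulmx0 mxE. Qed.

Lemma quad_form_ge0 x : 0 <= q x.
Proof.
have h := coercive x (Ordinal n_gt0).
by rewrite -(pmulr_rge0 _ Lam_gt0) (le_trans _ h)// sqr_ge0.
Qed.

Lemma quad_form_eq0 x : q x = 0 -> x = 0.
Proof.
move=> qx; apply/colP => i; rewrite mxE; have := coercive x i.
by rewrite qx mulr0 => h; apply/eqP; rewrite -sqrf_eq0 eq_le h sqr_ge0.
Qed.

Lemma cqball_compact s : compact [set x : 'cV[R]_n | q (x - y0) <= s].
Proof.
pose B := Lam * s + 1.
apply: (@cV_compact _ _ _ (B + `|y0|)).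
  move=> x xs i; have -> : x i ord0 = (x - y0) i ord0 + y0 i ord0.
    by rewrite !mxE subrK.
  rewrite (le_trans (ler_normD _ _))// lerD//.
    exact: (le_quad_form_bound coercive Lam_gt0 xs).
  have /mapP[j Hj ->] : `|y0 i ord0| \in [seq `|y0 x.1 x.2| | x : 'I_n * 'I_1].
    by apply/mapP; exists (i, ord0) => //=; rewrite mem_enum.
  by rewrite [leRHS]/Num.norm /= mx_normrE; apply/bigmax_geP; right => /=; exists j.
have cq : continuous (fun x : 'cV[R]_n => q (x - y0)).
  by apply: polyf_continuous; apply: polyf_shift; exact: polyf_quad_form.
apply: (closed_comp (f := fun x : 'cV[R]_n => q (x - y0)) (D := [set t | t <= s])).
  by move=> x _; exact: cq.
exact: closed_le.
Qed.

Hypothesis visc : forall x0 U phi, Omega x0 -> open U -> U x0 -> C2_on U phi ->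
  (phi x0)%:E = u x0 -> (\forall x \near x0, ((phi x)%:E <= u x)%E) ->
  mx_inner Z (hessian phi x0) <= 0.

(** If the minimum of [u - P] on the closed ellipsoid is negative, the boundary condition forces it
    to be interior. There a translate of [P] touches [u] from below, and the viscosity inequality
    contradicts [L P > 0]. *)
Lemma comparison_subharmonic P s : 0 <= s -> polyf P ->
  [set x : 'cV[R]_n | q (x - y0) <= s] `<=` Omega ->
  (forall x, 0 < Lop Z P x) ->
  (forall x : 'cV[R]_n, q (x - y0) = s -> ((P (x - y0))%:E < u x)%E) ->
  ((P 0)%:E <= u y0)%E.
Proof.
move=> s0 pP CO LP bd; set C := [set x : 'cV[R]_n | q (x - y0) <= s].
have Cy0 : C y0 by rewrite /C /= subrr quad_form0.
have pPs : polyf (fun x => P (x - y0)) by exact: polyf_shift.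
have cP := polyf_continuous pPs.
have pqs : polyf (fun x => q (x - y0)) by exact/polyf_shift/polyf_quad_form.
have cq := polyf_continuous pqs.
pose w x := (u x - (P (x - y0))%:E)%E.
have [x0 Cx0 wmin] : exists2 x, C x & forall y, C y -> (w x <= w y)%E.
  apply: compact_lsc_min; [by exists y0|exact: cqball_compact|].
  move=> x a Cx; rewrite /w lteBrDr// -EFinD => /ereal_between[b].
  rewrite lte_fin => /andP[ab bu].
  have n1 := lsc_on_near oO lscu (CO _ Cx) bu.
  have n2 : \forall y \near x, a + P (y - y0) < b.
    have cc : continuous (fun y : 'cV[R]_n => a + P (y - y0)).
      by move=> y; apply: continuousD; [exact: cst_continuous|exact: cP].
    exact: (cvgr_lt _ (cc x) _ ab).
  near=> y; move=> _; rewrite lteBrDr// -EFinD.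
  apply: (@lt_trans _ _ b%:E); last by near: y.
  by rewrite lte_fin; near: y.
have [w0|w0] := leP 0%E (w x0).
  by have := le_trans w0 (wmin _ Cy0); rewrite /w subrr sube_ge0// fin_numE.
exfalso.
have ux0 : (u x0 < (P (x0 - y0))%:E)%E.
  by move: w0; rewrite /w lteBlDr// add0e.
have ufin : u x0 \is a fin_num.
  by rewrite fin_numElt uNy ?(lt_trans ux0) ?ltry//; exact: CO.
have Ex0 : (fine (u x0))%:E = u x0 by rewrite fineK.
pose m := fine (u x0) - P (x0 - y0).
have xint : q (x0 - y0) < s.
  rewrite lt_neqAle Cx0 andbT; apply/eqP => /bd /(lt_trans ux0).
  by rewrite ltxx.
have pphi : polyf (fun x => P (x - y0) + m) by exact: polyfD (polyf_cst m).
have Ox0 : Omega x0 by exact: CO.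
have phi0 : (P (x0 - y0) + m)%:E = u x0 by rewrite /m addrC subrK.
have nphi : \forall x \near x0, ((P (x - y0) + m)%:E <= u x)%E.
  have n1 : \forall x \near x0, q (x - y0) < s.
    exact: (cvgr_lt _ (cq x0) _ xint).
  apply: filterS n1 => x /ltW Cx; have := wmin x Cx.
  have -> : w x0 = m%:E by rewrite /w /m EFinB Ex0.
  by rewrite /w leeBrDr// -EFinD addrC.
have := visc Ox0 openT I (polyf_C2 _ pphi) phi0 nphi.
apply/negP; rewrite -ltNge.
have := LopD Z x0 pPs (polyf_cst m).
rewrite {1}/Lop => ->; rewrite Lop_cst// addr0.
suff -> : Lop Z (fun x => P (x - y0)) x0 = Lop Z P (x0 - y0) by exact: LP.
transitivity (\sum_i \sum_j Z i j * partial i (partial j (fun x => P (x - y0))) x0).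
  exact: LopE.
transitivity (\sum_i \sum_j Z i j * partial i (partial j P) (x0 - y0)); last first.
  exact/esym/LopE.
apply: eq_bigr => i _; apply: eq_bigr => j _.
have -> : partial j (fun x => P (x - y0)) = (fun x => partial j P (x - y0)).
  exact: partial_shift.
exact: (congr1 (fun k => Z i j * k x0) (partial_shift (partial j P) (- y0) i)).
Unshelve. all: by end_near. Qed.

(** The bound is pointwise: on each level [t = q x], comparison on [q <= t] gives [H t 0 <= c], and
    the integral of [p] equals that of [H (q x) 0]. *)
Lemma polyf_mean_le p s (c : R) : 0 < s -> polyf p ->
  [set x : 'cV[R]_n | q (x - y0) <= s] `<=` Omega ->
  (forall x : 'cV[R]_n, q (x - y0) <= s -> ((p (x - y0))%:E < u x)%E) ->
  (u y0 <= c%:E)%E ->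
  \int[mu]_(x in qball Y s) p x <= c * fine (mu (qball Y s)).
Proof.
move=> s0 pp CO pu uc.
have pq : polyf q by exact: polyf_quad_form.
have fp := polyf_fischer symZ symY ZY n_gt0 pp.
have [H [H1 H2 H3 H4 H5]] :=
  fischer_dirichlet symZ symY ZY coercive Lam_gt0 fp.
rewrite H5 -Rintegral_cst; last exact: qball_measurable.
apply: le_Rintegral; first exact: qball_measurable.
- exact: (qball_integrable coercive Lam_gt0).
- by apply: (qball_integrable coercive Lam_gt0); exact: polyf_cst.
move=> x xs; set t := q x.
have ts : t <= s by exact: ltW.
(* The degenerate level is the centre itself, where [H 0 0 = p 0]. *)
have [t0|t0] := eqVneq t 0.
  have x0 := quad_form_eq0 t0; rewrite t0.
  have -> : H 0 0 = p 0 by rewrite -[in LHS]quad_form0 H3.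
  have := pu y0; rewrite subrr quad_form0 => /(_ (ltW s0)) /lt_le_trans.
  by move=> /(_ _ uc); rewrite lte_fin => /ltW.
have tp : 0 < t by rewrite lt_neqAle eq_sym t0 quad_form_ge0.
apply/ler_addgt0Pr => e e0.
(* With this choice the perturbation costs exactly [e] at the centre and nothing on the boundary. *)
pose del := e / t.
have del0 : 0 < del by rewrite divr_gt0.
pose P x := H t x + del * (q x - t).
have pqt : polyf (fun x => q x - t) by exact: polyfB pq (polyf_cst t).
have pP : polyf P by apply: polyfD => //; exact: polyfZ.
have LP y : 0 < Lop Z P y.
  rewrite /P LopD//; last exact: polyfZ.
  rewrite H2 add0r LopZ//.
  rewrite (LopD Z y pq (polyf_cst (- t))) Lop_cst// addr0.
  by rewrite (Lop_quad_form symZ symY ZY) mulr_gt0// mulr_gt0// ltr0n.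
have : ((P 0)%:E <= u y0)%E.
  apply: (comparison_subharmonic (ltW tp) pP) => //.
    by move=> y yt; apply: CO; exact: le_trans yt ts.
  move=> y yt; rewrite /P yt subrr mulr0 addr0 -yt H3.
  by apply: pu; rewrite yt.
move=> /le_trans /(_ uc); rewrite lee_fin /P quad_form0 sub0r mulrN.
by rewrite /del divfK// lerBlDr.
Qed.

End comparison.

(** * Approximation from below by maxima of paraboloids *)

Section uniform_approximation.
Context {R : realType} {n : nat}.
Implicit Types (f g p : 'cV[R]_n -> R) (M : R).

Definition unif_polyf M f := forall e, 0 < e -> exists2 p, polyf p &
  forall x, box M x -> `|f x - p x| <= e.

Lemma unif_polyfW M f : polyf f -> unif_polyf M f.
Proof. by move=> pf e e0; exists f => // x _; rewrite subrr normr0 ltW. Qed.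

Lemma unif_polyf_ext M f g : f =1 g -> unif_polyf M f -> unif_polyf M g.
Proof. by move=> /funext ->. Qed.

Lemma unif_polyfD M f g : unif_polyf M f -> unif_polyf M g ->
  unif_polyf M (fun x => f x + g x).
Proof.
move=> uf ug e e0; have e20 : 0 < e / 2 by rewrite divr_gt0.
have [p pp hp] := uf _ e20; have [r pr hr] := ug _ e20.
exists (fun x => p x + r x); first exact: polyfD.
move=> x xM; have -> : f x + g x - (p x + r x) = (f x - p x) + (g x - r x) by ring.
by rewrite (le_trans (ler_normD _ _))// [leRHS](splitr e) lerD ?hp ?hr.
Qed.

Lemma unif_polyfZ M f c : unif_polyf M f -> unif_polyf M (fun x => c * f x).
Proof.
move=> uf e e0; have c0 : 0 < `|c| + 1 by rewrite ltr_wpDl.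
have [p pp hp] := uf _ (divr_gt0 e0 c0).
exists (fun x => c * p x); first exact: polyfZ.
move=> x xM; rewrite -mulrBr normrM.
apply: (@le_trans _ _ ((`|c| + 1) * (e / (`|c| + 1)))).
  by apply: ler_pM => //; [rewrite lerDl|exact: hp].
by rewrite mulrC divfK// gt_eqF.
Qed.

(* Polynomial iteration for [|t|], as in the proof of the Stone-Weierstrass
   theorem. *)
Fixpoint abs_iter (t : R) (k : nat) : R :=
  if k is k'.+1 then abs_iter t k' + (t ^+ 2 - abs_iter t k' ^+ 2) / 2 else 0.

(** The error [d] becomes [d (1 - (|t| + a) / 2)], at most [d (1 - d / 2)]. If [d K <= 2] then [d (1
    - d / 2) (K + 1) <= (2 + d) (1 - d / 2) <= 2], so the error decays like [2 / (k + 2)]. *)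
Lemma abs_iter_bound t k : `|t| <= 1 ->
  [/\ 0 <= abs_iter t k, abs_iter t k <= `|t| &
      (`|t| - abs_iter t k) * k.+2%:R <= 2].
Proof.
move=> t1; elim: k => [|k [a0 at1 IH]] /=; first by rewrite subr0; split => //; lra.
have t0 : 0 <= `|t| by [].
rewrite -[t ^+ 2]real_normK ?num_real//.
move: (abs_iter t k) (`|t|) a0 at1 IH t1 t0 => a b a0 ab IH b1 b0.
have K0 : (0 : R) <= k.+2%:R by [].
rewrite -[k.+3%:R]natr1; move: (k.+2%:R : R) IH K0 => K IH K0.
split.
- have : 0 <= (b - a) * (b + a) by rewrite mulr_ge0 ?subr_ge0 ?addr_ge0.
  rewrite !expr2; lra.
- have : 0 <= (b - a) * (2 - (b + a)) by rewrite mulr_ge0 ?subr_ge0//; lra.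
  rewrite !expr2; lra.
- have e1 : b - (a + (b ^+ 2 - a ^+ 2) / 2) = (b - a) * (1 - (b + a) / 2) by field.
  rewrite e1.
  have h1 : (b - a) * (1 - (b + a) / 2) <= (b - a) * (1 - (b - a) / 2).
    by rewrite ler_wpM2l ?subr_ge0//; lra.
  apply: (@le_trans _ _ ((b - a) * (1 - (b - a) / 2) * (K + 1))).
    by rewrite ler_wpM2r// addr_ge0.
  move: IH; set d := b - a => IH.
  have d0 : 0 <= d by rewrite subr_ge0.
  have d1 : 0 <= 1 - d / 2 by rewrite /d; lra.
  have : (d * K + d) * (1 - d / 2) <= (2 + d) * (1 - d / 2).
    by rewrite ler_wpM2r// lerD2r.
  have := sqr_ge0 d; rewrite expr2.
  have -> : d * (1 - d / 2) * (K + 1) = (d * K + d) * (1 - d / 2) by ring.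
  lra.
Qed.

Lemma polyf_abs_iter p k : polyf p -> polyf (fun x => abs_iter (p x) k).
Proof.
move=> pp; elim: k => [|k IHk]; first exact: polyf_cst.
have pB : polyf (fun x => 2^-1 * (p x ^+ 2 - abs_iter (p x) k ^+ 2)).
  by apply: polyfZ; apply: polyfB; exact: polyf_exp.
by apply: (polyf_ext _ (polyfD IHk pB)) => x /=; rewrite [2^-1 * _]mulrC.
Qed.

Lemma unif_polyf_abs M f : unif_polyf M f -> unif_polyf M (fun x => `|f x|).
Proof.
move=> uf e e0; have e20 : 0 < e / 2 by rewrite divr_gt0.
have [p pp hp] := uf _ e20.
have [C pC] := polyf_bounded M pp.
pose D := `|C| + 1.
have D0 : 0 < D by rewrite ltr_wpDl.
have pD x : box M x -> `|D^-1 * p x| <= 1.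
  move=> xM; rewrite normrM gtr0_norm ?invr_gt0// ler_pdivrMl// mulr1.
  by rewrite (le_trans (pC _ xM))// (le_trans (ler_norm _))// lerDl.
(* The iteration runs on [p / D], of absolute value at most 1; its error [2 / (k + 1)] must stay
   below [e / 2] after multiplication by [D]. *)
have d0 : 0 < e / 2 / (2 * D) by rewrite divr_gt0// mulr_gt0.
have [k _ kP] := near_infty_natSinv_lt (PosNum d0).
have /= hk := kP k (leqnn k).
exists (fun x => D * abs_iter (D^-1 * p x) k).
  by apply: polyfZ; apply: polyf_abs_iter; exact: polyfZ.
move=> x xM; have [a0 a1 a2] := abs_iter_bound k (pD _ xM).
set a := abs_iter _ k in a0 a1 a2 *; set t := D^-1 * p x in a1 a2.
have -> : `|f x| - D * a = (`|f x| - `|p x|) + D * (`|t| - a).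
  rewrite mulrBr /t normrM gtr0_norm ?invr_gt0// mulrA divff ?gt_eqF// mul1r; ring.
rewrite (le_trans (ler_normD _ _))// [leRHS](splitr e) lerD//.
  by rewrite (le_trans (ler_dist_dist _ _))// hp.
have ta0 : 0 <= `|t| - a by rewrite subr_ge0.
rewrite ger0_norm; last by rewrite mulr_ge0// ltW.
have k1 : (0 : R) < k.+1%:R by [].
have h : (`|t| - a) * k.+1%:R <= 2.
  by apply: le_trans a2; rewrite ler_wpM2l// ler_nat.
have h2 : `|t| - a <= 2 * k.+1%:R^-1 by rewrite ler_pdivlMr.
apply: (@le_trans _ _ (D * (2 * k.+1%:R^-1))); first by rewrite ler_wpM2l// ltW.
apply: (@le_trans _ _ (D * (2 * (e / 2 / (2 * D))))).
  by rewrite ler_wpM2l ?ltW// ltr_pM2l.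
have -> : D * (2 * (e / 2 / (2 * D))) = e / 2; last by [].
by field; rewrite gt_eqF.
Qed.

Lemma unif_polyf_max M f g : unif_polyf M f -> unif_polyf M g ->
  unif_polyf M (fun x => Num.max (f x) (g x)).
Proof.
move=> uf ug.
have h : unif_polyf M (fun x => f x + -1 * g x).
  exact: unif_polyfD uf (unif_polyfZ (-1) ug).
have := unif_polyfZ (2^-1) (unif_polyfD (unif_polyfD uf ug) (unif_polyf_abs h)).
by apply: unif_polyf_ext => x; rewrite maxr_absE mulN1r mulrC.
Qed.

End uniform_approximation.

Section sup_of_paraboloids.
Context {R : realType} {n : nat}.
Variable C : set 'cV[R]_n.
Variable v : 'cV[R]_n -> \bar R.
Hypothesis lscv : forall x a, C x -> (a%:E < v x)%E -> \forall y \near x, (a%:E < v y)%E.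
Variable b : R.
Hypothesis bv : forall x, C x -> (b%:E < v x)%E.

Let I := (rat * nat * 'cV[rat]_n)%type.

(** Height and vertex are rational and the opening is a natural number, so the family is
    countable. *)
Definition paraboloid (i : I) (x : 'cV[R]_n) : R :=
  ratr i.1.1 - i.1.2%:R * \sum_j (x j ord0 - ratr (i.2 j ord0)) ^+ 2.

Lemma polyf_paraboloid i : polyf (paraboloid i).
Proof.
apply: polyfB; first exact: polyf_cst.
apply: polyfZ; apply: polyf_sum => j; apply: polyf_exp.
apply: polyfB; [exact: polyf_coor|exact: polyf_cst].
Qed.

(** An enumeration of the paraboloids strictly below [v] on [C]. Every other index yields the
    constant [b], which is itself a strict minorant. *)
Definition below (m : nat) : 'cV[R]_n -> R :=
  if unpickle m is Some i then
    if `[< forall x, C x -> ((paraboloid i x)%:E < v x)%E >] then paraboloid i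
    else fun=> b
  else fun=> b.

Lemma polyf_below m : polyf (below m).
Proof.
rewrite /below; case: unpickle => [i|]; last exact: polyf_cst.
by case: ifP => _; [exact: polyf_paraboloid|exact: polyf_cst].
Qed.

Lemma below_lt m x : C x -> ((below m x)%:E < v x)%E.
Proof.
move=> Cx; rewrite /below; case: unpickle => [i|]; last exact: bv.
by case: ifPn => [/asboolP|_]; [exact|exact: bv].
Qed.

(** A narrow paraboloid with vertex very near [x]: its height is below the values of [v] around [x],
    it has fallen to [b] outside that neighbourhood, and it has lost almost nothing at [x]. *)
Lemma paraboloid_dense x a : C x -> (a%:E < v x)%E -> exists i,
  a < paraboloid i x /\ forall y, C y -> ((paraboloid i y)%:E < v y)%E.
Proof.
move=> Cx /ereal_between[a' /andP[]]; rewrite lte_fin => aa' a'v.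
have /nbhs_ballP[r /= r0 rv] := lscv Cx a'v.
have [al] := rat_in_itvoo aa'; rewrite in_itv /= => /andP[aal ala'].
have r4 : 0 < r ^+ 2 / 4 by rewrite divr_gt0// exprn_gt0.
(* Steep enough to fall to [b] or lower wherever some coordinate is at least [r / 2] away from the
   vertex. *)
pose k := (Num.truncn ((ratr al - b) / (r ^+ 2 / 4))).+1.
have kP : ratr al - b <= k%:R * (r ^+ 2 / 4).
  by rewrite -ler_pdivrMr// ltW// truncnS_gt.
pose A := ratr al - a.
have A0 : 0 < A by rewrite subr_gt0.
pose kn : R := k%:R * n%:R.
have kn0 : 0 <= kn by rewrite mulr_ge0.
have kn1 : 0 < kn + 1 by rewrite ltr_wpDl.
(* The three bounds keep the vertex within [r / 2] of [x], allow [del^2 <= del], and make the loss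
   at [x], at most [k n del], smaller than [A]. *)
pose del := Num.min (r / 2) (Num.min 1 (A / (kn + 1))).
have del0 : 0 < del by rewrite !lt_min !divr_gt0//= ltr01.
have delr : del <= r / 2 by rewrite ge_min lexx.
have del1 : del <= 1 by rewrite !ge_min lexx orbT.
have delA : del <= A / (kn + 1) by rewrite !ge_min lexx !orbT.
have c j : {y : rat | `|x j ord0 - ratr y| < del}.
  apply: cid.
  have [y] : exists y, ratr y \in `](x j ord0 - del), (x j ord0 + del)[.
    by apply: rat_in_itvoo; rewrite ltrBlDr -addrA ltrDl addr_gt0.
  by rewrite in_itv /= -ltr_distl distrC; exists y.
pose y : 'cV[rat]_n := \col_j sval (c j).
have yx j : `|x j ord0 - ratr (y j ord0)| < del by rewrite mxE; exact: (svalP (c j)).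
exists (al, k, y); split.
  rewrite /paraboloid /= ltrBrDr -ltrBrDl -/A.
  apply: (@le_lt_trans _ _ (kn * del)).
    rewrite /kn -mulrA ler_wpM2l//.
    apply: (@le_trans _ _ (\sum_(j < n) del)).
      apply: ler_sum => j _; rewrite -real_normK ?num_real//.
      have h := yx j; rewrite expr2 (le_trans _ (_ : del * 1 <= del))//.
        by apply: ler_pM => //; apply/ltW => //; exact: lt_le_trans del1.
      by rewrite mulr1.
    by rewrite sumr_const card_ord mulr_natl.
  apply: (@le_lt_trans _ _ (kn * (A / (kn + 1)))); first by rewrite ler_wpM2l.
  rewrite mulrA ltr_pdivrMr// [ltLHS]mulrC ltr_pM2l// ltrDl//.
move=> z Cz; rewrite /paraboloid /=.
have s0 : 0 <= \sum_j (z j ord0 - ratr (y j ord0)) ^+ 2.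
  by apply: sumr_ge0 => j _; rewrite sqr_ge0.
have [zx|zx] := pselect (ball x r z).
  apply: le_lt_trans (rv z zx); rewrite lee_fin lerBlDr.
  by rewrite (le_trans (ltW ala'))// lerDl mulr_ge0.
apply: le_lt_trans (bv Cz); rewrite lee_fin lerBlDr -lerBlDl (le_trans kP)//.
rewrite ler_wpM2l//.
have [j zj] : exists j, r <= `|x j ord0 - z j ord0|.
  apply: contrapT => nj; apply: zx; apply/cV_ballP; split => // j.
  by rewrite ltNge; apply/negP => h; apply: nj; exists j.
rewrite (bigD1 j)//= ler_wpDr//; first by apply: sumr_ge0 => i _; rewrite sqr_ge0.
have -> : r ^+ 2 / 4 = (r / 2) ^+ 2 by field.
rewrite -[leRHS]real_normK ?num_real// lerXn2r// ?nnegrE ?divr_ge0 ?ltW//.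
have := ler_distD (ratr (y j ord0)) (x j ord0) (z j ord0).
have := yx j; rewrite [`|ratr _ - z _ _|]distrC.
move: zj delr; lra.
Qed.

Fixpoint below_max (m : nat) (x : 'cV[R]_n) : R :=
  if m is m'.+1 then Num.max (below_max m' x) (below m' x) else b.

Lemma unif_below_max M m : unif_polyf M (below_max m).
Proof.
elim: m => [|m IHm]; first exact/unif_polyfW/polyf_cst.
by apply: unif_polyf_max => //; exact/unif_polyfW/polyf_below.
Qed.

Lemma measurable_below_max m : measurable_fun setT (below_max m).
Proof.
elim: m => [|m IHm]; first exact: measurable_cst.
by apply: measurable_maxr => //; apply: polyf_measurable; exact: polyf_below.
Qed.

Lemma below_max_lt m x : C x -> ((below_max m x)%:E < v x)%E.
Proof.
move=> Cx; elim: m => [|m IHm] /=; first exact: bv.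
by rewrite EFin_max gt_max IHm below_lt.
Qed.

Lemma below_max_ge m x : b <= below_max m x.
Proof. by elim: m => [//|m IHm] /=; rewrite le_max IHm. Qed.

Lemma below_max_nd x : nondecreasing_seq (below_max^~ x).
Proof. by apply/nondecreasing_seqP => m /=; rewrite le_max lexx. Qed.

Lemma below_max_cvg x : C x -> (below_max m x)%:E @[m --> \oo] --> v x.
Proof.
move=> Cx.
have nd : nondecreasing_seq (fun m => (below_max m x)%:E).
  by move=> i j ij; rewrite lee_fin; exact: below_max_nd.
suff <- : ereal_sup (range (fun m => (below_max m x)%:E)) = v x.
  exact: ereal_nondecreasing_cvgn.
apply/eqP; rewrite eq_le; apply/andP; split.
  by apply: ge_ereal_sup => _ [m _ <-]; exact/ltW/below_max_lt.
rewrite leNgt; apply/negP => /ereal_between[a /andP[sa av]].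
have [i [ai iv]] := paraboloid_dense Cx av.
have [m mE] : exists m, below m = paraboloid i.
  exists (pickle i); rewrite /below pickleK.
  by case: asboolP => // /(_ iv).
(* [below m] enters the maximum at index [m + 1]. *)
have /ereal_sup_ubound : range (fun m => (below_max m x)%:E)
    (below_max m.+1 x)%:E by exists m.+1.
apply/negP; rewrite -ltNge (lt_le_trans sa)// lee_fin /= le_max mE.
by rewrite (ltW ai) orbT.
Qed.

End sup_of_paraboloids.

(** * From polynomials to lower semicontinuous functions *)

Section lsc_mean.
Context {R : realType} {n : nat}.
Local Notation mu := (@lebesgue_cV R n).
Variables (S C : set 'cV[R]_n) (M : R) (v : 'cV[R]_n -> \bar R) (c : R).
Hypotheses (mS : measurable S) (bS : bounded_by M S) (SC : S `<=` C).
Hypothesis lscv : forall x a, C x -> (a%:E < v x)%E -> \forall y \near x, (a%:E < v y)%E.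
Hypothesis mv : measurable_fun S v.
Hypothesis mean_polyf : forall p, polyf p ->
  (forall x, C x -> ((p x)%:E < v x)%E) -> \int[mu]_(x in S) p x <= c * fine (mu S).

Let muS_fin : mu S \is a fin_num.
Proof. by rewrite ge0_fin_numE//; exact: lebesgue_cV_lty bS. Qed.

(** If [p] is within [d] of [f] on the box, then [p - d] is a polynomial strictly below [v], and [f]
    exceeds it by at most [2 d]. *)
Lemma unif_mean f : measurable_fun setT f -> unif_polyf M f -> C `<=` box M ->
  (forall x, C x -> ((f x)%:E < v x)%E) -> 
  mu.-integrable S (EFin \o f) /\ \int[mu]_(x in S) f x <= c * fine (mu S).
Proof.
move=> mf uf CM fv.
have intf : mu.-integrable S (EFin \o f).
  have [p pp hp] := uf _ ltr01.
  have [D pD] := polyf_bounded M pp.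
  apply: (cV_integrable (C := D + 1) mS bS); first exact: measurable_funTS.
  move=> x Sx; have xM : box M x by exact: bS.
  have -> : f x = p x + (f x - p x) by rewrite addrC subrK.
  by rewrite (le_trans (ler_normD _ _))// lerD ?pD ?hp.
split=> //; apply/ler_addgt0Pr => e e0.
(* Then [2 d] times the measure of [S] is at most [e]; the added 1 covers measure 0. *)
pose d := e / (2 * (fine (mu S) + 1)).
have m0 : 0 <= fine (mu S) by rewrite fine_ge0.
have d0 : 0 < d by rewrite divr_gt0// mulr_gt0// ltr_wpDl.
have [p pp hp] := uf _ d0.
have pd : polyf (fun x => p x + - d) by exact: polyfD (polyf_cst _).
have ip : mu.-integrable S (EFin \o (fun x => p x + - d)).
  exact: (polyf_integrable mS bS).
have ic : mu.-integrable S (EFin \o (fun=> 2 * d)).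
  by apply: (polyf_integrable mS bS); exact: polyf_cst.
have h1 : \int[mu]_(x in S) (p x + - d) <= c * fine (mu S).
  apply: mean_polyf => // x Cx; apply: le_lt_trans (fv x Cx).
  by rewrite lee_fin; have := hp x (CM _ Cx); rewrite ler_norml => /andP[]; lra.
have h2 : \int[mu]_(x in S) f x <= \int[mu]_(x in S) (p x + - d + 2 * d).
  apply: le_Rintegral => //; first exact: (integrableD mS ip ic).
  by move=> x Sx; have := hp x (bS Sx); rewrite ler_norml => /andP[]; lra.
rewrite (le_trans h2)// RintegralD// Rintegral_cst// lerD//.
rewrite /d; have -> : 2 * (e / (2 * (fine (mu S) + 1))) * fine (mu S) =
    e * (fine (mu S) / (fine (mu S) + 1)).
  by field; rewrite gt_eqF// ltr_wpDl.
by rewrite ler_piMr ?(ltW e0)// ler_pdivrMr ?mul1r ?lerDl// ltr_wpDl.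
Qed.

Hypothesis CM : C `<=` box M.
Variable b : R.
Hypothesis bv : forall x, C x -> (b%:E < v x)%E.

(** Subtracting the lower bound [b] makes the approximants nonnegative, as monotone convergence
    requires. *)
Lemma lsc_integral_le :
  (\int[mu]_(x in S) (v x - b%:E) <= ((c - b) * fine (mu S))%:E)%E.
Proof.
pose g m x := (below_max C v b m x - b)%:E.
have g0 m x : S x -> (0 <= g m x)%E.
  by move=> _; rewrite /g lee_fin subr_ge0 below_max_ge.
have mg m : measurable_fun S (g m).
  apply/measurable_EFinP; apply: measurable_funB => //.
  by apply: measurable_funTS; exact: measurable_below_max.
have ndg x : S x -> nondecreasing_seq (g^~ x).
  by move=> _ i j ij; rewrite lee_fin lerB//; exact: below_max_nd.
have -> : (\int[mu]_(x in S) (v x - b%:E) = \int[mu]_(x in S) limn (g^~ x))%E.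
  apply: eq_integral => x; rewrite inE => Sx; apply/esym/cvg_lim => //.
  have h := below_max_cvg lscv bv (SC Sx).
  under eq_fun do rewrite /g EFinB.
  by apply: cvgeB => //; [rewrite fin_num_adde_defl|exact: cvg_cst].
rewrite monotone_convergence//; apply: lime_le.
  apply: ereal_nondecreasing_is_cvgn => i j ij.
  by apply: ge0_le_integral => // x Sx; [exact: g0|exact: (ndg x Sx _ _ ij)].
apply: nearW => m.
have [ib hb] := unif_mean (measurable_below_max C v b m)
  (unif_below_max C v b M m) CM (fun x Cx => below_max_lt bv m Cx).
have ic : mu.-integrable S (EFin \o (fun=> b)).
  by apply: (polyf_integrable mS bS); exact: polyf_cst.
have ig : mu.-integrable S (g m) by exact: (integrableB mS ib ic).
rewrite -[X in (X <= _)%E]fineK; last exact: integrable_fin_num.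
rewrite lee_fin -/(Rintegral mu S (fun x => below_max C v b m x - b)).
by rewrite RintegralB// Rintegral_cst// mulrBl lerB.
Qed.

(** On [S] the function [v - c] is integrable with integral at most 0. The statement separates the
    two parts because only this form passes to a union on which [v] may be unbounded below. *)
Lemma lsc_funepos_le :
  (\int[mu]_(x in S) (fun x => v x - c%:E)^\+ x <=
   \int[mu]_(x in S) (fun x => v x - c%:E)^\- x)%E.
Proof.
pose w x := (v x - b%:E)%E.
have w0 x : S x -> (0 <= w x)%E.
  by move=> Sx; rewrite /w suber_ge0// ltW// bv//; exact: SC.
have mw : measurable_fun S w.
  by apply: emeasurable_funB => //; exact: measurable_cst.
have iw : mu.-integrable S w.
  apply/integrableP; split=> //.
  rewrite (eq_integral w) => [|x /[!inE] Sx]; last by rewrite gee0_abs// w0.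
  apply: (le_lt_trans lsc_integral_le); exact: ltry.
have ic : mu.-integrable S (EFin \o (fun=> b - c)).
  by apply: (polyf_integrable mS bS); exact: polyf_cst.
have E x : (v x - c%:E = w x + (b - c)%:E)%E.
  rewrite /w; case: (v x) => [r||] //=.
  by rewrite -!EFinB -EFinD; congr EFin; ring.
have ig : mu.-integrable S (fun x => v x - c%:E)%E.
  by under eq_fun do rewrite E; exact: integrableD.
have : (\int[mu]_(x in S) (v x - c%:E) <= 0)%E.
  under eq_integral do rewrite E.
  rewrite integralD// integral_cst//.
  apply: (@le_trans _ _ (((c - b) * fine (mu S))%:E + (b - c)%:E * mu S)%E).
    by rewrite leeD2r//; exact: lsc_integral_le.
  rewrite -{2}(fineK muS_fin) -EFinM -EFinD lee_fin.
  by rewrite le_eqVlt; apply/orP; left; apply/eqP; ring.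
rewrite integralE sube_le0 //.
Qed.

End lsc_mean.

(** * Exhaustion of the open ellipsoid *)

Section mean_value_exhaustion.
Context {R : realType} {n : nat}.
Local Notation mu := (@lebesgue_cV R n).

(** If the negative part of [v - c] has finite integral, then so has the positive part, and the
    claim is linearity of the integral. Otherwise the negative part of [v] has infinite integral and
    the integral of [v] is [-oo]. *)
Lemma integral_le_cst (E : set 'cV[R]_n) (v : 'cV[R]_n -> \bar R) (c : R) :
  measurable E -> (mu E < +oo)%E -> measurable_fun E v ->
  (\int[mu]_(x in E) (fun x => v x - c%:E)^\+ x <=
   \int[mu]_(x in E) (fun x => v x - c%:E)^\- x)%E ->
  (\int[mu]_(x in E) v x <= c%:E * mu E)%E.
Proof.
move=> mE Eoo mv; set g := (fun x => (v x - c%:E)%E) => gle.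
have mg : measurable_fun E g.
  by apply: emeasurable_funB => //; exact: measurable_cst.
have iC k : mu.-integrable E (EFin \o (fun=> k : R)).
  apply: measurable_bounded_integrable => //.
  by exists `|k|; split; [exact: num_real|move=> r kr x Ex /=; exact: ltW].
have [goo|goo] := eqVneq (\int[mu]_(x in E) g^\- x)%E +oo%E; last first.
  have gltoo : (\int[mu]_(x in E) g^\- x < +oo)%E by rewrite ltey.
  have ig : mu.-integrable E g.
    apply/integrableP; split => //.
    under eq_integral do rewrite -/((abse \o g) _) fune_abse.
    rewrite ge0_integralD//; last 2 first.
      exact: measurable_funepos.
      exact: measurable_funeneg.
    by rewrite lte_add_pinfty// (le_lt_trans gle).
  have -> : (\int[mu]_(x in E) v x = \int[mu]_(x in E) (g x + c%:E))%E.
    by apply: eq_integral => x _; rewrite /g subeK.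
  rewrite integralD//; last exact: iC.
  have g0 : (\int[mu]_(x in E) g x <= 0)%E by rewrite integralE sube_le0.
  by rewrite integral_cst// -[leRHS]add0e leeD2r.
(* On a set of finite measure the constant [c] cannot make the integral of the negative part
   infinite. *)
have vneg : (\int[mu]_(x in E) v^\- x)%E = +oo%E.
  apply: contrapT => /eqP vn.
  have vlt : (\int[mu]_(x in E) v^\- x < +oo)%E by rewrite ltey.
  have : (\int[mu]_(x in E) g^\- x <= \int[mu]_(x in E) (v^\- x + `|c|%:E))%E.
    apply: ge0_le_integral => //.
    - exact: measurable_funeneg.
    - apply: emeasurable_funD; [exact: measurable_funeneg|exact: measurable_cst].
    - move=> x Ex; rewrite !funenegE /g ge_max; apply/andP; split; last first.
        by rewrite adde_ge0// le_max lexx orbT.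
      case: (v x) => [r| |] //=.
        rewrite -EFin_max -EFinD lee_fin.
        have : - r <= Num.max (- r) 0 by rewrite le_max lexx.
        have := ler_norm c; lra.
      by rewrite leNye.
  rewrite goo ge0_integralD//; last exact: measurable_funeneg.
  rewrite integral_cst// leNgt lte_add_pinfty//.
  by rewrite lte_mul_pinfty.
by rewrite integralE vneg; case: (integral _ _ _) => [r| |] /=; rewrite leNye.
Qed.

(** Only the positive part needs a limit, by monotone convergence; the negative part over [F m] is
    at most that over the union. *)
Lemma integral_exhaustion_le (F : (set 'cV[R]_n)^nat) (v : 'cV[R]_n -> \bar R) (c : R) :
  nondecreasing_seq F -> (forall m, measurable (F m)) ->
  (mu (\bigcup_m F m) < +oo)%E -> measurable_fun (\bigcup_m F m) v ->
  (forall m, \int[mu]_(x in F m) (fun x => v x - c%:E)^\+ x <=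
   \int[mu]_(x in F m) (fun x => v x - c%:E)^\- x)%E ->
  (\int[mu]_(x in \bigcup_m F m) v x <= c%:E * mu (\bigcup_m F m))%E.
Proof.
move=> ndF mF Foo mv Fle; set E := \bigcup_m F m.
have mE : measurable E by exact: bigcupT_measurable.
apply: integral_le_cst => //; set g := (fun x => (v x - c%:E)%E).
have mg : measurable_fun E g.
  by apply: emeasurable_funB => //; exact: measurable_cst.
have FE m : F m `<=` E by exact: bigcup_sup.
have mgF m : measurable_fun (F m) (g^\+)%E.
  by apply: measurable_funepos; exact: measurable_funS (FE m) mg.
have gp m x : F m x -> (0 <= g^\+ x)%E by move=> _; exact: funepos_ge0.
have cv := @ge0_nondecreasing_set_cvg_integral _ _ _ F g^\+%E mu ndF mF mgF gp.
rewrite -(cvg_lim _ cv)//; apply: lime_le.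
  by apply/cvg_ex; eexists; exact: cv.
apply: nearW => m; apply: (le_trans (Fle m)).
apply: ge0_subset_integral => //; exact: measurable_funeneg.
Qed.

End mean_value_exhaustion.

(** * Mean value inequality *)

Section mean_value_core.
Context {R : realType} {n : nat}.
Local Notation mu := (@lebesgue_cV R n).

Lemma cV_shift_continuous (a : 'cV[R]_n) : continuous (fun x : 'cV[R]_n => x + a).
Proof.
move=> x B /nbhs_ballP[e /= e0 eB]; apply/nbhs_ballP; exists e => //= y.
move=> /cV_ballP[_ xy]; apply: eB; apply/cV_ballP; split => // i.
by rewrite !mxE opprD addrACA subrr addr0.
Qed.

Lemma ellipsoidE (Z : 'M[R]_n) y0 eps :
  ellipsoid Z y0 eps = (fun x => x + - y0) @^-1` qball (invmx Z) (eps ^+ 2).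
Proof. by []. Qed.

Lemma ellipsoid_open (Z : 'M[R]_n) y0 eps : open (ellipsoid Z y0 eps).
Proof.
rewrite ellipsoidE; apply: open_comp; last exact: qball_open.
by move=> x _; exact: cV_shift_continuous.
Qed.

Lemma ellipsoid_center (Z : 'M[R]_n) y0 eps : 0 < eps -> ellipsoid Z y0 eps y0.
Proof.
by move=> e0; rewrite /ellipsoid /= subrr /quad_form mulmx0 mxE exprn_gt0.
Qed.

Lemma lebesgue_ellipsoid (Z : 'M[R]_n) y0 eps :
  mu (ellipsoid Z y0 eps) = mu (qball (invmx Z) (eps ^+ 2)).
Proof. by rewrite ellipsoidE lebesgue_cV_shift//; exact: qball_measurable. Qed.

Lemma integral_ellipsoid (Z : 'M[R]_n) y0 eps (u : 'cV[R]_n -> \bar R) :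
  measurable_fun (ellipsoid Z y0 eps) u ->
  measurable_fun (qball (invmx Z) (eps ^+ 2)) (fun x => u (x + y0)) /\
  (\int[mu]_(x in ellipsoid Z y0 eps) u x =
   \int[mu]_(x in qball (invmx Z) (eps ^+ 2)) u (x + y0)%R)%E.
Proof.
move=> mu_.
have mv : measurable_fun (qball (invmx Z) (eps ^+ 2)) (fun x => u (x + y0)).
  apply: (measurable_comp _ _ mu_ (measurable_funTS (measurable_shift y0))).
    by apply: open_measurable_cV; exact: ellipsoid_open.
  by move=> _ [x xq <-]; rewrite ellipsoidE /= addrK.
split=> //.
rewrite -(integral_shift (- y0) (qball_measurable _ _) mv).
by apply: eq_integral => x _; rewrite subrK.
Qed.

Lemma mean_value_le (E : set 'cV[R]_n) u (c : R) :
  (0 < mu E)%E -> (mu E < +oo)%E ->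
  (mean_value E u <= c%:E)%E <-> (\int[mu]_(x in E) u x <= c%:E * mu E)%E.
Proof.
move=> E0 Eoo; have fE : mu E \is a fin_num by rewrite ge0_fin_numE.
rewrite /mean_value -(fineK fE); set r := fine _.
have r0 : 0 < r by rewrite fine_gt0// E0.
rewrite inver gt_eqF//; split => [h|h].
  by rewrite muleC -lee_pdivrMl.
by rewrite lee_pdivrMl// muleC.
Qed.

Variables Z : 'M[R]_n.
Local Notation Y := (invmx Z).
Hypotheses (symZ : Z^T = Z) (unitZ : Z \in unitmx).
Variable Lam : R.
Local Notation q := (quad_form Y).
Hypothesis coercive : forall (x : 'cV[R]_n) i, (x i ord0) ^+ 2 <= Lam * q x.
Hypothesis Lam_gt0 : 0 < Lam.
Hypothesis n_gt0 : (0 < n)%N.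

Lemma ellipsoid_gt0 y0 eps : 0 < eps -> (0 < mu (ellipsoid Z y0 eps))%E.
Proof.
move=> e0; apply: open_lebesgue_cV_gt0; first exact: ellipsoid_open.
by exists y0; exact: ellipsoid_center.
Qed.

Lemma ellipsoid_lty y0 eps : (mu (ellipsoid Z y0 eps) < +oo)%E.
Proof. by rewrite lebesgue_ellipsoid (qball_lty coercive Lam_gt0). Qed.

Variables (Omega : set 'cV[R]_n) (u : 'cV[R]_n -> \bar R).
Hypotheses (oO : open Omega) (lscu : lsc_on Omega u).
Hypothesis uNy : forall x, Omega x -> (-oo < u x)%E.

Lemma lsc_lower_bound (C : set 'cV[R]_n) : C !=set0 -> compact C -> C `<=` Omega ->
  exists b : R, forall x, C x -> (b%:E < u x)%E.
Proof.
move=> C0 cC CO; have [|x0 Cx0 xmin] := @compact_lsc_min _ _ C u C0 cC.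
  move=> x a Cx ax; have := lsc_on_near oO lscu (CO _ Cx) ax.
  by apply: filterS => y.
have [b /andP[_ bx]] := ereal_between (uNy (CO _ Cx0)).
by exists b => x Cx; exact: lt_le_trans (xmin _ Cx).
Qed.

Hypothesis visc : forall x0 U phi, Omega x0 -> open U -> U x0 -> C2_on U phi ->
  (phi x0)%:E = u x0 -> (\forall x \near x0, ((phi x)%:E <= u x)%E) ->
  mx_inner Z (hessian phi x0) <= 0.

(** Each closed ellipsoid [q <= s m] with [s m < eps^2] is a compact subset of [Omega] after
    translation. There [u] has a finite lower bound and the inequality for polynomials applies. *)
Lemma superharmonic_mean_value y0 eps : 0 < eps -> Omega y0 ->
  ellipsoid Z y0 eps `<=` Omega -> (mean_value (ellipsoid Z y0 eps) u <= u y0)%E.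
Proof.
move=> e0 Oy0 EO.
have symY : Y^T = Y by rewrite trmx_inv symZ.
have ZY : Z *m Y = 1%:M by rewrite mulmxV.
have [uy|uy] := eqVneq (u y0) +oo%E; first by rewrite uy leey.
have ufin : u y0 \is a fin_num by rewrite fin_numElt uNy//= ltey.
rewrite -(fineK ufin); set c := fine (u y0).
apply/mean_value_le; [exact: ellipsoid_gt0|exact: ellipsoid_lty|].
have mE : measurable (ellipsoid Z y0 eps).
  by apply: open_measurable_cV; exact: ellipsoid_open.
have mu_ := lsc_on_measurable oO lscu EO mE.
have [mv ->] := integral_ellipsoid mu_.
rewrite lebesgue_ellipsoid.
set v := fun x => u (x + y0).
have e20 : 0 < eps ^+ 2 by rewrite exprn_gt0.
(* The shift by 2 keeps [s 0] positive. *)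
pose s (m : nat) : R := eps ^+ 2 * (1 - m.+2%:R^-1).
have s_gt0 m : 0 < s m.
  by rewrite mulr_gt0// subr_gt0 invf_lt1// ltr1n.
have s_lt m : s m < eps ^+ 2 by rewrite gtr_pMr// gtrBl invr_gt0.
pose F m := qball Y (s m).
have FU : \bigcup_m F m = qball Y (eps ^+ 2).
  apply/seteqP; split=> [x [m _]|x xs].
    by move=> /lt_trans; apply.
  have d0 : 0 < 1 - q x / eps ^+ 2 by rewrite subr_gt0 ltr_pdivrMr// mul1r.
  have [m _ mP] := near_infty_natSinv_lt (PosNum d0).
  exists m => //; have /= h := mP m.+1 (leqnSn m).
  by rewrite /F /qball /s /= mulrC -ltr_pdivrMr// ltrBrDr addrC -ltrBrDr.
rewrite -FU; apply: integral_exhaustion_le.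
- apply/nondecreasing_seqP => m; apply/subsetPset => x.
  rewrite /F /qball /= => /lt_le_trans; apply.
  by rewrite /s ler_pM2l// lerD2l lerN2 lef_pV2 ?posrE ?ltr0n// ler_nat.
- by move=> m; exact: qball_measurable.
- by rewrite FU; exact: (qball_lty coercive Lam_gt0).
- by rewrite FU.
move=> m; set C := [set x : 'cV[R]_n | q x <= s m].
have C0 : C 0 by rewrite /C /= quad_form0 ltW.
have CE x : C x -> ellipsoid Z y0 eps (x + y0).
  by move=> Cx; rewrite ellipsoidE /= addrK; exact: le_lt_trans Cx (s_lt m).
have CO x : C x -> Omega (x + y0) by move=> /CE /EO.
pose Cy := [set x : 'cV[R]_n | q (x - y0) <= s m].
have CyO : Cy `<=` Omega by move=> x Cx; have := CO (x - y0) Cx; rewrite subrK.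
have cCy : compact Cy by exact: (cqball_compact coercive Lam_gt0).
have [|b bu] := lsc_lower_bound _ cCy CyO.
  by exists y0; rewrite /Cy /= subrr.
have bv x : C x -> (b%:E < v x)%E.
  by move=> Cx; apply: bu; rewrite /Cy /= addrK.
have lscv x a : C x -> (a%:E < v x)%E -> \forall y \near x, (a%:E < v y)%E.
  move=> Cx ax; have := lsc_on_near oO lscu (CO _ Cx) ax.
  exact: cV_shift_continuous.
apply: (@lsc_funepos_le _ _ (qball Y (s m)) C (Lam * s m + 1) v c).
- exact: qball_measurable.
- exact: (qball_bounded coercive Lam_gt0).
- by move=> x /ltW.
- exact: lscv.
- apply: measurable_funS mv; first exact: qball_measurable.
  by move=> x /lt_trans; apply.
- move=> p pp pv.
  apply: (polyf_mean_le symZ symY ZY coercive Lam_gt0 n_gt0 oO lscu uNy visc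
    (s_gt0 m) pp CyO) => [x xC|]; last by rewrite fineK.
  by have := pv (x - y0) xC; rewrite /v subrK.
- by move=> x Cx i; exact: (le_quad_form_bound coercive Lam_gt0 Cx).
- exact: bv.
Qed.

End mean_value_core.

(** * Eigenvalue bounds for the matrices of [K] *)

Section convex_body_bounds.
Context {R : realType} {n : nat}.
Implicit Types (Z A X : 'M[R]_n) (x xi : 'cV[R]_n).

Definition sqnorm x : R := \sum_i (x i ord0) ^+ 2.

Lemma sqnorm_ge0 x : 0 <= sqnorm x.
Proof. by apply: sumr_ge0 => i _; rewrite sqr_ge0. Qed.

Lemma sqr_coor_le_sqnorm x i : (x i ord0) ^+ 2 <= sqnorm x.
Proof.
rewrite /sqnorm (bigD1 i)//= lerDl; apply: sumr_ge0 => j _; exact: sqr_ge0.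
Qed.

Lemma mulmx_dot x : (x^T *m x) ord0 ord0 = sqnorm x.
Proof. by rewrite mxE; apply: eq_bigr => i _; rewrite mxE expr2. Qed.

Variables (F : 'M[R]_n -> R) (K : set 'M[R]_n).
Hypotheses (hF : sublinear F) (hFe : uniformly_elliptic F)
  (hK : associated_convex_body F K).

(** Ellipticity is tested on the rank-one matrix [A = xi xi^T], whose trace is the squared norm of
    [xi] and whose inner product with [Z] is [quad_form Z xi]. Increments from [-A] to 0 and from 0
    to [A] bound [F (- A)] and [F A], and [F] dominates the inner product with [Z] at both. *)
Lemma convex_body_bounds : exists lam Lam : R, [/\ 0 < lam, 0 < Lam &
  forall Z, K Z -> forall xi, lam * sqnorm xi <= quad_form Z xi <= Lam * sqnorm xi].
Proof.
have [lam [Lam [/andP[lam0 lamLam] ell]]] := hFe.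
exists lam, Lam; split => //; first exact: lt_le_trans lamLam.
move=> Z KZ xi.
have [_ _ _ KS supp] := hK.
pose A := xi *m xi^T.
have symA : Sym A by rewrite /Sym /= /A trmx_mul trmxK.
have symNA : Sym (- A) by rewrite /Sym /= linearN /= symA.
have sym0 : Sym (0 : 'M[R]_n) by rewrite /Sym /= trmx0.
have A0 : mx_le 0 A.
  move=> x; rewrite /quad_form mulmx0 mul0mx mxE /A !mulmxA.
  rewrite -mulmxA -[xi^T *m x]trmxK trmx_mul trmxK.
  set a := x^T *m xi; rewrite mxE big_ord1 [a^T _ _]mxE -expr2; exact: sqr_ge0.
have trA : \tr A = sqnorm xi.
  by rewrite /A mxtrace_mulC /mxtrace big_ord1 mulmx_dot.
have inA : mx_inner Z A = quad_form Z xi.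
  by rewrite /mx_inner /A mulmxA mxtrace_mulC mulmxA /mxtrace big_ord1.
have F0 : F 0 = 0.
  by have := hF.2 0 0 (lexx 0) sym0; rewrite scaler0 mul0r.
have [_ s1] := supp A symA; have [_ s2] := supp (- A) symNA.
have /andP[e1 _] := ell (- A) A symNA symA A0.
have /andP[_ e2] := ell 0 A sym0 symA A0.
have := s1 Z KZ; have := s2 Z KZ.
have -> : mx_inner Z (- A) = - mx_inner Z A.
  by rewrite /mx_inner mulmxN linearN.
move: e1 e2; rewrite addNr add0r F0 trA inA => *.
by apply/andP; split; lra.
Qed.

End convex_body_bounds.

Section positive_definite.
Context {R : realType} {n : nat}.
Variables (Z : 'M[R]_n) (lam Lam : R).
Hypotheses (symZ : Z^T = Z) (lam_gt0 : 0 < lam) (Lam_gt0 : 0 < Lam).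
Hypothesis boundZ : forall xi : 'cV[R]_n,
  lam * sqnorm xi <= quad_form Z xi <= Lam * sqnorm xi.

Lemma posdef_unitmx : Z \in unitmx.
Proof.
rewrite -row_free_unit -kermx_eq0; apply/rowV0P => w /sub_kermxP wZ.
have /andP[] := boundZ w^T.
rewrite {1}/quad_form trmxK wZ mul0mx mxE pmulr_rle0// => w0 _.
apply/rowP => i; rewrite mxE; have := sqr_coor_le_sqnorm w^T i.
rewrite mxE => h; apply/eqP; rewrite -sqrf_eq0 eq_le sqr_ge0 andbT.
exact: le_trans h w0.
Qed.

(** Expanding [quad_form Z] at [Z^-1 x - x / Lam], where it is nonnegative, and bounding
    [quad_form Z x] by [Lam |x|^2] gives the estimate without diagonalization. *)
Lemma quad_form_invmx_ge (x : 'cV[R]_n) : sqnorm x <= Lam * quad_form (invmx Z) x.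
Proof.
have uZ := posdef_unitmx.
pose xi := invmx Z *m x.
have xE : Z *m xi = x by rewrite /xi mulmxA mulmxV// mul1mx.
have xiT : xi^T *m Z = x^T by have := congr1 trmx xE; rewrite trmx_mul symZ.
pose t := Lam^-1.
have t0 : 0 < t by rewrite invr_gt0.
have /andP[h1 _] := boundZ (xi - t *: x); have /andP[_ h2] := boundZ x.
have {h1} h1 : 0 <= quad_form Z (xi - t *: x).
  by apply: le_trans h1; rewrite mulr_ge0 ?sqnorm_ge0// ltW.
have subE (A B : 'M[R]_1) : (A - B) ord0 ord0 = A ord0 ord0 - B ord0 ord0.
  by rewrite !mxE.
have scaleE (a : R) (B : 'M[R]_1) : (a *: B) ord0 ord0 = a * B ord0 ord0.
  by rewrite !mxE.
have qE : quad_form (invmx Z) x = (x^T *m xi) ord0 ord0.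
  by rewrite /quad_form -mulmxA.
have E : quad_form Z (xi - t *: x) =
   quad_form (invmx Z) x - 2 * t * sqnorm x + t ^+ 2 * quad_form Z x.
  rewrite qE /quad_form.
  have -> : (xi - t *: x)^T *m Z = x^T - t *: (x^T *m Z).
    by rewrite linearB /= linearZ /= mulmxBl xiT -scalemxAl.
  rewrite mulmxBl subE !mulmxBr !subE -!scalemxAr -!scalemxAl !scaleE.
  rewrite -[x^T *m Z *m xi]mulmxA xE mulmx_dot.
  rewrite -/(quad_form Z x); ring.
rewrite {}E in h1.
have h3 : t ^+ 2 * quad_form Z x <= t * sqnorm x.
  have -> : t * sqnorm x = t ^+ 2 * (Lam * sqnorm x).
    by rewrite /t; field; rewrite gt_eqF.
  by rewrite ler_wpM2l// sqr_ge0.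
have h4 : t * sqnorm x <= quad_form (invmx Z) x by lra.
by rewrite -ler_pdivrMl// mulrC mulrC.
Qed.

Lemma quad_form_invmx_coercive (x : 'cV[R]_n) i :
  (x i ord0) ^+ 2 <= Lam * quad_form (invmx Z) x.
Proof. exact: le_trans (sqr_coor_le_sqnorm x i) (quad_form_invmx_ge x). Qed.

End positive_definite.

(** * Functions of class C2 *)

Section C2_functions.
Context {R : realType} {n : nat}.
Implicit Types (f phi : 'cV[R]_n -> R) (x y h v : 'cV[R]_n) (i j : 'I_n).
Implicit Types U : set 'cV[R]_n.
Local Notation e i := (delta_mx i ord0 : 'cV[R]_n).

Lemma is_derive_line f x v (s : R) : derivable f (x + s *: v) v ->
  is_derive s (1 : R) (fun t : R => f (x + t *: v)) ('D_v f (x + s *: v)).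
Proof.
move=> df.
have E : (fun t : R => t^-1 *: (((fun t : R => f (x + t *: v)) \o shift s) (t *: (1 : R)) -
     f (x + s *: v))) =
  (fun t : R => t^-1 *: ((f \o shift (x + s *: v)) (t *: v) - f (x + s *: v))).
  apply/funext => t; rewrite /= /shift /=; congr (_ *: (f _ - _)).
  by rewrite [t *: (1 : R)]mulr1 scalerDl addrCA.
split; first by rewrite /derivable E.
by rewrite /derive E.
Qed.

Lemma MVT_line f x v (t : R) :
  (forall s : R, `|s| <= `|t| -> derivable f (x + s *: v) v) ->
  exists2 s : R, `|s| <= `|t| & f (x + t *: v) - f x = t * 'D_v f (x + s *: v).
Proof.
move=> df.
have der (s : R) : `|s| <= `|t| ->
    is_derive s (1 : R) (fun t : R => f (x + t *: v)) ('D_v f (x + s *: v)).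
  by move=> st; apply: is_derive_line; exact: df.
have cont (s : R) : `|s| <= `|t| ->
    {for s, continuous (fun t : R => f (x + t *: v))}.
  move=> st; have [d _] := der _ st.
  exact/differentiable_continuous/derivable1_diffP.
have x0 : f x = f (x + 0 *: v) by rewrite scale0r addr0.
have [t0|t0] := leP 0 t.
  have [s||] := @MVT_segment R (fun t : R => f (x + t *: v))
     (fun s => 'D_v f (x + s *: v)) 0 t t0.
  - rewrite in_itv /= => /andP[s0 s1]; apply: der.
    by rewrite !ger0_norm// ltW.
  - apply: continuous_in_subspaceT => s; rewrite inE /= in_itv /= => /andP[s0 s1].
    by apply: cont; rewrite !ger0_norm.
  move=> s; rewrite in_itv /= => /andP[s0 s1] E.
  exists s; first by rewrite !ger0_norm.
  by rewrite x0 E subr0 mulrC.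
have [s||] := @MVT_segment R (fun t : R => f (x + t *: v))
     (fun s => 'D_v f (x + s *: v)) t 0 (ltW t0).
- rewrite in_itv /= => /andP[s0 s1]; apply: der.
  by rewrite !ler0_norm ?lerN2// ltW.
- apply: continuous_in_subspaceT => s; rewrite inE /= in_itv /= => /andP[s0 s1].
  by apply: cont; rewrite !ler0_norm ?lerN2// ltW.
move=> s; rewrite in_itv /= => /andP[s0 s1] E.
exists s; first by rewrite !ler0_norm ?lerN2// ltW.
rewrite x0 -opprB E; ring.
Qed.

(** The increment from [x] to [x + h] is split along the coordinate axes and the mean value theorem
    is applied on each segment, which uses derivatives in coordinate directions only. *)
Lemma increment_le f x (r ep : R) :
  (forall y, (forall i, `|y i ord0 - x i ord0| < r) -> forall i,
     derivable f y (e i) /\ `|partial i f y - partial i f x| <= ep) ->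
  forall h, (forall i, `|h i ord0| < r) ->
  `|f (x + h) - f x - \sum_i h i ord0 * partial i f x| <= ep * \sum_i `|h i ord0|.
Proof.
move=> D h hr.
(* [h] with all but its first [m] coordinates set to 0. *)
pose hm (m : nat) : 'cV[R]_n := \col_i (if (i < m)%N then h i ord0 else 0).
suff claim m : (m <= n)%N -> `|f (x + hm m) - f x -
    \sum_i hm m i ord0 * partial i f x| <= ep * \sum_i `|hm m i ord0|.
  have hn : hm n = h by apply/colP => i; rewrite mxE ltn_ord.
  by have := claim n (leqnn n); rewrite hn.
elim: m => [_|m IHm mn].
  have h0 : hm 0%N = 0 by apply/colP => i; rewrite !mxE ltn0.
  rewrite h0 addr0 subrr big1 => [|i _]; last by rewrite mxE mul0r.
  by rewrite subrr normr0 big1 ?mulr0// => i _; rewrite mxE normr0.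
pose i0 := Ordinal mn.
have hmS i : hm m.+1 i ord0 = hm m i ord0 + (i == i0)%:R * h i0 ord0.
  rewrite !mxE ltnS leq_eqVlt -[i == i0]val_eqE /=.
  case: eqVneq => [im|_] /=; last by rewrite mul0r addr0.
  rewrite im ltnn add0r mul1r; congr (h _ _); exact: val_inj.
have hm0 : hm m i0 ord0 = 0 by rewrite mxE /= ltnn.
have hmE : hm m.+1 = hm m + h i0 ord0 *: e i0.
  by apply/colP => i; rewrite hmS !mxE eqxx andbT [_%:R * _]mulrC.
have hmr i : `|hm m i ord0| <= `|h i ord0|.
  by rewrite mxE; case: ifP => //; rewrite normr0.
have inball (s : R) : `|s| <= `|h i0 ord0| -> forall i,
    `|(x + hm m + s *: e i0) i ord0 - x i ord0| < r.
  move=> sh i; have -> : (x + hm m + s *: e i0) i ord0 - x i ord0 =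
      hm m i ord0 + s * (i == i0)%:R.
    have mxD (A B : 'cV[R]_n) k : (A + B) k ord0 = A k ord0 + B k ord0 by rewrite mxE.
    have mxZ a (A : 'cV[R]_n) k : (a *: A) k ord0 = a * A k ord0 by rewrite mxE.
    have mxe k : (e i0) k ord0 = (k == i0)%:R by rewrite mxE eqxx andbT.
    by rewrite !mxD mxZ mxe; ring.
  have [->|ii0] := eqVneq i i0.
    by rewrite hm0 mulr1 add0r; exact: le_lt_trans sh (hr i0).
  by rewrite mulr0 addr0; exact: le_lt_trans (hmr i) (hr i).
have [s sh sE] := @MVT_line f (x + hm m) (e i0) (h i0 ord0)
  (fun s sh => (D _ (inball s sh) i0).1).
have [_ dE] := D _ (inball s sh) i0.
have S1 : \sum_i hm m.+1 i ord0 * partial i f x =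
    \sum_i hm m i ord0 * partial i f x + h i0 ord0 * partial i0 f x.
  rewrite (bigD1 i0)//= [in RHS](bigD1 i0)//= hmS hm0 mul0r !add0r eqxx mul1r addrC.
  congr (_ + _); apply: eq_bigr => i ii0.
  by rewrite hmS (negbTE ii0) mul0r addr0.
have S2 : \sum_i `|hm m.+1 i ord0| = \sum_i `|hm m i ord0| + `|h i0 ord0|.
  rewrite (bigD1 i0)//= [in RHS](bigD1 i0)//= hmS hm0 normr0 !add0r eqxx mul1r addrC.
  congr (_ + _); apply: eq_bigr => i ii0.
  by rewrite hmS (negbTE ii0) mul0r addr0.
rewrite S1 S2 hmE addrA mulrDr.
set a := f (x + hm m + _) in sE *; set b := f (x + hm m) in sE IHm *.
have -> : a - f x - (\sum_i hm m i ord0 * partial i f x + h i0 ord0 * partial i0 f x) =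
   (b - f x - \sum_i hm m i ord0 * partial i f x) +
   h i0 ord0 * (partial i0 f (x + hm m + s *: e i0) - partial i0 f x).
  have -> : a = b + h i0 ord0 * partial i0 f (x + hm m + s *: e i0).
    by rewrite -[LHS](subrK b) sE addrC.
  move: (partial i0 f _) (partial i0 f x) (\sum_i _) => *; ring.
rewrite (le_trans (ler_normD _ _))// lerD//; first exact: IHm (ltnW mn).
by rewrite normrM mulrC ler_wpM2r.
Qed.

Lemma C1_near U f x (ep : R) : open U -> C1_on U f -> U x -> 0 < ep ->
  exists2 r : R, 0 < r & forall y, (forall i, `|y i ord0 - x i ord0| < r) ->
    U y /\ forall i, `|partial i f y - partial i f x| <= ep.
Proof.
move=> oU C1 Ux ep0.
have nU : \forall y \near x, U y by apply: open_nbhs_nbhs.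
have nd : \forall y \near x, forall i, `|partial i f y - partial i f x| <= ep.
  have h i : \forall y \near x, `|partial i f y - partial i f x| <= ep.
    have [_ c] := C1 i x Ux.
    by have /cvgrPdist_le /(_ _ ep0) := c; apply: filterS => y; rewrite distrC.
  exact: (@filter_forall _ _ (fun i y => `|partial i f y - partial i f x| <= ep)
    (nbhs x) _ h).
have [r /= r0 rP] := (nbhs_ballP _ _).1 (filterI nU nd).
exists r => // y yr; have [] : U y /\ forall i, `|partial i f y - partial i f x| <= ep.
  by apply: rP; apply/cV_ballP; split => // i; rewrite distrC.
by split.
Qed.

Lemma is_derive_C1 U f x v : open U -> C1_on U f -> U x ->
  is_derive x v f (\sum_i v i ord0 * partial i f x).
Proof.
move=> oU C1 Ux; set L := \sum_i _; set N := \sum_i `|v i ord0|.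
have N0 : 0 <= N by apply: sumr_ge0.
have vN i : `|v i ord0| <= N.
  by rewrite /N (bigD1 i)//= lerDl; exact: sumr_ge0.
have lim : (fun t : R => t^-1 *: ((f \o shift x) (t *: v) - f x)) @ 0^' --> L.
  apply/cvgrPdist_le => ep ep0.
  have N1 : 0 < N + 1 by rewrite ltr_wpDl.
  have [r r0 rP] := C1_near oU C1 Ux (divr_gt0 ep0 N1).
  have rN : 0 < r / (N + 1) by rewrite divr_gt0.
  near=> t.
  have t0 : t != 0 by near: t; exact: nbhs_dnbhs_neq.
  have tr : `|t| < r / (N + 1).
    near: t; exact: dnbhs0_lt.
  have tv i : `|(t *: v) i ord0| < r.
    rewrite mxE normrM; apply: (@le_lt_trans _ _ (`|t| * (N + 1))).
      by rewrite ler_wpM2l// (le_trans (vN i))// lerDl.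
    by rewrite -ltr_pdivlMr.
  have D y : (forall i, `|y i ord0 - x i ord0| < r) -> forall i,
     derivable f y (e i) /\ `|partial i f y - partial i f x| <= ep / (N + 1).
    move=> yr i; have [Uy dy] := rP y yr.
    by split; [exact: (C1 i y Uy).1|exact: dy].
  have := increment_le D tv.
  have -> : \sum_i (t *: v) i ord0 * partial i f x = t * L.
    by rewrite mulr_sumr; apply: eq_bigr => i _; rewrite mxE mulrA.
  have -> : \sum_i `|(t *: v) i ord0| = `|t| * N.
    by rewrite mulr_sumr; apply: eq_bigr => i _; rewrite mxE normrM.
  rewrite /= /shift [t *: v + x]addrC => h.
  have -> : L - t^-1 *: (f (x + t *: v) - f x) = - (t^-1 * (f (x + t *: v) - f x - t * L)).
    by rewrite /GRing.scale /=; field.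
  rewrite normrN normrM normfV ler_pdivrMl ?normr_gt0// (le_trans h)//.
  rewrite mulrCA ler_wpM2l// mulrAC ler_pdivrMr// ler_wpM2l ?lerDl// ltW//.
split; first by apply/cvg_ex; exists L.
exact: cvg_lim lim.
Unshelve. all: by end_near. Qed.

(** The second difference [Delta] is symmetric in the two directions. Two applications of the mean
    value theorem make it [s^2] times a mixed derivative at a point near [x], in either order. *)
Lemma schwarz U f x i j : open U -> C2_on U f -> U x ->
  partial i (partial j f) x = partial j (partial i f) x.
Proof.
move=> oU C2 Ux.
pose Delta (a b : 'I_n) (s : R) :=
  f (x + s *: e a + s *: e b) - f (x + s *: e a) - (f (x + s *: e b) - f x).
have DeltaC s : Delta i j s = Delta j i s.
  by rewrite /Delta -!addrA [s *: e i + _]addrC; ring.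
have key (a b : 'I_n) (ep : R) : 0 < ep -> exists2 r : R, 0 < r &
   forall s : R, 0 < s -> s < r ->
   `|Delta a b s - s ^+ 2 * partial b (partial a f) x| <= s ^+ 2 * ep.
  move=> ep0; have [r r0 rP] := C1_near oU (C2.2 a) Ux ep0.
  have r20 : 0 < r / 2 by rewrite divr_gt0.
  exists (r / 2) => // s s0 sr.
  have inball (sg t : R) : `|sg| <= `|s| -> `|t| <= `|s| -> forall k,
      `|(x + sg *: e a + t *: e b) k ord0 - x k ord0| < r.
    move=> sg1 t1 k.
    have mxD (A B : 'cV[R]_n) l : (A + B) l ord0 = A l ord0 + B l ord0 by rewrite mxE.
    have mxZ c (A : 'cV[R]_n) l : (c *: A) l ord0 = c * A l ord0 by rewrite mxE.
    have mxe c l : (e c) l ord0 = (l == c)%:R by rewrite mxE eqxx andbT.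
    rewrite !mxD !mxZ !mxe.
    have -> : x k ord0 + sg * (k == a)%:R + t * (k == b)%:R - x k ord0 =
      sg * (k == a)%:R + t * (k == b)%:R by ring.
    have le1 (c : R) (z : bool) : `|c| <= `|s| -> `|c * z%:R| <= s.
      move=> cs; rewrite normrM -[leRHS](gtr0_norm s0) (le_trans _ cs)//.
      by case: z; rewrite ?normr1 ?mulr1// normr0 mulr0.
    rewrite (le_lt_trans (ler_normD _ _))//.
    have := le1 _ (k == a) sg1; have := le1 _ (k == b) t1; lra.
  have s1 : `|s| <= `|s| by [].
  have z1 : `|0 : R| <= `|s| by rewrite normr0.
  have inU (sg t : R) : `|sg| <= `|s| -> `|t| <= `|s| -> U (x + sg *: e a + t *: e b).
    by move=> h1 h2; have [] := rP _ (inball _ _ h1 h2).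
  pose g y := f (y + s *: e b) - f y.
  have dsh y : derivable f (y + s *: e b) (e a) ->
     derivable (fun y => f (y + s *: e b)) y (e a) /\
     'D_(e a) (fun y => f (y + s *: e b)) y = 'D_(e a) f (y + s *: e b).
    have E : (fun t : R => t^-1 *: (((fun y => f (y + s *: e b)) \o shift y) (t *: e a) -
        f (y + s *: e b))) =
       (fun t : R => t^-1 *: ((f \o shift (y + s *: e b)) (t *: e a) - f (y + s *: e b))).
      by apply/funext => t; rewrite /= /shift /= addrA.
    by move=> df; split; [rewrite /derivable E|rewrite /derive E].
  have Ua (sg : R) : `|sg| <= `|s| -> U (x + sg *: e a).
    by move=> h; have := inU _ _ h z1; rewrite scale0r addr0.
  have dg (sg : R) : `|sg| <= `|s| -> derivable g (x + sg *: e a) (e a).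
    move=> h; apply: derivableB.
      by have [] := dsh _ (C2.1 a _ (inU _ _ h s1)).1.
    exact: (C2.1 a _ (Ua _ h)).1.
  have [sg h1 E1] := MVT_line dg.
  have D1 : 'D_(e a) g (x + sg *: e a) =
     partial a f (x + sg *: e a + s *: e b) - partial a f (x + sg *: e a).
    have [d1 d2] := dsh _ (C2.1 a _ (inU _ _ h1 s1)).1.
    rewrite !partialE -d2.
    exact: (deriveB d1 (C2.1 a _ (Ua _ h1)).1).
  have [tau h2 E2] := @MVT_line (partial a f) (x + sg *: e a) (e b) s
    (fun t ht => (C2.2 a b _ (inU _ _ h1 ht)).1).
  have -> : Delta a b s = s ^+ 2 * partial b (partial a f) (x + sg *: e a + tau *: e b).
    rewrite [LHS]E1 D1 E2 -partialE expr2 mulrA; done.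
  rewrite -mulrBr normrM ger0_norm ?sqr_ge0// ler_wpM2l ?sqr_ge0//.
  by have [_] := rP _ (inball _ _ h1 h2); exact.
apply/eqP; rewrite -subr_eq0; apply/negPn/negP => d0.
set d := _ - _ in d0.
(* Two errors of [|d| / 4] would give [|d| <= |d| / 2]. *)
have nd : 0 < `|d| / 4 by rewrite divr_gt0// normr_gt0.
have [r1 r10 h1] := key i j _ nd; have [r2 r20 h2] := key j i _ nd.
pose s := Num.min r1 r2 / 2.
have m0 : 0 < Num.min r1 r2 by rewrite lt_min r10.
have s0 : 0 < s by rewrite divr_gt0.
have sm : s < Num.min r1 r2 by rewrite /s; lra.
have := h1 s s0 (lt_le_trans sm _); rewrite ge_min lexx => /(_ isT) k1.
have := h2 s s0 (lt_le_trans sm _); rewrite ge_min lexx orbT => /(_ isT).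
rewrite -DeltaC => k2.
have s2 : 0 < s ^+ 2 by rewrite exprn_gt0.
have : s ^+ 2 * `|d| <= s ^+ 2 * (`|d| / 4) + s ^+ 2 * (`|d| / 4).
  rewrite -[X in X * `|d|](gtr0_norm s2) -normrM.
  have -> : s ^+ 2 * d = (Delta i j s - s ^+ 2 * partial j (partial i f) x) -
      (Delta i j s - s ^+ 2 * partial i (partial j f) x).
    rewrite /d; move: (Delta i j s) (partial i (partial j f) x).
    by move: (partial j (partial i f) x) => *; ring.
  apply: (le_trans (ler_normB _ _)); exact: (lerD k1 k2).
move: nd; clear -s2; move: (`|d|) (s ^+ 2) s2 => D S S0 D0.
rewrite -mulrDr ler_pM2l//; lra.
Qed.

(** After subtracting the quadratic part, the second derivative is [g2 - Q >= 0]; two mean value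
    steps show that the difference increases. *)
Lemma taylor2_lower (g g1 g2 : R -> R) (Q : R) :
  (forall t : R, 0 <= t <= 1 -> is_derive t (1 : R) g (g1 t)) ->
  (forall t : R, 0 <= t <= 1 -> is_derive t (1 : R) g1 (g2 t)) ->
  (forall t : R, 0 <= t <= 1 -> Q <= g2 t) -> g 0 + g1 0 + Q / 2 <= g 1.
Proof.
move=> dg dg1 g2Q.
have cont (k : R -> R) (l : R -> R) (a b : R) : 0 <= a -> b <= 1 ->
   (forall t : R, 0 <= t <= 1 -> is_derive t (1 : R) k (l t)) ->
   {within `[a, b], continuous k}.
  move=> a0 b1 dk; apply: continuous_in_subspaceT => t.
  rewrite inE /= in_itv /= => /andP[ta tb].
  have t01 : 0 <= t <= 1 by rewrite (le_trans a0 ta) (le_trans tb b1).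
  by have [d _] := dk t t01; exact/differentiable_continuous/derivable1_diffP.
pose G1 (t : R) := g1 t - g1 0 - t * Q.
pose G (t : R) := g t - t * g1 0 - t ^+ 2 * (Q / 2).
have dG (t : R) : 0 <= t <= 1 -> is_derive t (1 : R) G (G1 t).
  move=> t01; have := dg t t01 => ?.
  by rewrite /G /G1; apply: is_derive_eq; rewrite /GRing.scale /=; field.
have dG1 (t : R) : 0 <= t <= 1 -> is_derive t (1 : R) G1 (g2 t - Q).
  move=> t01; have := dg1 t t01 => ?.
  by rewrite /G1; apply: is_derive_eq; rewrite /GRing.scale /=; ring.
have [t|t|t t01 E] := @MVT_segment R G G1 0 1 ler01.
- by rewrite in_itv /= => /andP[t0 t1]; apply: dG; rewrite !ltW.
- exact: (cont G G1 0 1).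
move: t01; rewrite in_itv /= => /andP[t0 t1].
have [t'|t'|t' t01' E'] := @MVT_segment R G1 (fun t => g2 t - Q) 0 t t0.
- rewrite in_itv /= => /andP[t'0 t'1]; apply: dG1.
  by rewrite (ltW t'0) (le_trans (ltW t'1)).
- exact: (cont G1 (fun t => g2 t - Q) 0 t).
move: t01'; rewrite in_itv /= => /andP[t'0 t'1].
have Q' : Q <= g2 t' by apply: g2Q; rewrite t'0 (le_trans t'1).
have G10 : G1 0 = 0 by rewrite /G1 subrr mul0r subr0.
have h : 0 <= G1 t.
  have <- : G1 t - G1 0 = G1 t by rewrite G10 subr0.
  by rewrite E' subr0 mulr_ge0// subr_ge0.
rewrite subr0 mulr1 in E.
have : 0 <= G 1 - G 0 by rewrite E.
by rewrite /G !mul0r expr0n expr1n /= !mul0r !mul1r; lra.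
Qed.

Lemma is_derive_fsum (I : finType) (F : I -> R -> R) (L : I -> R) (t : R) :
  (forall a, is_derive t (1 : R) (F a) (L a)) ->
  is_derive t (1 : R) (fun s => \sum_a F a s) (\sum_a L a).
Proof.
move=> dF; rewrite /index_enum; elim: (Finite.enum _) => [|a s IHs].
  under eq_fun do rewrite big_nil.
  by rewrite big_nil; exact: is_derive_cst.
under eq_fun do rewrite big_cons.
by rewrite big_cons; exact: is_deriveD.
Qed.

Lemma quad_formE (X : 'M[R]_n) h :
  quad_form X h = \sum_i \sum_j h i ord0 * (h j ord0 * X j i).
Proof.
rewrite /quad_form mxE; apply: eq_bigr => i _; rewrite mxE mulr_suml.
by apply: eq_bigr => j _; rewrite mxE mulrC.
Qed.

(** The error of the second-order expansion is expressed in [quad_form Y], the form that defines the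
    ellipsoids, so that its integral there can be compared with that of the Hessian term. *)
Lemma C2_taylor_lower U phi x0 (Y : 'M[R]_n) (Lam del : R) : open U ->
  C2_on U phi -> U x0 -> 0 < Lam -> (forall h, 0 <= quad_form Y h) ->
  (forall h i, (h i ord0) ^+ 2 <= Lam * quad_form Y h) -> 0 < del ->
  exists2 r : R, 0 < r & forall h, (forall i, `|h i ord0| < r) ->
    phi x0 + \sum_i h i ord0 * partial i phi x0 +
      (quad_form (hessian phi x0) h - del * quad_form Y h) / 2 <= phi (x0 + h).
Proof.
move=> oU C2 Ux Lam0 q0 co del0.
(* Each of the [n^2] entries of the Hessian varies by at most [eta] and [|h_i h_j| <= Lam q h], so
   the total error is at most [del q h]. *)
pose eta := del / (n%:R * n%:R * Lam + 1).
have N0 : 0 <= n%:R * n%:R * Lam :> R by rewrite !mulr_ge0// ltW.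
have N1 : 0 < n%:R * n%:R * Lam + 1 by rewrite ltr_wpDl.
have eta0 : 0 < eta by rewrite divr_gt0.
have near i : \forall y \near x0, U y /\
    forall j, `|partial j (partial i phi) y - partial j (partial i phi) x0| <= eta.
  have [r r0 rP] := C1_near oU (C2.2 i) Ux eta0.
  apply/nbhs_ballP; exists r => //= y /cV_ballP[_ xy].
  by apply: rP => k; rewrite distrC.
have nU : \forall y \near x0, U y by apply: open_nbhs_nbhs.
have near2 : \forall y \near x0, forall i, U y /\
    forall j, `|partial j (partial i phi) y - partial j (partial i phi) x0| <= eta.
  exact: (@filter_forall _ _ (fun i y => U y /\
    forall j, `|partial j (partial i phi) y - partial j (partial i phi) x0| <= eta)
    (nbhs x0) _ near).
have [r /= r0 rP] := (nbhs_ballP _ _).1 (filterI nU near2).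
exists r => // h hr.
have inU (t : R) : 0 <= t <= 1 -> U (x0 + t *: h) /\ forall i j,
    `|partial j (partial i phi) (x0 + t *: h) - partial j (partial i phi) x0| <= eta.
  move=> /andP[t0 t1]; have [|Uy P] := rP (x0 + t *: h).
    apply/cV_ballP; split => // i; rewrite !mxE opprD addrA subrr add0r normrN normrM.
    by rewrite ger0_norm// (le_lt_trans _ (hr i))// ler_piMl.
  by split => // i j; have [_] := P i; exact.
have dline f (t : R) : C1_on U f -> 0 <= t <= 1 ->
    is_derive t (1 : R) (fun s : R => f (x0 + s *: h))
      (\sum_j h j ord0 * partial j f (x0 + t *: h)).
  move=> C1f /inU[Ut _]; have [d1 d2] := is_derive_C1 h oU C1f Ut.
  by rewrite -d2; exact: is_derive_line.
pose g (t : R) := phi (x0 + t *: h).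
pose g1 (t : R) := \sum_i h i ord0 * partial i phi (x0 + t *: h).
pose g2 (t : R) := \sum_i h i ord0 *
  \sum_j h j ord0 * partial j (partial i phi) (x0 + t *: h).
have dg (t : R) : 0 <= t <= 1 -> is_derive t (1 : R) g (g1 t).
  by move=> t01; apply: dline => //; exact: C2.1.
have dg1 (t : R) : 0 <= t <= 1 -> is_derive t (1 : R) g1 (g2 t).
  move=> t01; apply: is_derive_fsum => i.
  have := dline _ t (C2.2 i) t01 => ?; exact: is_deriveZ.
pose Q := quad_form (hessian phi x0) h - del * quad_form Y h.
have g2Q (t : R) : 0 <= t <= 1 -> Q <= g2 t.
  move=> t01; have [_ P] := inU t t01.
  rewrite /Q lerBlDr -lerBlDl.
  have -> : quad_form (hessian phi x0) h - g2 t = \sum_i \sum_j h i ord0 *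
     (h j ord0 * (partial j (partial i phi) x0 - partial j (partial i phi) (x0 + t *: h))).
    rewrite quad_formE -sumrB; apply: eq_bigr => i _.
    rewrite mulr_sumr -sumrB; apply: eq_bigr => j _.
    by rewrite (hessianE phi x0 j i) -!mulrBr.
  apply: (@le_trans _ _ (\sum_(i < n) \sum_(j < n) Lam * quad_form Y h * eta)).
    apply: ler_sum => i _; apply: ler_sum => j _.
    rewrite (le_trans (ler_norm _))// mulrA normrM distrC.
    apply: (ler_pM _ _ _ (P i j)) => //.
    have ci := co h i; have cj := co h j.
    have := sqr_ge0 (`|h i ord0| - `|h j ord0|).
    rewrite normrM sqrrB !real_normK ?num_real//.
    move: ci cj; move: (`|_| * `|_|) (Lam * _) ((h i ord0) ^+ 2) ((h j ord0) ^+ 2).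
    move=> *; lra.
  rewrite !sumr_const card_ord -[leLHS]mulr_natl -[X in n%:R * X]mulr_natl !mulrA /eta.
  have -> : n%:R * n%:R * Lam * quad_form Y h * del / (n%:R * n%:R * Lam + 1) =
     (del * quad_form Y h) * (n%:R * n%:R * Lam / (n%:R * n%:R * Lam + 1)).
    by field; rewrite gt_eqF.
  rewrite ler_piMr ?mulr_ge0// ?(ltW del0)// ler_pdivrMr// mul1r lerDl//.
have := taylor2_lower dg dg1 g2Q.
rewrite /g /g1 scale1r scale0r addr0 //.
Qed.

End C2_functions.

(** * The converse *)

Section converse.
Context {R : realType} {n : nat}.
Local Notation mu := (@lebesgue_cV R n).
Implicit Types (x y : 'cV[R]_n).

Lemma le_integral_minorant (D : set 'cV[R]_n) (f v : 'cV[R]_n -> \bar R) :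
  measurable D -> measurable_fun D f -> measurable_fun D v ->
  (forall x, D x -> (f x <= v x)%E) ->
  (\int[mu]_(x in D) f x <= \int[mu]_(x in D) v x)%E.
Proof.
move=> mD mf mv fv; rewrite integralE [leRHS]integralE; apply: leeB.
  apply: ge0_le_integral => //; try exact: measurable_funepos.
  by move=> x Dx; rewrite !funeposE ge_max !le_max lexx orbT fv.
apply: ge0_le_integral => //; try exact: measurable_funeneg.
by move=> x Dx; rewrite !funenegE ge_max !le_max lexx orbT leeN2 fv.
Qed.

Variables Z : 'M[R]_n.
Local Notation Y := (invmx Z).
Hypotheses (symZ : Z^T = Z) (unitZ : Z \in unitmx).
Variable Lam : R.
Local Notation q := (quad_form Y).
Hypothesis coercive : forall (x : 'cV[R]_n) i, (x i ord0) ^+ 2 <= Lam * q x.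
Hypothesis Lam_gt0 : 0 < Lam.
Hypothesis n_gt0 : (0 < n)%N.

Let symY : Y^T = Y. Proof. by rewrite trmx_inv symZ. Qed.
Let ZY : Z *m Y = 1%:M. Proof. by rewrite mulmxV. Qed.

Lemma Rintegral_quad_form_gt0 s : 0 < s -> 0 < \int[mu]_(x in qball Y s) q x.
Proof.
move=> s0.
pose A := qball Y s `&` [set x | s / 2 < q x].
have oA : open A.
  apply: openI; first exact: qball_open.
  apply: (open_comp (f := q) (D := [set y | s / 2 < y])); last exact: open_gt.
  by move=> x _; exact: quad_form_continuous.
have A0 : A !=set0.
  pose e : 'cV[R]_n := delta_mx (Ordinal n_gt0) ord0.
  have qe : 0 < q e.
    rewrite lt_neqAle (quad_form_ge0 coercive Lam_gt0 n_gt0) andbT eq_sym.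
    apply/eqP => /(quad_form_eq0 coercive)/colP/(_ (Ordinal n_gt0)).
    by rewrite !mxE !eqxx => /eqP; rewrite oner_eq0.
  (* Scaled so that [q (c *: e) = 3 s / 4], inside the shell [s / 2 < q < s]. *)
  pose c := Num.sqrt (3 * s / (4 * q e)).
  have c2 : c ^+ 2 = 3 * s / (4 * q e) by rewrite sqr_sqrtr// divr_ge0 ?mulr_ge0 ?ltW.
  have qc : q (c *: e) = 3 * s / 4.
    have -> : q (c *: e) = c ^+ 2 * q e.
      have mxZ i : (c *: e) i ord0 = c * e i ord0 by rewrite mxE.
      rewrite !quad_formE mulr_sumr; apply: eq_bigr => i _.
      by rewrite mulr_sumr; apply: eq_bigr => j _; rewrite !mxZ; ring.
    by rewrite c2; field; rewrite gt_eqF.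
  by exists (c *: e); split; rewrite /qball /= qc; lra.
have mA : measurable A by exact: open_measurable_cV.
have mS : measurable (qball Y s) by exact: qball_measurable.
have AS : A `<=` qball Y s by move=> x [].
have muA : (0 < mu A)%E by exact: open_lebesgue_cV_gt0.
have Aoo : (mu A < +oo)%E.
  by rewrite (le_lt_trans _ (qball_lty coercive Lam_gt0 s))// le_measure ?inE.
have pq : polyf q by exact: polyf_quad_form.
have iS := qball_integrable coercive Lam_gt0 s pq.
have q0 := quad_form_ge0 coercive Lam_gt0 n_gt0.
have h1 : s / 2 * fine (mu A) <= \int[mu]_(x in qball Y s) q x.
  rewrite -lee_fin /Rintegral fineK; last exact: integrable_fin_num.
  apply: (@le_trans _ _ (\int[mu]_(x in A) (q x)%:E)%E); last first.
    apply: ge0_subset_integral => //; first exact: measurable_int iS.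
    by move=> x _; rewrite lee_fin.
  rewrite EFinM fineK ?ge0_fin_numE// -integral_cst//.
  apply: ge0_le_integral => //.
  - by move=> x _; rewrite lee_fin divr_ge0// ltW.
  - by apply: measurable_funS (measurable_int _ iS).
  - by move=> x [_ /ltW]; rewrite lee_fin.
by apply: lt_le_trans h1; rewrite mulr_gt0 ?divr_gt0// fine_gt0// muA.
Qed.

(** With [T = mx_inner Z H], the form [quad_form H - (T / n) q] is harmonic of degree 2 and the
    linear part is harmonic of degree 1; both integrate to 0, leaving [c] and a multiple of [q]. *)
Lemma Rintegral_paraboloid s (c : R) (g : 'I_n -> R) (H : 'M[R]_n) : H^T = H ->
  \int[mu]_(x in qball Y s) (c + \sum_i x i ord0 * g i + quad_form H x / 2) =
  c * fine (mu (qball Y s)) +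
    mx_inner Z H / (2 * n%:R) * \int[mu]_(x in qball Y s) q x.
Proof.
move=> symH.
have mS : measurable (qball Y s) by exact: qball_measurable.
have iS f : polyf f -> mu.-integrable (qball Y s) (EFin \o f).
  exact: (qball_integrable coercive Lam_gt0).
have n0 : n%:R != 0 :> R by rewrite pnatr_eq0 -lt0n.
have pq X : polyf (quad_form X : 'cV[R]_n -> R) by exact: polyf_quad_form.
pose T := mx_inner Z H.
pose h2 x := quad_form H x + - (T / n%:R) * q x.
have hq X : hpoly 2 (quad_form X : 'cV[R]_n -> R).
  by apply: hpoly_ext (hpoly_quad_formM X (hpoly_cst 1)) => x; rewrite mulr1.
have hh2 : Lharmonic Z 2 h2.
  split; first exact: hpolyD (hq H) (hpolyZ _ (hq _)).
  move=> x; rewrite (LopD Z x (pq H) (polyfZ _ (pq _))).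
  rewrite (LopZ symZ _ _ (pq _)) (Lop_quad_form_tr symZ x symH).
  rewrite (Lop_quad_form symZ symY ZY) -/(mx_inner Z H) -/T.
  by field.
have I2 : \int[mu]_(x in qball Y s) h2 x = 0.
  rewrite -(harmonic_moment symZ symY ZY coercive Lam_gt0 s 0 hh2).
  by apply: eq_Rintegral => x _; rewrite expr0 mul1r.
have I1 : \int[mu]_(x in qball Y s) (\sum_i x i ord0 * g i) = 0.
  have pi i : polyf (fun x : 'cV[R]_n => x i ord0 * g i).
    by apply: polyfM; [exact: polyf_coor|exact: polyf_cst].
  apply: Rintegral_sum0 => // i; first exact: iS.
  have hi : Lharmonic Z 1 (fun x => x i ord0 * g i).
    split; first exact: hpolyX (hpoly_cst _).
    move=> x; rewrite (Lop_coorM symZ _ _ (polyf_cst _)) Lop_cst// mulr0 add0r.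
    rewrite /Zgrad big1 ?mulr0// => j _; by rewrite partial_cst mulr0.
  rewrite -(harmonic_moment symZ symY ZY coercive Lam_gt0 s 0 hi).
  by apply: eq_Rintegral => x _; rewrite expr0 mul1r.
have p1 : polyf (fun x : 'cV[R]_n => \sum_i x i ord0 * g i).
  by apply: polyf_sum => i; apply: polyfM; [exact: polyf_coor|exact: polyf_cst].
have p2 : polyf h2 by exact: hpoly_polyf hh2.1.
transitivity (\int[mu]_(x in qball Y s) (c + \sum_i x i ord0 * g i +
   2^-1 * h2 x + T / (2 * n%:R) * q x)).
  apply: eq_Rintegral => x _; rewrite /h2.
  by move: (quad_form H x) (q x) (\sum_i _) => *; field.
have p01 : polyf (fun x : 'cV[R]_n => c + \sum_i x i ord0 * g i).
  exact: polyfD (polyf_cst c) p1.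
have p012 := polyfD p01 (polyfZ (2^-1) p2).
rewrite (RintegralD mS (iS _ p012) (iS _ (polyfZ _ (pq _)))).
rewrite (RintegralD mS (iS _ p01) (iS _ (polyfZ _ p2))).
rewrite (RintegralD mS (iS _ (polyf_cst c)) (iS _ p1)).
rewrite (RintegralZl _ mS (iS _ p2)) (RintegralZl _ mS (iS _ (pq _))).
by rewrite Rintegral_cst// I1 I2 mulr0 !addr0.
Qed.

Variables (Omega : set 'cV[R]_n) (u : 'cV[R]_n -> \bar R).
Hypotheses (oO : open Omega) (lscu : lsc_on Omega u).

(** If the trace were positive, the minorant would have mean strictly above [c], since [q] has
    positive integral. *)
Lemma touching_trace_le0 x0 (eps c del : R) (g : 'I_n -> R) (H : 'M[R]_n) :
  0 < eps -> ellipsoid Z x0 eps `<=` Omega -> H^T = H ->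
  del = mx_inner Z H / (2 * n%:R) ->
  (forall h, q h < eps ^+ 2 ->
    ((c + \sum_i h i ord0 * g i + (quad_form H h - del * q h) / 2)%:E <=
      u (x0 + h)%R)%E) ->
  (mean_value (ellipsoid Z x0 eps) u <= c%:E)%E ->
  mx_inner Z H <= 0.
Proof.
move=> e0 EO symH delE lower mean; rewrite leNgt; apply/negP => T0.
have mE : measurable (ellipsoid Z x0 eps).
  by apply: open_measurable_cV; exact: ellipsoid_open.
have [mv intE] := integral_ellipsoid (lsc_on_measurable oO lscu EO mE).
have := (mean_value_le u c (ellipsoid_gt0 Z x0 e0)
  (ellipsoid_lty coercive Lam_gt0 x0 eps)).1 mean.
rewrite intE lebesgue_ellipsoid; apply/negP; rewrite -ltNge.
set S := qball Y (eps ^+ 2) in mv *.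
have mS : measurable S by exact: qball_measurable.
(* As [tr (Z Y) = n], the choice of [del] gives up exactly half of the trace:
   [mx_inner Z X = mx_inner Z H / 2]. *)
pose X := H - del *: Y.
have symX : X^T = X by rewrite /X linearB /= linearZ /= symH symY.
have XE h : quad_form X h = quad_form H h - del * q h.
  rewrite /quad_form /X mulmxBr mulmxBl -scalemxAr -scalemxAl.
  have subE (A B : 'M[R]_1) : (A - B) ord0 ord0 = A ord0 ord0 - B ord0 ord0.
    by rewrite !mxE.
  have scaleE (a : R) (B : 'M[R]_1) : (a *: B) ord0 ord0 = a * B ord0 ord0.
    by rewrite !mxE.
  by rewrite subE scaleE.
pose P (h : 'cV[R]_n) := c + \sum_i h i ord0 * g i + quad_form X h / 2.
have pP : polyf P.
  apply: polyfD; last by apply: polyfM; [exact: polyf_quad_form|exact: polyf_cst].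
  apply: polyfD; first exact: polyf_cst.
  by apply: polyf_sum => i; apply: polyfM; [exact: polyf_coor|exact: polyf_cst].
have iP := qball_integrable coercive Lam_gt0 (eps ^+ 2) pP.
have le1 : (\int[mu]_(x in S) (P x)%:E <= \int[mu]_(x in S) u (x + x0)%R)%E.
  apply: le_integral_minorant => //; first exact: measurable_int iP.
  by move=> x Sx; rewrite /P XE [x + x0]addrC; exact: lower.
apply: lt_le_trans le1.
rewrite -[X in (_ < X)%E]fineK; last exact: integrable_fin_num.
rewrite -/(Rintegral mu S P).
have := Rintegral_paraboloid (eps ^+ 2) c g symX; rewrite -/P -/S => ->.
have Soo : mu S \is a fin_num.
  by rewrite ge0_fin_numE// (qball_lty coercive Lam_gt0).
rewrite -{1}(fineK Soo) -EFinM lte_fin ltrDl mulr_gt0//; last first.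
  by apply: Rintegral_quad_form_gt0; rewrite exprn_gt0.
have n0 : 0 < n%:R :> R by rewrite ltr0n.
have -> : mx_inner Z X = mx_inner Z H / 2.
  rewrite /mx_inner /X mulmxBr -scalemxAr linearB /= linearZ /= ZY mxtrace1.
  rewrite delE /mx_inner; field; rewrite gt_eqF//.
by rewrite !divr_gt0// mulr_gt0.
Qed.

(** The lower bound [b] makes the integral of the negative part finite, while the positive part is
    infinite on a set of positive measure. *)
Lemma open_pinfty_mean_value y eps (A : set 'cV[R]_n) (b : R) :
  0 < eps -> ellipsoid Z y eps `<=` Omega ->
  open A -> A `<=` ellipsoid Z y eps -> A !=set0 -> (forall x, A x -> u x = +oo%E) ->
  (forall x, ellipsoid Z y eps x -> (b%:E <= u x)%E) ->
  mean_value (ellipsoid Z y eps) u = +oo%E.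
Proof.
move=> e0 EO oA AE A0 uA ub; set E := ellipsoid Z y eps in EO AE ub *.
have mE : measurable E by apply: open_measurable_cV; exact: ellipsoid_open.
have mA : measurable A by exact: open_measurable_cV.
have mu_ := lsc_on_measurable oO lscu EO mE.
have muE := ellipsoid_gt0 Z y e0.
have Eoo := ellipsoid_lty coercive Lam_gt0 y eps.
have muA := open_lebesgue_cV_gt0 oA A0.
have up : (\int[mu]_(x in E) u^\+ x)%E = +oo%E.
  apply/eqP; rewrite -leye_eq.
  apply: (@le_trans _ _ (\int[mu]_(x in A) u^\+ x)%E); last first.
    by apply: ge0_subset_integral => //; exact: measurable_funepos.
  rewrite (eq_integral (cst +oo%E)) => [|x /[!inE] Ax].
    by rewrite integral_cst// gt0_mulye.
  by rewrite funeposE uA.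
have um : (\int[mu]_(x in E) u^\- x < +oo)%E.
  apply: (@le_lt_trans _ _ (\int[mu]_(x in E) `|b|%:E)%E).
    apply: ge0_le_integral => //; first exact: measurable_funeneg.
    move=> x Ex; rewrite funenegE ge_max lee_fin normr_ge0 andbT leeNl.
    by apply: le_trans (ub x Ex); rewrite -EFinN lee_fin lerNl -normrN ler_norm.
  by rewrite integral_cst// lte_mul_pinfty.
rewrite /mean_value integralE up addye; last first.
  by apply: contraTneq um => /(congr1 oppe); rewrite oppeK => ->.
have Efin : mu E \is a fin_num by rewrite ge0_fin_numE.
have r0 : 0 < fine (mu E) by rewrite fine_gt0// muE.
rewrite -(fineK Efin) inver gt_eqF// gt0_muley// lte_fin invr_gt0//.
Qed.

End converse.

(** * The two implications for [F] and [K] *)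

Section characterization.
Context {R : realType} {n : nat}.
Implicit Types (x y : 'cV[R]_n) (Z : 'M[R]_n).
Variables (F : 'M[R]_n -> R) (K : set 'M[R]_n).
Hypotheses (hF : sublinear F) (hFe : uniformly_elliptic F)
  (hK : associated_convex_body F K) (n_gt0 : (0 < n)%N).
Variables (Omega : set 'cV[R]_n) (u : 'cV[R]_n -> \bar R).
Hypotheses (oO : open Omega) (uNy : forall x, Omega x -> (-oo < u x)%E).

Lemma hessian_sym U phi x : open U -> C2_on U phi -> U x -> Sym (hessian phi x).
Proof.
move=> oU C2 Ux; rewrite /Sym /=; apply/matrixP => i j.
rewrite [LHS]mxE; transitivity (partial j (partial i phi) x).
  exact: hessianE.
transitivity (partial i (partial j phi) x); last exact/esym/hessianE.
exact: (schwarz j i oU C2 Ux).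
Qed.

Lemma convex_body_coercive : exists Lam : R, 0 < Lam /\
  forall Z, K Z -> [/\ Z^T = Z, Z \in unitmx &
    forall x i, (x i ord0) ^+ 2 <= Lam * quad_form (invmx Z) x].
Proof.
have [lam [Lam [lam0 Lam0 bd]]] := convex_body_bounds hF hFe hK.
exists Lam; split => // Z KZ; have [_ _ _ KS _] := hK.
have symZ : Z^T = Z by exact: KS.
split => //; first exact: posdef_unitmx lam0 (bd Z KZ).
by move=> x i; exact: (quad_form_invmx_coercive symZ lam0 Lam0 (bd Z KZ)).
Qed.

Lemma viscosity_mean_value y0 eps : viscosity_supersolution F Omega u ->
  Omega y0 -> 0 < eps ->
  \bigcup_(Z in K) ellipsoid Z y0 eps `<=` Omega ->
  (ereal_sup [set mean_value (ellipsoid Z y0 eps) u | Z in K] <= u y0)%E.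
Proof.
move=> [lscu _ visc] Oy0 e0 EO.
have [Lam [Lam0 co]] := convex_body_coercive.
apply: ge_ereal_sup => _ [Z KZ <-].
have [symZ uZ coZ] := co Z KZ.
apply: (superharmonic_mean_value symZ uZ coZ Lam0 n_gt0 oO lscu uNy) => //; last first.
  by move=> y Ey; apply: EO; exists Z.
move=> x0 U phi Ox0 oU Ux0 C2 eqx nx.
have [_ _ _ _ supp] := hK.
have [_ s] := supp _ (hessian_sym oU C2 Ux0).
exact: le_trans (s Z KZ) (visc x0 U phi Ox0 oU Ux0 C2 eqx nx).
Qed.

Lemma ball_connected_component x (r : R) y : ball x r `<=` Omega -> ball x r y ->
  connected_component Omega x y.
Proof.
move=> BO By; have /cV_ballP[r0 xy] := By.
pose s (t : R) := x + t *: (y - x).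
have cs : continuous s.
  have -> : s = (fun z => z + x) \o (fun t : R => t *: (y - x)).
    by apply/funext => t; rewrite /s /= addrC.
  move=> t; apply: continuous_comp; first exact: scalel_continuous.
  exact: cV_shift_continuous.
have S1 : [set s t | t in `[0, 1]%classic] y.
  by exists 1; [rewrite /= in_itv /= ler01 lexx|rewrite /s scale1r addrC subrK].
have S0 : [set s t | t in `[0, 1]%classic] x.
  by exists 0; [rewrite /= in_itv /= ler01 lexx|rewrite /s scale0r addr0].
have SO : [set s t | t in `[0, 1]%classic] `<=` Omega.
  move=> _ [t + <-]; rewrite /= in_itv /= => /andP[t0 t1].
  apply: BO; apply/cV_ballP; split => // i.
  rewrite /s !mxE opprD addrA subrr add0r normrN normrM ger0_norm//.
  by rewrite (le_lt_trans _ (xy i))// distrC ler_piMl.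
exists [set s t | t in `[0, 1]%classic] => //; split => //.
apply: connected_continuous_connected; first exact: segment_connected.
exact: continuous_subspaceT.
Qed.

(** A ball in [Omega] around [x] lies in the component of [x] and contains a point where [u] is
    finite. *)
Lemma finite_dense_component : finite_on_dense_subset Omega u ->
  not_identically_pinfty Omega u.
Proof.
move=> dense x Ox; have := oO; rewrite openE => /(_ x Ox) /nbhs_ballP[r /= r0 rO].
have [y [[Oy uy] xy]] := dense x Ox _ (nbhsx_ballx x r r0).
exists y; first exact: ball_connected_component rO xy.
by move: uy => /=; rewrite fin_numE => /andP[].
Qed.

Hypothesis lscu : lsc_on Omega u.
Hypothesis mean_le : forall (y0 : 'cV[R]_n) (eps : R), Omega y0 -> 0 < eps ->
  \bigcup_(Z in K) ellipsoid Z y0 eps `<=` Omega ->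
  (ereal_sup [set mean_value (ellipsoid Z y0 eps) u | Z in K] <= u y0)%E.

(** The coercivity constant is common to all of [K], so one [eps] serves every [Z], as the condition
    on the union of the ellipsoids demands. The choice [eps = r / (Lam + 1)] works because
    [Lam <= (Lam + 1)^2]. *)
Lemma small_ellipsoids (r : R) : 0 < r -> exists2 eps : R, 0 < eps &
  forall Z y x, K Z -> quad_form (invmx Z) (x - y) <= eps ^+ 2 ->
    forall i, `|x i ord0 - y i ord0| <= r.
Proof.
move=> r0; have [Lam [Lam0 co]] := convex_body_coercive.
have L1 : 0 < Lam + 1 by rewrite ltr_wpDl// ltW.
exists (r / (Lam + 1)); first by rewrite divr_gt0.
move=> Z y x KZ qxy i; have [_ _ coZ] := co Z KZ.
have h := coZ (x - y) i.
have xyE : (x - y) i ord0 = x i ord0 - y i ord0 by rewrite !mxE.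
rewrite xyE in h.
rewrite -(@ler_pXn2r _ 2)// ?nnegrE ?(ltW r0)// real_normK ?num_real//.
rewrite (le_trans h)//.
apply: (@le_trans _ _ (Lam * (r / (Lam + 1)) ^+ 2)); first by rewrite ler_wpM2l// ltW.
rewrite expr_div_n mulrA ler_pdivrMr ?exprn_gt0// mulrC ler_wpM2l ?sqr_ge0//.
rewrite sqrrD expr1n mulr1; have := sqr_ge0 Lam; lra.
Qed.

Lemma mean_value_ellipsoid_le Z y0 eps : K Z -> Omega y0 -> 0 < eps ->
  \bigcup_(Z in K) ellipsoid Z y0 eps `<=` Omega ->
  (mean_value (ellipsoid Z y0 eps) u <= u y0)%E.
Proof.
move=> KZ Oy0 e0 EO; apply: le_trans (mean_le Oy0 e0 EO).
by apply: ereal_sup_ubound; exists Z.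
Qed.

Lemma touching_le0 x0 U phi : Omega x0 -> open U -> U x0 -> C2_on U phi ->
  (phi x0)%:E = u x0 -> (\forall x \near x0, ((phi x)%:E <= u x)%E) ->
  F (hessian phi x0) <= 0.
Proof.
move=> Ox0 oU Ux0 C2 eqx nx.
have symH := hessian_sym oU C2 Ux0.
have [_ _ _ _ supp] := hK.
(* The maximum is attained at some [Z], so the claim concerns the trace for this one matrix. *)
have [[Z KZ ->] _] := supp _ symH.
have [Lam [Lam0 co]] := convex_body_coercive.
have [symZ uZ coZ] := co Z KZ.
rewrite leNgt; apply/negP => T0.
set H := hessian phi x0 in symH T0 *.
pose del := mx_inner Z H / (2 * n%:R).
have del0 : 0 < del by rewrite divr_gt0// mulr_gt0// ltr0n.
have [r1 r10 low] := C2_taylor_lower oU C2 Ux0 Lam0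
  (quad_form_ge0 coZ Lam0 n_gt0) coZ del0.
have nO : \forall x \near x0, Omega x by apply: open_nbhs_nbhs.
have [r2 /= r20 r2P] := (nbhs_ballP _ _).1 (filterI nx nO).
(* The half turns the non-strict bound [<= r] on the ellipsoids into the strict bounds by [r1] and
   [r2]. *)
pose r := Num.min r1 r2 / 2.
have m0 : 0 < Num.min r1 r2 by rewrite lt_min r10.
have r0 : 0 < r by rewrite divr_gt0.
have rm : r < Num.min r1 r2 by rewrite /r; move: m0; move: (Num.min r1 r2) => m; lra.
have rr1 : r < r1 by rewrite (lt_le_trans rm)// ge_min lexx.
have rr2 : r < r2 by rewrite (lt_le_trans rm)// ge_min lexx orbT.
have [eps e0 small] := small_ellipsoids r0.
have EO : \bigcup_(Z in K) ellipsoid Z x0 eps `<=` Omega.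
  move=> x [Z' KZ' /ltW Ex].
  have [] // : ((phi x)%:E <= u x)%E /\ Omega x.
  apply: r2P; apply/cV_ballP; split => // i; rewrite distrC.
  exact: le_lt_trans (small Z' x0 x KZ' Ex i) rr2.
have mean := mean_value_ellipsoid_le KZ Ox0 e0 EO.
rewrite -eqx in mean.
have EOZ : ellipsoid Z x0 eps `<=` Omega by move=> x Ex; apply: EO; exists Z.
have := touching_trace_le0 symZ uZ coZ Lam0 n_gt0 oO lscu
  (g := fun i => partial i phi x0) e0 EOZ symH (erefl del) _ mean.
rewrite leNgt T0 => /(_ _)/negP; apply => // h hq.
have hi i : `|h i ord0| <= r.
  have := small Z x0 (x0 + h) KZ; rewrite addrC addKr => /(_ (ltW hq) i).
  by rewrite [(x0 + h) _ _]mxE [x0 _ _ + _]addrC addrK.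
have h1 i : `|h i ord0| < r1 by exact: le_lt_trans (hi i) rr1.
have [ph _] : ((phi (x0 + h))%:E <= u (x0 + h)%R)%E /\ Omega (x0 + h).
  apply: r2P; apply/cV_ballP; split => // i.
  rewrite mxE opprD addrA subrr add0r normrN.
  exact: le_lt_trans (hi i) rr2.
by apply: le_trans ph; rewrite lee_fin; exact: low.
Qed.

Let W := [set x | Omega x /\ \forall y \near x, u y = +oo%E].

Let W_open : open W.
Proof.
rewrite openE => x [Ox nx].
have nO : \forall y \near x, Omega y by apply: open_nbhs_nbhs.
exact: filterI nO (near_join nx).
Qed.

(** The ellipsoids are centred at the points [y] near [x0]: each contains [x0], hence meets the open
    set [W], so its mean is infinite and [u y] is too. Thus [u] is infinite on a whole neighbourhood
    of [x0]. *)
Lemma pinfty_interior_closed (x0 : 'cV[R]_n) : Omega x0 -> closure W x0 -> W x0.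
Proof.
move=> Ox0 clx; split => //.
have [Lam [Lam0 co]] := convex_body_coercive.
have [[Z KZ] _ _ _ _] := hK.
have [symZ uZ coZ] := co Z KZ.
have := oO; rewrite openE => /(_ x0 Ox0) /nbhs_ballP[r /= r0 rO].
(* One half for the distance from [x0] to [y], the other for the ellipsoid around [y]. *)
have r20 : 0 < r / 2 by rewrite divr_gt0.
have [eps e0 small] := small_ellipsoids r20.
have nb : \forall y \near x0, ball x0 (r / 2) y by exact: nbhsx_ballx.
have nq : \forall y \near x0, quad_form (invmx Z) (x0 - y) < eps ^+ 2.
  have pq : polyf (fun y => quad_form (invmx Z) (x0 - y)).
    apply: (polyf_ext _ (polyf_shift (- x0) (polyf_quad_form (invmx Z)))) => y.
    have mxB i : (y - x0) i ord0 = - (x0 - y) i ord0 by rewrite !mxE opprB.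
    rewrite !quad_formE; apply: eq_bigr => i _; apply: eq_bigr => j _.
    by rewrite !mxB; ring.
  have c := polyf_continuous pq.
  have q0 : quad_form (invmx Z) (x0 - x0) < eps ^+ 2.
    by rewrite subrr quad_form0 exprn_gt0.
  exact: (cvgr_lt _ (c x0) _ q0).
near=> y.
have By : ball x0 (r / 2) y by near: y.
have qy : quad_form (invmx Z) (x0 - y) < eps ^+ 2 by near: y.
have cover Z' x : K Z' -> quad_form (invmx Z') (x - y) <= eps ^+ 2 -> Omega x.
  move=> KZ' qx; apply: rO; apply/cV_ballP; split => // i.
  have h := small Z' y x KZ' qx i; have /cV_ballP[_ /(_ i) h2] := By.
  rewrite [ltRHS]splitr (le_lt_trans (ler_distD (y i ord0) _ _))// ltr_leD//.
  by rewrite distrC.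
have EO : \bigcup_(Z in K) ellipsoid Z y eps `<=` Omega.
  by move=> x [Z' KZ' /ltW]; exact: cover.
have EOZ : ellipsoid Z y eps `<=` Omega by move=> x Ex; apply: EO; exists Z.
have Oy : Omega y by apply: EOZ; exact: ellipsoid_center.
have cC : compact [set x | quad_form (invmx Z) (x - y) <= eps ^+ 2].
  exact: (cqball_compact coZ Lam0).
have [b bu] : exists b : R, forall x,
    [set x | quad_form (invmx Z) (x - y) <= eps ^+ 2] x -> (b%:E < u x)%E.
  apply: (lsc_lower_bound oO lscu uNy) => //.
    by exists y; rewrite /= subrr quad_form0 sqr_ge0.
  by move=> x; exact: cover.
have mean := mean_value_ellipsoid_le KZ Oy e0 EO.
apply/eqP; rewrite -leye_eq; apply: le_trans mean; rewrite leye_eq; apply/eqP.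
have Ex0 : ellipsoid Z y eps x0 by [].
have [w [Ww Ew]] := clx _ (open_nbhs_nbhs (conj (@ellipsoid_open R n Z y eps) Ex0)).
apply: (@open_pinfty_mean_value _ _ Z Lam coZ Lam0 Omega u oO lscu y eps
  (W `&` ellipsoid Z y eps) b) => //.
- by apply: openI => //; exact: ellipsoid_open.
- by exists w.
- by move=> x [[_ /nbhs_singleton]].
- by move=> x /ltW Ex; exact/ltW/bu.
Unshelve. all: by end_near. Qed.

Lemma finite_dense : not_identically_pinfty Omega u ->
  finite_on_dense_subset Omega u.
Proof.
move=> notpy x Ox; apply: contrapT => ncl.
have Wx : W x.
  split => //.
  have [B xB nB] : exists2 B, nbhs x B &
      ~ ((Omega `&` [set x | u x \is a fin_num]) `&` B !=set0).
    apply: contrapT => h; apply: ncl => B xB.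
    by apply: contrapT => nB; apply: h; exists B.
  have nO : \forall y \near x, Omega y by apply: open_nbhs_nbhs.
  apply: filterS (filterI xB nO) => y [By Oy].
  apply/eqP/negPn/negP => uy; apply: nB; exists y; split => //; split => //.
  by rewrite /= fin_numElt uNy//= ltey.
set C := connected_component Omega x.
have CO : C `<=` Omega by exact: connected_component_sub.
have cC : connected C by exact: component_connected.
have Cx : C x by exact: connected_component_refl.
(* In the connected component [C], the set [W] is nonempty, open and relatively closed. *)
have : C `&` W = C.
  apply: cC; first by exists x.
    by exists W => //; exact: W_open.
  exists (closure W); first exact: closed_closure.
  apply/seteqP; split => y [Cy Wy]; split => //; first exact: subset_closure.
  by apply: pinfty_interior_closed => //; exact: CO.
move=> CW; have [y Cy uy] := notpy x Ox.
have [_ [_ /nbhs_singleton uyy]] : (C `&` W) y by rewrite CW.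
by rewrite uyy eqxx in uy.
Qed.

End characterization.

Theorem theorem4p2p1 (R : realType) (n : nat) (hn : (2 <= n)%N)
    (F : 'M[R]_n -> R) (K : set 'M[R]_n)
    (hF : sublinear F) (hFe : uniformly_elliptic F)
    (hK : associated_convex_body F K)
    (Omega : set 'cV[R]_n) (hO0 : Omega !=set0) (hO : open Omega)
    (u : 'cV[R]_n -> \bar R)
    (hu : forall x, Omega x -> (-oo < u x)%E) :
  viscosity_supersolution F Omega u <->
  [/\ not_identically_pinfty Omega u,
      lsc_on Omega u &
      forall (y0 : 'cV[R]_n) (eps : R), Omega y0 -> 0 < eps ->
        \bigcup_(Z in K) ellipsoid Z y0 eps `<=` Omega ->
        (ereal_sup [set mean_value (ellipsoid Z y0 eps) u | Z in K]
           <= u y0)%E].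
Proof.
have n0 : (0 < n)%N by exact: ltnW.
split=> [visc|[notpy lscu mean]].
  have [lscu dense _] := visc; split => //.
    exact: finite_dense_component dense.
  move=> y0 eps Oy0 e0 EO.
  exact: (viscosity_mean_value hF hFe hK n0 hO hu visc).
split => //.
  exact: (finite_dense hF hFe hK hO hu lscu mean notpy).
move=> x0 U phi Ox0 oU Ux0 C2 eqx nx.
exact: (touching_le0 hF hFe hK n0 hO lscu mean Ox0 oU Ux0 C2 eqx nx).
Qed.
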